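(* Let $t_0\in\mathbb T$ and $\mathcal G=\mathcal G_{\mathrm{tight}}$. Write $\mathcal G_1^0=\{\phi(\infty,\infty)\}$, $\mathcal G_2^0=\{\phi(\infty,k_2):k_2\in\mathbb N\}$, $\mathcal G_3^0=\{\phi(k_1,\infty):k_1\in\mathbb N\}$, $\mathcal G_4^0=\{\phi(\bm k):\bm k\in\mathbb N^2\}$ for the four orbits of the unit space. For $i\in\{1,2,3,4\}$ and $u\in\mathcal G_i^0$ let $\mathcal K_i=\mathcal G_u^u\cong\mathbb Z$ be the isotropy group and let $L=L_{t_0}$ be the corresponding representation of $C^*(\mathcal K_i)$ on $\mathbb C$. The representations $\operatorname{Ind}_{\mathcal K_i}^{\mathcal G}L:C^*(\mathcal G)\to\mathcal L(\mathscr H^i_{\operatorname{Ind}L})$ induced by the isotropy groups $\mathcal K_i$ are as follows. (i) For $u\in\mathcal G_1^0=\{\phi(\infty,\infty)\}$: (a) $\{e_r:r\in\mathbb Z\}$ forms a basis for $\mathscr H^1_{\operatorname{Ind}L}$ and the inner product is $\langle e_{r_1},e_{r_2}\rangle=t_0^{r_2-r_1}$; (b) $\mathscr H^1_{\operatorname{Ind}L}\cong\mathbb C$ with the isomorphism $e_r\mapsto t_0^{-r}$; (c) $\operatorname{Ind}_{\mathcal K_1}^{\mathcal G}L\cong\Pi_{(1,t_0)}$ as a representation on $\mathscr H^1_{\operatorname{Ind}L}$. (ii) For $u\in\mathcal G_2^0=\{\phi(\infty,k_2):k_2\in\mathbb N\}$: (a) given $\bm s=(s_1,s_2)\in\mathbb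 N\times\mathbb Z$, $\{e_{\bm s}:s_2=0\}$ forms a basis for $\mathscr H^2_{\operatorname{Ind}L}$, and the inner product is $\langle e_{\bm s},e_{\bm u}\rangle=\delta_{s_1,u_1}t_0^{u_2-s_2}$; (b) $\mathscr H^2_{\operatorname{Ind}L}\cong\ell^2(\mathbb N)$ with the isomorphism $e_{\bm s}\mapsto t_0^{-s_2}e_{s_1}$; (c) $\operatorname{Ind}_{\mathcal K_2}^{\mathcal G}L\cong\Pi_{(\omega_2,t_0)}$ as a representation on $\mathscr H^2_{\operatorname{Ind}L}$. (iii) For $u\in\mathcal G_3^0=\{\phi(k_1,\infty):k_1\in\mathbb N\}$: (a) given $\bm s=(s_1,s_2)\in\mathbb N\times\mathbb Z$, $\{e_{\bm s}:s_2=0\}$ forms a basis for $\mathscr H^3_{\operatorname{Ind}L}$, and the inner product is $\langle e_{\bm s},e_{\bm u}\rangle=\delta_{s_1,u_1}t_0^{u_2-s_2}$; (b) $\mathscr H^3_{\operatorname{Ind}L}\cong\ell^2(\mathbb N)$ with the isomorphism $e_{\bm s}\mapsto t_0^{-s_2}e_{s_1}$; (c) $\operatorname{Ind}_{\mathcal K_3}^{\mathcal G}L\cong\Pi_{(\omega_1,t_0)}$ as a representation on $\mathscr H^3_{\operatorname{Ind}L}$. (iv) For $u\in\mathcal G_4^0=\{\phi(\bm k):\bm k\in\mathbb N^2\}$: (a) given $\bm s=(s_1,s_2,s_3)\in\mathbb N\times\mathbb N\times\mathbb Z$, $\{e_{\bm s}:s_3=0\}$ forms a basis for $\mathscr H^4_{\operatorname{Ind}L}$,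 and the inner product is $\langle e_{\bm s},e_{\bm u}\rangle=\delta_{(s_1,s_2),(u_1,u_2)}t_0^{u_3-s_3}$; (b) $\mathscr H^4_{\operatorname{Ind}L}\cong\ell^2(\mathbb N)\otimes\ell^2(\mathbb N)$ with the isomorphism $e_{\bm s}\mapsto t_0^{-s_3}(e_{s_1}\otimes e_{s_2})$; (c) $\operatorname{Ind}_{\mathcal K_4}^{\mathcal G}L\cong\Pi_{(\omega_1\omega_2,t_0)}$ as a representation on $\mathscr H^4_{\operatorname{Ind}L}$.
   Context: Notation: $\mathbb N=\{0,1,2,\dots\}$; $\overline{\mathbb N}=\mathbb N\cup\{\infty\}$ is its one-point compactification; $\mathcal L(\mathscr H)$ is the algebra of bounded operators on $\mathscr H$; $\{e_x:x\in X\}$ is the standard orthonormal basis of $\ell^2(X)$; $S$ and $\bm t$ are the left shifts on $\ell^2(\mathbb N)$ and $\ell^2(\mathbb Z)$; $p$ is the projection of $\ell^2(\mathbb N)$ onto $\mathbb Ce_0$; $\delta$ is the Kronecker delta. Generators: on $\ell^2(\mathbb N)\otimes\ell^2(\mathbb N)\otimes\ell^2(\mathbb Z)$ put $s_1^0=S^*\otimes S^*\otimes\bm t$, $s_2^0=-p\otimes S^*\otimes\bm t$, $s_3^0=-S^*\otimes p\otimes\bm t$, $s_4^0=-p\otimes p\otimes\bm t$. The $C^*$-algebra $D_0$ they generate is $C(SO_0(4)/SO_0(2))$, which is isomorphic to $C(SO_q(4)/SO_q(2))$ for $q\in(0,1)$. Inverse semigroup $T$: for $\bm n=(n_1,n_2),\bm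 m=(m_1,m_2)\in\mathbb N^2$ and $r\in\mathbb Z$ let $B_1(r,\bm n,\bm m)=S^{*n_1}S^{m_1}\otimes S^{*n_1}S^{m_1}\otimes\bm t^r$, $r=m_1-n_1$ (with $n_1=n_2$, $m_1=m_2$); $B_2(r,\bm n,\bm m)=S^{*n_1}S^{m_1}\otimes S^{*n_2}pS^{m_2}\otimes\bm t^r$, $r=m_1-n_1$, $n_1\ge n_2$, $m_1\ge m_2$; $B_3(r,\bm n,\bm m)=S^{*n_1}pS^{m_1}\otimes S^{*n_2}S^{m_2}\otimes\bm t^r$, $r=m_2-n_2$, $n_1\le n_2$, $m_1\le m_2$; $B_4(r,\bm n,\bm m)=S^{*n_1}pS^{m_1}\otimes S^{*n_2}pS^{m_2}\otimes\bm t^r$, $r\in\mathbb Z$. $T$ consists of all these operators and $0$, with operator product and adjoint; it is regarded as the inverse semigroup generated by the $s_j^0$, and the $s_j^0$ are treated as elements of $T$. $E$ is the set of projections of $T$; its nonzero elements are $P_i(\bm n)=B_i(0,\bm n,\bm n)$ (with $n_1=n_2$ if $i=1$; $n_1\ge n_2$ if $i=2$; $n_1\le n_2$ if $i=3$). Characters: $\widehat E_0$ is the set of nonzero semigroup homomorphisms $x:E\to\{0,1\}$ with $x(0)=0$, with the topology inherited from $\{0,1\}^E$. A filter is a nonempty $A\subseteq E\setminus\{0\}$ closed under products and upward closed (for $e\le f\iff fe=e$); an ultrafilter is a maximal filter. $\widehat E_\infty$ is the set of $x\in\widehat E_0$ with $x^{-1}(1)$ an ultrafilter, and $\widehat E_{\mathrm{tight}}$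 is its closure. For $k_1,k_2\in\mathbb N$ put $\Lambda(k_1,k_2)=\{P_4((k_1,k_2))\}$, $\Lambda(k_1,\infty)=\{P_3((k_1,l)):l\in\mathbb N,\,l\ge k_1\}$, $\Lambda(\infty,k_2)=\{P_2((l,k_2)):l\in\mathbb N,\,l\ge k_2\}$, $\Lambda(\infty,\infty)=\{P_1((l,l)):l\in\mathbb N\}$. For $\bm k\in\overline{\mathbb N}^2$ let $A_{\Lambda(\bm k)}=\{f\in E:fe=e\text{ for some }e\in\Lambda(\bm k)\}$ and $\phi(\bm k)=1_{A_{\Lambda(\bm k)}}$. Then $\widehat E_{\mathrm{tight}}=\widehat E_\infty=\{\phi(\bm k):\bm k\in\overline{\mathbb N}^2\}$. Groupoid: for $s\in T$ let $D_s=\{x\in\widehat E_0:x(ss^* )=1\}$, and for $x\in D_s$ let $(x\cdot s)(e)=x(ses^* )$. On $\Sigma=\{(x,s):s\in T,\ x\in D_s\}$ let $(x,s)\sim(x,s')$ iff $es=es'$ for some $e\in E$ with $x(e)=1$. $\mathcal G'=\Sigma/\sim$ is a groupoid with $[(x,s)][(x\cdot s,s')]=[(x,ss')]$ and $[(x,s)]^{-1}=[(x\cdot s,s^* )]$, topologized by the basis of sets $\{[(x,s)]:x\in U\}$, $s\in T$, $U\subseteq D_s$ open; its unit space is $\widehat E_0$ via $[(x,1)]\leftrightarrow x$, so $[(x,s)]$ has range $x$ and source $x\cdot s$. $\mathcal G_{\mathrm{tight}}$ is the reduction of $\mathcal G'$ to $\widehat E_{\mathrm{tight}}$, with the Haar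 system of counting measures, and $C^*(\mathcal G_{\mathrm{tight}})$ is its full groupoid $C^*$-algebra. For a unit $u$, $\mathcal G_u$ is the set of elements with source $u$ and $\mathcal G_u^u$ the set of those with source and range $u$. Let $\Theta_s=\{[(x,s)]:x\in D_s\cap\widehat E_{\mathrm{tight}}\}$ and $a_j=1_{\Theta_{s_j^0}}$, $j=1,2,3,4$. The $a_j$ generate $C^*(\mathcal G_{\mathrm{tight}})$, and there is an isomorphism $C^*(\mathcal G_{\mathrm{tight}})\to D_0$ with $a_j\mapsto s_j^0$. Coordinates on $\mathcal G_u$ (for $r,s_2,s_3\in\mathbb Z$ and $s_1\in\mathbb N$; in (iv) also $s_2\in\mathbb N$): (i) $u=\phi(\infty,\infty)$: $\mathcal G_u=\mathcal G_u^u=\{\sigma_r:r\in\mathbb Z\}$, $\sigma_r=[(\phi(\infty,\infty),B_1(r,(0,0),(r,r)))]$ if $r\ge0$, $\sigma_r=[(\phi(\infty,\infty),B_1(r,(-r,-r),(0,0)))]$ if $r<0$. (ii) $u=\phi(\infty,k_2)$: $\rho_{(s_1,s_2)}=[(\phi(\infty,s_1),B_2(s_2,(s_1+k_2,s_1),(s_2+s_1+k_2,k_2)))]$ if $s_2\ge0$, $\rho_{(s_1,s_2)}=[(\phi(\infty,s_1),B_2(s_2,(s_1+k_2-s_2,s_1),(s_1+k_2,k_2)))]$ if $s_2<0$; $\mathcal G_u^u=\{\sigma_r=\rho_{(k_2,r)}:r\in\mathbb Z\}$. (iii) $u=\phi(k_1,\infty)$: $\rho_{(s_1,s_2)}=[(\phi(s_1,\infty),B_3(s_2,(s_1,s_1+k_1),(k_1,s_2+s_1+k_1)))]$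 if $s_2\ge0$, $\rho_{(s_1,s_2)}=[(\phi(s_1,\infty),B_3(s_2,(s_1,s_1+k_1-s_2),(k_1,s_1+k_1)))]$ if $s_2<0$; $\mathcal G_u^u=\{\sigma_r=\rho_{(k_1,r)}:r\in\mathbb Z\}$. (iv) $u=\phi(\bm k)$, $\bm k\in\mathbb N^2$: $\rho_{(s_1,s_2,s_3)}=[(\phi(s_1,s_2),B_4(s_3,(s_1,s_2),\bm k))]$; $\mathcal G_u^u=\{\sigma_r=[(\phi(\bm k),B_4(r,\bm k,\bm k))]:r\in\mathbb Z\}$. In (ii)–(iv) the $\rho_{\bm s}$ exhaust $\mathcal G_u$. The symbol $e_r$ in (i), respectively $e_{\bm s}$ in (ii)–(iv), denotes the vector of $\mathscr H^i_{\operatorname{Ind}L}$ given by the indicator function of $\sigma_r$, respectively of $\rho_{\bm s}$, in $C_c(\mathcal G_u)$. Induction: $L(f)=\sum_{n\in\mathbb Z}f(\sigma_n)t_0^n$ for $f\in C_c(\mathcal K_i)$, acting on $\mathscr H_L=\mathbb C$. For $\varphi,\psi\in C_c(\mathcal G_u)$ and $k\in\mathcal K_i$ put $\langle\varphi,\psi\rangle_*(k)=\sum_{y\in\mathcal G_u}\overline{\varphi(y)}\psi(yk)$. $\mathscr H^i_{\operatorname{Ind}L}$ is the Hilbert space completion of $C_c(\mathcal G_u)\otimes\mathscr H_L\cong C_c(\mathcal G_u)$ with respect to $\langle\varphi,\psi\rangle=L(\langle\varphi,\psi\rangle_* )$, and $\operatorname{Ind}_{\mathcal K_i}^{\mathcal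 G}L(a)\varphi=a*\varphi$ for $a\in C_c(\mathcal G)$, where $(a*\varphi)(x)=\sum_{y:\,r(y)=r(x)}a(y)\varphi(y^{-1}x)$ and $r(y)$ denotes the range of $y$. The representations $\Pi$ of $C(SO_q(4)/SO_q(2))\cong C(SO_0(4)/SO_0(2))$, compared with representations of $C^*(\mathcal G_{\mathrm{tight}})$ through $a_j\mapsto s_j^0$ (here $\omega_1,\omega_2$ are the commuting order-two generators of the Weyl group): $\Pi_{(\omega_1\omega_2,t_0)}$ on $\ell^2(\mathbb N)\otimes\ell^2(\mathbb N)$: $s_1^0\mapsto t_0(S^*\otimes S^* )$, $s_2^0\mapsto t_0(S^*\otimes p)$, $s_3^0\mapsto t_0(p\otimes S^* )$, $s_4^0\mapsto t_0(p\otimes p)$. $\Pi_{(\omega_1,t_0)}$ on $\ell^2(\mathbb N)$: $s_1^0\mapsto t_0S^*$, $s_2^0\mapsto0$, $s_3^0\mapsto t_0p$, $s_4^0\mapsto0$. $\Pi_{(\omega_2,t_0)}$ on $\ell^2(\mathbb N)$: $s_1^0\mapsto t_0S^*$, $s_2^0\mapsto t_0p$, $s_3^0\mapsto0$, $s_4^0\mapsto0$. $\Pi_{(1,t_0)}$ on $\mathbb C$: $s_1^0\mapsto t_0$, $s_2^0,s_3^0,s_4^0\mapsto0$.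
   Formalization: The t-exponent in B_i is -r instead of r, so that the generators lie in T; s_2^0 and s_3^0 are exchanged; ⟨φ,ψ⟩_* has the conjugate on ψ instead of φ; in (i)(a) ''basis'' means that the e_r are total and each single e_r is an orthonormal basis. *)

(* Defs.v *)
From HB Require Import structures.
From mathcomp Require Import all_boot all_order all_algebra.
From mathcomp Require Import complex.
From mathcomp Require Import all_classical all_reals all_analysis.
From mathcomp Require Import ring lra zify.
Set Implicit Arguments.
Unset Strict Implicit.
Unset Printing Implicit Defensive.
Import Order.TTheory GRing.Theory Num.Theory numFieldNormedType.Exports.
Local Open Scope classical_set_scope.
Local Open Scope ring_scope.

(* Typed as a numClosedFieldType, so that the norm topology of
   numFieldNormedType is inferred on the complex numbers. *)
Definition Cx (R : realType) : numClosedFieldType := R[i].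

Section CxTheory.
Variable R : realType.
Implicit Types (z : Cx R) (r : R).

Definition re z : R := complex.Re (z : R[i]).
Definition ofR r : Cx R := (r%:C)%C.

Lemma ofRK r : re (ofR r) = r. Proof. by []. Qed.
Lemma reK z : 0 <= z -> ofR (re z) = z.
Proof. by move=> /ger0_real/RRe_real. Qed.
Lemma le_re z1 z2 : z1 <= z2 -> re z1 <= re z2.
Proof. by rewrite lecE => /andP[]. Qed.
Lemma re_ge0 z : 0 <= z -> 0 <= re z.
Proof. exact: le_re. Qed.
Lemma ofR_le r1 r2 : (ofR r1 <= ofR r2) = (r1 <= r2).
Proof. exact: lecR. Qed.
Lemma ofR_lt r1 r2 : (ofR r1 < ofR r2) = (r1 < r2).
Proof. exact: ltcR. Qed.
Lemma reD z1 z2 : re (z1 + z2) = re z1 + re z2.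
Proof. by rewrite /re; case: z1 => a b; case: z2 => c d. Qed.
Lemma reB z1 z2 : re (z1 - z2) = re z1 - re z2.
Proof. by rewrite /re; case: z1 => a b; case: z2 => c d. Qed.
Lemma re_sum I (s : seq I) (h : I -> Cx R) :
  re (\sum_(x <- s) h x) = \sum_(x <- s) re (h x).
Proof. by elim: s => [|x s ih]; rewrite ?big_nil// !big_cons reD ih. Qed.
Lemma ofRD r1 r2 : ofR (r1 + r2) = ofR r1 + ofR r2.
Proof. exact: (rmorphD (real_complex R)). Qed.
Lemma ofRB r1 r2 : ofR (r1 - r2) = ofR r1 - ofR r2.
Proof. exact: (rmorphB (real_complex R)). Qed.
Lemma ofR_norm r : `|ofR r| = ofR `|r|.
Proof. by rewrite /ofR normc_def/= expr0n/= addr0 sqrtr_sqr. Qed.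
Lemma re_norm z : `|re z| <= re `|z|.
Proof. by rewrite -ofR_le reK//; exact: normc_ge_Re. Qed.
Lemma re_norm_sqr z : re `|z| ^+ 2 = re (`|z| ^+ 2).
Proof. by rewrite -[X in _ = re (X ^+ 2)]reK// -(rmorphXn (real_complex R)). Qed.

Lemma eps_real (e : Cx R) : 0 < e -> 0 < re e /\ ofR (re e) = e.
Proof.
by move=> e0; have := reK (ltW e0) => h; split=> //; rewrite -ofR_lt h.
Qed.

Lemma Rcauchy (u : nat -> R) :
  (forall e, 0 < e -> exists N, forall m n, (N <= m)%N -> (N <= n)%N ->
    `|u m - u n| < e) ->
  exists l, forall e, 0 < e -> exists N, forall n, (N <= n)%N -> `|u n - l| < e.
Proof.
move=> hu.
have /cauchy_cvgP : cauchy (u @ \oo).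
  apply/cauchy_exP => e e0; have [N hN] := hu e e0.
  by exists (u N), N => // n /= Nn; rewrite -ball_normE/=; exact: hN.
move=> /cvg_ex[l] /= ul; exists l => e e0.
have /cvgrPdist_lt/(_ e e0)[N _ hN] := ul.
by exists N => n Nn; rewrite distrC; exact: hN.
Qed.

Lemma Ccauchy (u : nat -> Cx R) :
  (forall e, 0 < e -> exists N, forall m n, (N <= m)%N -> (N <= n)%N ->
    `|u m - u n| < e) ->
  exists l, forall e, 0 < e -> exists N, forall n, (N <= n)%N -> `|u n - l| < e.
Proof.
move=> hu.
pose im z : R := complex.Im (z : R[i]).
have imB z1 z2 : im (z1 - z2) = im z1 - im z2.
  by rewrite /im; case: z1 => a b; case: z2 => c d.
have im_norm z : `|im z| <= re `|z|.
  rewrite /im /re normc_def/= -[`|complex.Im z|]sqrtr_sqr.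
  by rewrite ler_sqrt ?addr_ge0 ?sqr_ge0// lerDr sqr_ge0.
have norm_le z : `|z| <= ofR `|re z| + ofR `|im z|.
  rewrite -!ofR_norm {1}[z]complexE (le_trans (ler_normD _ _))// lerD//.
  by rewrite normrM complexiE normCi mul1r.
have aux (f : Cx R -> R) : (forall z1 z2, f (z1 - z2) = f z1 - f z2) ->
    (forall z, `|f z| <= re `|z|) ->
    exists l : R, forall e, 0 < e -> exists N, forall n, (N <= n)%N ->
      `|f (u n) - l| < e.
  move=> fB fn; apply: (@Rcauchy (f \o u)) => e e0.
  have [|N hN] := hu (ofR e); first by rewrite -[0]/(ofR 0) ofR_lt.
  exists N => m n Nm Nn /=; rewrite -fB (le_lt_trans (fn _))//.
  by rewrite -ofR_lt reK ?hN.
have [a ha] := aux re reB re_norm; have [b hb] := aux im imB im_norm.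
exists ((a +i* b)%C : R[i]) => e /eps_real[e0 <-].
have [|N1 h1] := ha (re e / 2); first by rewrite divr_gt0.
have [|N2 h2] := hb (re e / 2); first by rewrite divr_gt0.
exists (maxn N1 N2) => n; rewrite geq_max => /andP[/h1 k1 /h2 k2].
rewrite (le_lt_trans (norm_le _))// -ofRD ofR_lt.
by rewrite reB imB [re e]splitr ltrD.
Qed.

End CxTheory.

Section Sums.
Variables (R : realType) (X : choiceType).
Local Notation C := (Cx R).
Implicit Types (h : X -> C) (c : C).

(* Unconditional convergence along the finite subsets of [X]. *)
Definition is_sum h c := forall e : C, 0 < e -> exists s : seq X,
  forall s', uniq s' -> {subset s <= s'} -> `|\sum_(x <- s') h x - c| < e.

Definition csum h : C := xget 0 [set c | is_sum h c].

Lemma small_eq0 (d : C) : (forall e, 0 < e -> `|d| < e) -> d = 0.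
Proof.
move=> k; apply/eqP; apply: contraT => d0.
by have := k `|d|; rewrite normr_gt0 ltxx => /(_ d0).
Qed.

Lemma is_sum_unique h c1 c2 : is_sum h c1 -> is_sum h c2 -> c1 = c2.
Proof.
move=> h1 h2; apply/eqP; rewrite -subr_eq0; apply/eqP/small_eq0 => e e0.
have [|s1 k1] := h1 (e / 2); first by rewrite divr_gt0.
have [|s2 k2] := h2 (e / 2); first by rewrite divr_gt0.
have {}k1 : `|\sum_(x <- undup (s1 ++ s2)) h x - c1| < e / 2.
  by apply: k1; rewrite ?undup_uniq// => x xs; rewrite mem_undup mem_cat xs.
have {}k2 : `|\sum_(x <- undup (s1 ++ s2)) h x - c2| < e / 2.
  by apply: k2; rewrite ?undup_uniq// => x xs; rewrite mem_undup mem_cat xs orbT.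
rewrite [e]splitr; apply: le_lt_trans (ltrD k1 k2).
set S := \sum_(x <- _) _.
rewrite [c1 - c2](_ : _ = - (S - c1) + (S - c2)); last by ring.
by rewrite (le_trans (ler_normD _ _))// normrN.
Qed.

Lemma csumE h c : is_sum h c -> csum h = c.
Proof.
by move=> hc; rewrite /csum; case: xgetP => [x _ /is_sum_unique|/(_ c)]//; exact.
Qed.

Lemma is_sum_lin (a : C) h1 h2 c1 c2 : is_sum h1 c1 -> is_sum h2 c2 ->
  is_sum (fun x => a * h1 x + h2 x) (a * c1 + c2).
Proof.
move=> k1 k2 e e0.
have a0 : 0 < `|a| + 1 by rewrite ltr_wpDl.
have [|s1 {}k1] := k1 (e / 2 / (`|a| + 1)); first by rewrite !divr_gt0.
have [|s2 {}k2] := k2 (e / 2); first by rewrite divr_gt0.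
exists (s1 ++ s2) => s us ss.
rewrite big_split/= -mulr_sumr.
have {}k1 : `|\sum_(x <- s) h1 x - c1| < e / 2 / (`|a| + 1).
  by apply: k1 => // x xs; apply: ss; rewrite mem_cat xs.
have {}k2 : `|\sum_(x <- s) h2 x - c2| < e / 2.
  by apply: k2 => // x xs; apply: ss; rewrite mem_cat xs orbT.
rewrite [X in `|X|](_ : _ =
  a * (\sum_(x <- s) h1 x - c1) + (\sum_(x <- s) h2 x - c2)); last by ring.
rewrite (le_lt_trans (ler_normD _ _))// [e]splitr ler_ltD// normrM.
rewrite (le_trans (ler_wpM2l _ (ltW k1)))//.
rewrite mulrA ler_pdivrMr// mulrC ler_wpM2l ?lerDl//.
by rewrite divr_ge0 ?(ltW e0).
Qed.

Lemma is_sum0 : is_sum (fun=> 0) 0.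
Proof. by move=> e e0; exists [::] => s _ _; rewrite big1// subrr normr0. Qed.

Lemma eq_is_sum h1 h2 c : h1 =1 h2 -> is_sum h1 c -> is_sum h2 c.
Proof. by move=> /funext->. Qed.

Lemma is_sum_conj h c : is_sum h c -> is_sum (fun x => (h x)^*) c^*.
Proof.
move=> hc e /hc[s hs]; exists s => s' us ss.
by rewrite -rmorph_sum -rmorphB norm_conjC hs.
Qed.

Lemma ler_sum_sub h s s' : (forall x, 0 <= h x) -> uniq s -> uniq s' ->
  {subset s <= s'} -> \sum_(x <- s) h x <= \sum_(x <- s') h x.
Proof.
move=> h0 us us' ss; have sP : perm_eq [seq x <- s' | x \in s] s.
  apply: uniq_perm; rewrite ?filter_uniq// => x.
  by rewrite mem_filter; case: (boolP (x \in s)) => //= /ss.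
rewrite [leRHS](bigID (mem s))/= -[X in _ <= X + _]big_filter (perm_big _ sP)/=.
by rewrite lerDl sumr_ge0.
Qed.

Lemma is_sum_bounded h (M : C) : (forall x, 0 <= h x) ->
  (forall s, uniq s -> \sum_(x <- s) h x <= M) ->
  exists2 c, is_sum h c & 0 <= c <= M.
Proof.
move=> h0 hM; pose A := [set re (\sum_(x <- s) h x) | s in [set s | uniq s]].
have M0 : 0 <= M by have := hM [::] isT; rewrite big_nil.
have hsup : has_sup A.
  split; first by exists (re (\sum_(x <- [::]) h x)), [::].
  by exists (re M) => _ [s us <-]; rewrite le_re ?hM.
have S0 s : 0 <= \sum_(x <- s) h x by rewrite sumr_ge0.
have ub s : uniq s -> \sum_(x <- s) h x <= ofR (sup A).
  move=> us; rewrite -[leLHS]reK// ofR_le.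
  by apply: (ub_le_sup hsup.2); exists s.
have cM : 0 <= ofR (sup A) <= M.
  rewrite (le_trans _ (ub [::] isT)) ?big_nil//=.
  rewrite -[leRHS]reK// ofR_le; apply: ge_sup hsup.1 _ => _ [s us <-].
  by rewrite le_re ?hM.
exists (ofR (sup A)) => //.
move=> e /eps_real[e0 <-].
have [_ [s us <-] hs] := sup_adherent e0 hsup.
exists s => s' us' ss.
rewrite ler0_norm ?subr_le0 ?ub// opprB -[X in _ - X]reK// -ofRB ofR_lt.
rewrite ltrBlDr -ltrBlDl (lt_le_trans hs)//.
by rewrite le_re ?ler_sum_sub.
Qed.

Lemma is_sum_ge h c s : (forall x, 0 <= h x) -> is_sum h c -> uniq s ->
  \sum_(x <- s) h x <= c.
Proof.
move=> h0 hc us.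
have S0 t : 0 <= \sum_(x <- t) h x by rewrite sumr_ge0.
have [cR c0] : ofR (re c) = c /\ \sum_(x <- s) h x <= ofR (re c).
  suff k e : 0 < e -> exists2 t : C, 0 <= t /\ \sum_(x <- s) h x <= t & `|t - c| < e.
    have cR : ofR (re c) = c.
      apply/eqP; rewrite eq_sym -subr_eq0; apply/eqP/small_eq0 => e e0.
      have [|t [t0 _] tc] := k (e / 2); first by rewrite divr_gt0.
      have h1 : `|t - ofR (re c)| < e / 2.
        rewrite -[t]reK// -ofRB ofR_norm -reB; apply: le_lt_trans tc.
        by rewrite -[leRHS]reK// ofR_le re_norm.
      rewrite [e]splitr; apply: le_lt_trans (ltrD tc h1).
      by rewrite (distrC t) (le_trans _ (ler_normD _ _))// addrA subrK.
    split=> //; rewrite -[leLHS]reK// ofR_le; apply/ler_addgt0Pl => e e0.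
    have [|t [t0 st] tc] := k (ofR e); first by rewrite -[0]/(ofR 0) ofR_lt.
    have : re t - re c < e.
      rewrite -reB (le_lt_trans (ler_norm _))// (le_lt_trans (re_norm _))//.
      by rewrite -ofR_lt reK.
    by move/le_re: st; lra.
  move=> e0; have [t ht] := hc e e0.
  exists (\sum_(x <- undup (s ++ t)) h x); last first.
    by apply: ht; rewrite ?undup_uniq// => x xt; rewrite mem_undup mem_cat xt orbT.
  by split=> //; apply: ler_sum_sub; rewrite ?undup_uniq// => x xs;
    rewrite mem_undup mem_cat xs.
by rewrite -cR.
Qed.

Lemma is_sum_le h c (M : C) : (forall x, 0 <= h x) -> is_sum h c ->
  (forall s, uniq s -> \sum_(x <- s) h x <= M) -> c <= M.
Proof.
move=> h0 hc hM; have [c' hc' /andP[_]] := is_sum_bounded h0 hM.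
by rewrite (is_sum_unique hc hc').
Qed.

End Sums.

(* Inner products are linear in the first variable. *)
Record hilbert (R : realType) := Hilbert {
  hcar :> lmodType (Cx R);
  ip : hcar -> hcar -> Cx R;
  ip_linear : forall a x y z, ip (a *: x + y) z = a * ip x z + ip y z;
  ip_conj : forall x y, ip y x = (ip x y)^*;
  ip_ge0 : forall x, 0 <= ip x x;
  ip_eq0 : forall x, ip x x = 0 -> x = 0;
  ip_complete : forall u : nat -> hcar,
    (forall e : Cx R, 0 < e -> exists N, forall m n, (N <= m)%N -> (N <= n)%N ->
       ip (u m - u n) (u m - u n) < e) ->
    exists l, forall e : Cx R, 0 < e -> exists N, forall n, (N <= n)%N ->
       ip (u n - l) (u n - l) < e }.

Definition hnorm (R : realType) (H : hilbert R) (x : H) : R :=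
  Num.sqrt (re (ip x x)).

Section L2.
Variables (R : realType) (X : choiceType).
Local Notation C := (Cx R).

Definition sqsummable : {pred X -> C} := fun f =>
  `[< exists M : C, forall s : seq X, uniq s -> \sum_(x <- s) `|f x| ^+ 2 <= M >].

Lemma sqsummableP f : reflect (exists M : C, forall s : seq X, uniq s ->
  \sum_(x <- s) `|f x| ^+ 2 <= M) (f \in sqsummable).
Proof. exact: asboolP. Qed.

Lemma sqr_normD2 (a b : C) : `|a + b| ^+ 2 <= 2 * (`|a| ^+ 2 + `|b| ^+ 2).
Proof.
rewrite -subr_ge0 (_ : _ - _ = `|a - b| ^+ 2) ?exprn_ge0//.
by rewrite !normCK !rmorphD rmorphN/=; ring.
Qed.

Lemma sqsummable_submod : submod_closed sqsummable.
Proof.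
split=> [|a f g /sqsummableP[M hM] /sqsummableP[N hN]]; apply/sqsummableP.
  by exists 0 => s _; rewrite big1// => x _; rewrite normr0 expr0n.
exists (2 * (`|a| ^+ 2 * M + N)) => s us.
apply: (@le_trans _ _ (2 * (`|a| ^+ 2 * \sum_(x <- s) `|f x| ^+ 2
    + \sum_(x <- s) `|g x| ^+ 2))); last first.
  by rewrite ler_wpM2l// lerD ?hN// ler_wpM2l ?exprn_ge0 ?hM.
rewrite mulr_sumr -big_split/= mulr_sumr; apply: ler_sum => x _.
by rewrite (le_trans (sqr_normD2 _ _))// normrM exprMn.
Qed.
HB.instance Definition _ :=
  GRing.isSubmodClosed.Build C (X -> C) sqsummable
    (GRing.submod_closed_semi sqsummable_submod).

Record l2 := L2 { l2val :> X -> C; l2valP : l2val \in sqsummable }.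
HB.instance Definition _ := [isSub for l2val].
HB.instance Definition _ := [Choice of l2 by <:].
HB.instance Definition _ := [SubChoice_isSubLmodule of l2 by <:].
End L2.

Section L2Hilbert.
Variables (R : realType) (X : choiceType).
Local Notation C := (Cx R).
Local Notation l2X := (l2 R X).
Implicit Types (f g : l2X).

Lemma l2P f g : f =1 g -> f = g.
Proof. by move=> /funext fg; exact: val_inj. Qed.
Lemma l2_addE f g x : (f + g) x = f x + g x. Proof. by []. Qed.
Lemma l2_oppE f x : (- f) x = - f x. Proof. by []. Qed.
Lemma l2_scaleE a f x : (a *: f) x = a * f x. Proof. by []. Qed.

Definition l2ip f g : C := csum (fun x => f x * (g x)^*).

Lemma l2_sum_sqr f : exists c, is_sum (fun x => `|f x| ^+ 2) c.
Proof.
have /sqsummableP[M hM] := l2valP f.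
by have [|c hc _] := is_sum_bounded _ hM; [move=> x; rewrite exprn_ge0|exists c].
Qed.

Lemma l2_is_sum f g : is_sum (fun x => f x * (g x)^*) (l2ip f g).
Proof.
suff [c hc] : exists c, is_sum (fun x => f x * (g x)^*) c.
  by rewrite /l2ip (csumE hc).
have [a ha] := l2_sum_sqr (f + g); have [b hb] := l2_sum_sqr (f - g).
have [c hc] := l2_sum_sqr (f + 'i *: g); have [d hd] := l2_sum_sqr (f - 'i *: g).
have k0 := @is_sum0 R X.
have k1 := is_sum_lin (1 / 4) ha k0; have k2 := is_sum_lin (- 1 / 4) hb k1.
have k3 := is_sum_lin ('i / 4) hc k2; have k4 := is_sum_lin (- 'i / 4) hd k3.
eexists; apply: eq_is_sum k4 => x; cbv beta; rewrite !l2_addE !l2_oppE !l2_scaleE.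
rewrite !normCK !rmorphD !rmorphN !rmorphM/= conjCi.
rewrite [RHS](_ : _ = (2 * (f x * (g x)^*) * (1 - 'i ^+ 2)
   + 2 * ((f x)^* * g x) * (1 + 'i ^+ 2)) / 4); last by rewrite sqrCi; field.
by field.
Qed.

Lemma l2ip_linear a f g h : l2ip (a *: f + g) h = a * l2ip f h + l2ip g h.
Proof.
apply: csumE; apply: eq_is_sum (is_sum_lin a (l2_is_sum f h) (l2_is_sum g h)).
by move=> x; cbv beta; rewrite l2_addE l2_scaleE mulrDl mulrA.
Qed.

Lemma l2ip_conj f g : l2ip g f = (l2ip f g)^*.
Proof.
apply: csumE; apply: eq_is_sum (is_sum_conj (l2_is_sum f g)) => x /=.
by rewrite rmorphM/= conjCK mulrC.
Qed.

Lemma l2_is_sum_sqr f : is_sum (fun x => `|f x| ^+ 2) (l2ip f f).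
Proof. by apply: eq_is_sum (l2_is_sum f f) => x; rewrite normCK. Qed.

Lemma l2_sum_le f s : uniq s -> \sum_(x <- s) `|f x| ^+ 2 <= l2ip f f.
Proof. by apply: is_sum_ge (l2_is_sum_sqr f) => x; rewrite exprn_ge0. Qed.

Lemma l2_le f (M : C) : (forall s, uniq s -> \sum_(x <- s) `|f x| ^+ 2 <= M) ->
  l2ip f f <= M.
Proof. by apply: is_sum_le (l2_is_sum_sqr f) => x; rewrite exprn_ge0. Qed.

Lemma l2ip_ge0 f : 0 <= l2ip f f.
Proof. by have := @l2_sum_le f [::] isT; rewrite big_nil. Qed.

Lemma l2ip_eq0 f : l2ip f f = 0 -> f = 0.
Proof.
move=> f0; apply: l2P => x; have := @l2_sum_le f [:: x] isT.
rewrite big_seq1 f0 => le0.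
change (f x = 0); apply/eqP.
have -> : (f x == 0) = (`|f x| ^+ 2 == 0) by rewrite sqrf_eq0 normr_eq0.
by rewrite eq_le le0 exprn_ge0.
Qed.

Lemma l2_complete (u : nat -> l2X) :
  (forall e : C, 0 < e -> exists N, forall m n, (N <= m)%N -> (N <= n)%N ->
     l2ip (u m - u n) (u m - u n) < e) ->
  exists l, forall e : C, 0 < e -> exists N, forall n, (N <= n)%N ->
     l2ip (u n - l) (u n - l) < e.
Proof.
move=> hu.
have pt x : exists l, forall e : C, 0 < e -> exists N, forall n, (N <= n)%N ->
    `|u n x - l| < e.
  apply: Ccauchy => e e0; have [|N hN] := hu (e ^+ 2); first by rewrite exprn_gt0.
  exists N => m n Nm Nn; rewrite -(@ltr_pXn2r _ 2) ?nnegrE ?(ltW e0)//.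
  apply: le_lt_trans (hN _ _ Nm Nn).
  by have := @l2_sum_le (u m - u n) [:: x] isT; rewrite big_seq1.
pose l x := sval (cid (pt x)).
have hl x : forall e : C, 0 < e -> exists N, forall n, (N <= n)%N ->
    `|u n x - l x| < e by rewrite /l; case: cid.
have unif (s : seq X) (e : C) : 0 < e -> exists N, forall n, (N <= n)%N ->
    \sum_(x <- s) `|u n x - l x| ^+ 2 <= e.
  elim: s e => [|x s ih] e e0; first by exists 0 => n _; rewrite big_nil ltW.
  have [|N hN] := ih (e / 2); first by rewrite divr_gt0.
  have [|K hK] := hl x (sqrtC (e / 2)); first by rewrite sqrtC_gt0 divr_gt0.
  exists (maxn N K) => n; rewrite geq_max big_cons => /andP[/hN Nn /hK Kn].
  rewrite [e]splitr lerD// -[leRHS]sqrtCK.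
  by rewrite ler_pXn2r ?nnegrE ?(ltW Kn)// (le_trans _ (ltW Kn)).
have fin (e : C) : 0 < e -> exists N, forall n, (N <= n)%N ->
    forall s, uniq s -> \sum_(x <- s) `|u n x - l x| ^+ 2 <= e.
  move=> e0; have [|N hN] := hu (e / 4); first by rewrite divr_gt0.
  exists N => n Nn s us; have [|K hK] := unif s (e / 4); first by rewrite divr_gt0.
  have {}hK := hK (maxn N K) (leq_maxr _ _).
  have {}hN := ltW (hN _ _ Nn (leq_maxl N K)).
  rewrite (_ : e = 2 * (e / 4 + e / 4)); last by field.
  have h1 := le_trans (l2_sum_le _ us) hN.
  apply: le_trans (ler_wpM2l _ (lerD h1 hK)) => //.
  rewrite -big_split/= mulr_sumr; apply: ler_sum => x _.
  apply: le_trans (sqr_normD2 _ _); rewrite le_eqVlt; apply/orP; left; apply/eqP.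
  by congr (`|_| ^+ 2); rewrite -[X in _ = X + _]/(u n x - u (maxn N K) x) addrA subrK.
have lP : l \in @sqsummable R X.
  have [N /(_ N (leqnn N)) hN] := fin 1 ltr01.
  have /sqsummableP[M hM] := l2valP (u N).
  apply/sqsummableP; exists (2 * (M + 1)) => s us.
  apply: le_trans (ler_wpM2l _ (lerD (hM s us) (hN s us))) => //.
  rewrite -big_split/= mulr_sumr; apply: ler_sum => x _.
  rewrite (le_trans _ (le_trans (sqr_normD2 (u N x) (l x - u N x)) _))//.
    by rewrite addrC subrK.
  by rewrite (distrC (l x)).
exists (L2 lP) => e e0; have [|N hN] := fin (e / 2); first by rewrite divr_gt0.
exists N => n Nn; apply: (@le_lt_trans _ _ (e / 2)).
  by apply: l2_le => s us; exact: hN.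
by rewrite ltr_pdivrMr// ltr_pMr// ltr1n.
Qed.

Definition ell2 : hilbert R :=
  Hilbert l2ip_linear l2ip_conj l2ip_ge0 l2ip_eq0 l2_complete.

Definition mk_l2 (f : X -> C) : l2X := insubd 0 f.

Lemma mk_l2E (f : X -> C) : f \in @sqsummable R X -> mk_l2 f =1 f.
Proof. by move=> fP x; rewrite /mk_l2 insubdK. Qed.

Definition delta (x : X) : l2X := mk_l2 (fun y => (y == x)%:R).

End L2Hilbert.

Section ScalarHilbert.
Variable R : realType.
Local Notation C := (Cx R).

Definition Cip (a b : C^o) : C := a * b^*.

Lemma Cip_linear (a : C) (x y z : C^o) :
  Cip (a *: x + y) z = a * Cip x z + Cip y z.
Proof. by rewrite /Cip mulrDl -mulrA. Qed.
Lemma Cip_conj (x y : C^o) : Cip y x = (Cip x y)^*.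
Proof. by rewrite /Cip rmorphM/= conjCK mulrC. Qed.
Lemma Cip_sqr (x : C^o) : Cip x x = `|x : C| ^+ 2.
Proof. by rewrite /Cip normCK. Qed.
Lemma Cip_ge0 (x : C^o) : 0 <= Cip x x.
Proof. by rewrite Cip_sqr exprn_ge0. Qed.
Lemma Cip_eq0 (x : C^o) : Cip x x = 0 -> x = 0.
Proof. by move/eqP; rewrite Cip_sqr sqrf_eq0 normr_eq0 => /eqP. Qed.
Lemma Cip_complete (u : nat -> C^o) :
  (forall e : C, 0 < e -> exists N, forall m n, (N <= m)%N -> (N <= n)%N ->
     Cip (u m - u n) (u m - u n) < e) ->
  exists l, forall e : C, 0 < e -> exists N, forall n, (N <= n)%N ->
     Cip (u n - l) (u n - l) < e.
Proof.
move=> hu; have [|l hl] := @Ccauchy R u.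
  move=> e e0; have [|N hN] := hu (e ^+ 2); first by rewrite exprn_gt0.
  exists N => m n Nm Nn; have := hN m n Nm Nn.
  by rewrite Cip_sqr ltr_pXn2r ?nnegrE ?(ltW e0).
exists l => e e0; have [|N hN] := hl (sqrtC e); first by rewrite sqrtC_gt0.
exists N => n /hN; rewrite Cip_sqr -[X in _ -> _ < X]sqrtCK.
by rewrite ltr_pXn2r ?nnegrE ?sqrtC_ge0 ?(ltW e0).
Qed.

Definition scalarH : hilbert R :=
  Hilbert Cip_linear Cip_conj Cip_ge0 Cip_eq0 Cip_complete.
End ScalarHilbert.

Section Operators.
Variable R : realType.

Definition bounded_op (H K : hilbert R) (f : H -> K) :=
  linear f /\ exists M : R, forall x, hnorm (f x) <= M * hnorm x.

Definition opnorm (H K : hilbert R) (f : H -> K) : R :=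
  sup [set hnorm (f x) | x in [set x : H | hnorm x <= 1]].

Definition adjoint (H K : hilbert R) (f : H -> K) (g : K -> H) :=
  forall x y, ip (f x) y = ip x (g y).

Definition unitary (H K : hilbert R) (f : H -> K) :=
  [/\ linear f, forall x y, ip (f x) (f y) = ip x y & forall y, exists x, f x = y].

Definition total_family (H : hilbert R) (I : choiceType) (e : I -> H) :=
  forall (x : H) (eps : R), 0 < eps -> exists (s : seq I) (c : I -> Cx R),
    hnorm (x - \sum_(i <- s) c i *: e i) < eps.

Definition orthonormal_basis (H : hilbert R) (I : choiceType) (e : I -> H) :=
  (forall i j, ip (e i) (e j) = (i == j)%:R) /\ total_family e.

End Operators.

Section Shifts.
Variable R : realType.
Local Notation C := (Cx R).
Local Notation ell2 := (ell2 R).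

(* Left shifts: S e_(n+1) = e_n, S e_0 = 0, and bt r = t^r with t e_k = e_(k-1). *)
Definition Sop (f : ell2 nat) : ell2 nat := mk_l2 (fun n => f n.+1).
Definition Sadj (f : ell2 nat) : ell2 nat :=
  mk_l2 (fun n => if n is n'.+1 then f n' else 0).
Definition pop (f : ell2 nat) : ell2 nat :=
  mk_l2 (fun n => if n == 0%N then f n else 0).
Definition bt (r : int) (f : ell2 int) : ell2 int := mk_l2 (fun k => f (k + r)).

(* [ell2 X] tensored with [ell2 Y] is identified with [ell2 (X * Y)], the vector
   e_x (x) e_y being e_(x, y). For bounded A and B the functions to which [mk_l2]
   is applied are square summable, and this is the operator A (x) B: B acts on
   every slice F (x, -), then A acts on the first variable. *)
Definition tens (X Y : choiceType) (A : ell2 X -> ell2 X) (B : ell2 Y -> ell2 Y)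
    (F : ell2 (X * Y)%type) : ell2 (X * Y)%type :=
  mk_l2 (fun z => A (mk_l2 (fun x => B (mk_l2 (fun y => F (x, y))) z.2)) z.1).

End Shifts.

Section PartialMaps.
Variable R : realType.
Local Notation C := (Cx R).
Local Notation ell2 := (ell2 R).

Definition pinj (X : Type) (h : X -> option X) :=
  forall x y z, h x = Some z -> h y = Some z -> x = y.

(* The operators of the inverse semigroup send each basis vector to a basis
   vector or to 0; [pull h] is the operator e_y |-> e_x if h x = Some y. *)
Definition pull (X : choiceType) (h : X -> option X) (f : ell2 X) : ell2 X :=
  mk_l2 (fun x => oapp f 0 (h x)).

Lemma uniq_pmap (X Y : eqType) (h : X -> option Y) (s : seq X) :
  (forall x y z, h x = Some z -> h y = Some z -> x = y) ->
  uniq s -> uniq (pmap h s).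
Proof.
move=> hi; elim: s => //= x s ih /andP[xs us].
case E: (h x) => [y|]/=; last exact: ih.
rewrite ih// andbT; apply/negP; rewrite mem_pmap => /mapP[z zs Ez].
by move: xs; rewrite (hi x z y E (esym Ez)) zs.
Qed.

Lemma sqsummable_pull (X Y : choiceType) (h : X -> option Y) (f : ell2 Y) :
  (forall x y z, h x = Some z -> h y = Some z -> x = y) ->
  (fun x => oapp f 0 (h x)) \in @sqsummable R X.
Proof.
move=> hi; have /sqsummableP[M hM] := l2valP (f : l2 R Y).
apply/sqsummableP; exists M => s us.
have up := uniq_pmap hi us.
rewrite (le_trans _ (hM _ up))//.
elim: {us up} s => [|x s ih] /=; first by rewrite !big_nil.
rewrite big_cons; case: (h x) => [y|]/=; first by rewrite big_cons lerD2l.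
by rewrite normr0 expr0n/= add0r.
Qed.

Lemma pullE (X : choiceType) (h : X -> option X) f x : pinj h ->
  pull h f x = oapp f 0 (h x).
Proof. by move=> hi; rewrite /pull mk_l2E ?sqsummable_pull. Qed.

Lemma pullP (X : choiceType) (A : ell2 X -> ell2 X) (h : X -> option X) : pinj h ->
  (forall f x, A f x = oapp f 0 (h x)) -> A = pull h.
Proof. by move=> hi hA; apply/funext => f; apply: l2P => x; rewrite hA pullE. Qed.

Lemma eq_pull (X : choiceType) (h g : X -> option X) : h =1 g -> pull h = pull g.
Proof. by move=> /funext->. Qed.

Lemma pinj_comp (X : Type) (h g : X -> option X) : pinj h -> pinj g ->
  pinj (fun x => obind h (g x)).
Proof.
move=> hi gi x y z; case Ex: (g x) => [a|]//=; case Ey: (g y) => [b|]//= ha hb.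
by apply: gi Ex _; rewrite Ey (hi _ _ _ ha hb).
Qed.

Lemma pull_comp (X : choiceType) (h g : X -> option X) : pinj h -> pinj g ->
  pull g \o pull h = pull (fun x => obind h (g x)).
Proof.
move=> hi gi; apply: pullP; first exact: pinj_comp.
by move=> f x /=; rewrite pullE//; case: (g x) => //= y; rewrite pullE.
Qed.

Lemma deltaE (X : choiceType) (x y : X) : delta R x y = (y == x)%:R.
Proof.
rewrite /delta mk_l2E//; apply/sqsummableP; exists 1 => s us.
rewrite (eq_bigr (fun y => (y == x)%:R)); last first.
  by move=> z _; case: eqP; rewrite ?normr1 ?normr0 ?expr1n ?expr0n.
elim: s us => [|z s ih] /=; first by rewrite big_nil.
move=> /andP[zs us]; rewrite big_cons; case: eqP => [zx|_]; last by rewrite add0r ih.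
rewrite big_seq big1 ?addr0// => w ws; case: eqP => // wx.
by move: zs; rewrite zx -wx ws.
Qed.

Lemma pull_inj (X : choiceType) (h g : X -> option X) : pinj h -> pinj g ->
  pull h = pull g -> h =1 g.
Proof.
move=> hi gi hg x.
have k y : oapp (delta R y) 0 (h x) = oapp (delta R y) 0 (g x).
  by rewrite -!pullE// hg.
case Eh: (h x) k => [a|]; case Eg: (g x) => [b|] //= k.
- have := k a; rewrite !deltaE eqxx => /esym/eqP.
  by case: (b =P a) => [->//|_]; rewrite eq_sym oner_eq0.
- by have := k a; rewrite deltaE eqxx => /eqP; rewrite oner_eq0.
- by have := k b; rewrite deltaE eqxx => /eqP; rewrite eq_sym oner_eq0.
Qed.

Definition pprod (X Y : Type) (h : X -> option X) (g : Y -> option Y) :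
    X * Y -> option (X * Y) :=
  fun z => obind (fun x => omap (pair x) (g z.2)) (h z.1).

Lemma pinj_pprod (X Y : Type) (h : X -> option X) (g : Y -> option Y) :
  pinj h -> pinj g -> pinj (pprod h g).
Proof.
move=> hi gi [a b] [a' b'] [x y]; rewrite /pprod/=.
case E1: (h a) => [?|]//=; case E2: (g b) => [?|]//= -[<- <-].
case E3: (h a') => [?|]//=; case E4: (g b') => [?|]//= -[e3 e4].
by rewrite (hi _ _ _ E1 (etrans E3 (congr1 Some e3)))
  (gi _ _ _ E2 (etrans E4 (congr1 Some e4))).
Qed.

Lemma tens_pull (X Y : choiceType) (h : X -> option X) (g : Y -> option Y) :
  pinj h -> pinj g -> tens (pull h) (pull g) = pull (pprod h g).
Proof.
move=> hi gi; apply: pullP; first exact: pinj_pprod.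
have slice2 (F : ell2 (X * Y)%type) x : (fun y => F (x, y)) \in @sqsummable R Y.
  have := @sqsummable_pull Y _ (fun y => Some (x, y)) F.
  by apply; move=> ? ? z [<-] [->].
have slice1 (F : ell2 (X * Y)%type) oy :
    (fun x => oapp (fun y => F (x, y)) 0 oy) \in @sqsummable R X.
  have := @sqsummable_pull X _ (fun x => omap (pair x) oy) F.
  case: oy => [y|] /=; first by apply; move=> ? ? z [<-] [->].
  by apply.
have pullS (F : ell2 (X * Y)%type) z :
    (fun x => pull g (mk_l2 (fun y => F (x, y))) z) =
    (fun x => oapp (fun y => F (x, y)) 0 (g z)).
  by apply/funext => x; rewrite pullE//; case: (g z) => //= y; rewrite mk_l2E.
move=> F [a b]; rewrite /tens.
rewrite (_ : (fun z : X * Y => _) = fun z => oapp F 0 (pprod h g z)).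
  by rewrite mk_l2E// sqsummable_pull//; exact: pinj_pprod.
apply/funext => z; rewrite pullS pullE// /pprod.
by case: (h z.1) => //= x; rewrite mk_l2E//; case: (g z.2).
Qed.

Lemma is_sum_reindex (X : choiceType) (h g : X -> option X) (p q : X -> C) c :
  (forall x y, h x = Some y <-> g y = Some x) ->
  (forall x y, h x = Some y -> q x = p y) -> (forall x, h x = None -> q x = 0) ->
  (forall y, g y = None -> p y = 0) -> is_sum p c -> is_sum q c.
Proof.
move=> hg qp q0 p0 pc e /pc[s hs]; exists (pmap g s) => t ut st.
have hi : pinj h by move=> x y z /hg + /hg => -> [].
pose s' := pmap h t ++ [seq y <- undup s | y \notin pmap h t].
have us' : uniq s'.
  rewrite cat_uniq uniq_pmap// filter_uniq ?undup_uniq// andbT/=.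
  by apply/hasPn => y; rewrite mem_filter => /andP[].
have ss' : {subset s <= s'}.
  move=> y ys; rewrite mem_cat mem_filter mem_undup ys andbT.
  by case: (_ \in _).
suff -> : \sum_(x <- t) q x = \sum_(y <- s') p y by exact: hs.
rewrite big_cat/= [X in _ = _ + X]big_seq [X in _ = _ + X]big1 ?addr0.
  elim: {ut st s' us' ss'} t => [|x t ih] /=; first by rewrite !big_nil.
  rewrite big_cons ih; case E: (h x) => [y|]/=; first by rewrite big_cons (qp _ _ E).
  by rewrite q0// add0r.
move=> y; rewrite mem_filter mem_undup => /andP[yt ys].
case E: (g y) => [x|]; last exact: p0.
case/negP: yt; rewrite mem_pmap; apply/mapP; exists x; last by apply/esym/hg.
by apply: st; rewrite mem_pmap; apply/mapP; exists y.
Qed.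

Lemma adjoint_pull (X : choiceType) (h g : X -> option X) :
  (forall x y, h x = Some y <-> g y = Some x) -> adjoint (pull h) (pull g).
Proof.
move=> hg.
have hi : pinj h by move=> x y z /hg + /hg => -> [].
have gi : pinj g by move=> x y z /hg + /hg => -> [].
move=> f k; apply: csumE; apply: (is_sum_reindex hg _ _ _ (l2_is_sum f (pull g k))).
- by move=> x y E; have /hg E' := E; rewrite !pullE// E E'.
- by move=> x E; rewrite pullE// E mul0r.
- by move=> y E; rewrite pullE// E conjC0 mulr0.
Qed.

Lemma adjoint_uniq (H : hilbert R) (f g1 g2 : H -> H) :
  adjoint f g1 -> adjoint f g2 -> g1 = g2.
Proof.
move=> h1 h2; apply/funext => y; apply/eqP; rewrite -subr_eq0; apply/eqP/ip_eq0.
set d := g1 y - g2 y.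
have : ip d (g1 y) = ip d (g2 y) by rewrite -h1 h2.
rewrite ip_conj [RHS]ip_conj => /(congr1 Num.conj); rewrite !conjCK => E.
have := @ip_linear R H (-1) (g2 y) (g1 y) d.
by rewrite scaleN1r addrC -/d E mulN1r addNr.
Qed.

End PartialMaps.

Section InverseSemigroup.
Variable R : realType.
Local Notation ell2 := (ell2 R).

Definition X3 : choiceType := (nat * nat * int)%type.
Definition op3 := ell2 X3 -> ell2 X3.

Definition SS (n m : nat) : ell2 nat -> ell2 nat :=
  iter n (@Sadj R) \o iter m (@Sop R).
Definition SpS (n m : nat) : ell2 nat -> ell2 nat :=
  iter n (@Sadj R) \o @pop R \o iter m (@Sop R).

(* The generators S* (x) S* (x) t, ... can only lie in this family if S*^n S^m
   goes with t^(n - m). As r stands for m - n, the last factor is t^(- r). *)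
Definition B1 (r : int) (n m : nat * nat) : op3 :=
  tens (tens (SS n.1 m.1) (SS n.1 m.1)) (bt (- r)).
Definition B2 (r : int) (n m : nat * nat) : op3 :=
  tens (tens (SS n.1 m.1) (SpS n.2 m.2)) (bt (- r)).
Definition B3 (r : int) (n m : nat * nat) : op3 :=
  tens (tens (SpS n.1 m.1) (SS n.2 m.2)) (bt (- r)).
Definition B4 (r : int) (n m : nat * nat) : op3 :=
  tens (tens (SpS n.1 m.1) (SpS n.2 m.2)) (bt (- r)).

Definition inT (s : op3) : Prop :=
  s = (fun=> 0) \/ exists (r : int) (n m : nat * nat),
  [\/ [/\ r = m.1%:Z - n.1%:Z, n.1 = n.2, m.1 = m.2 & s = B1 r n m],
      [/\ r = m.1%:Z - n.1%:Z, (n.2 <= n.1)%N, (m.2 <= m.1)%N & s = B2 r n m],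
      [/\ r = m.2%:Z - n.2%:Z, (n.1 <= n.2)%N, (m.1 <= m.2)%N & s = B3 r n m] |
      s = B4 r n m].

Definition cmap (b : bool) (n m a : nat) : option nat :=
  if (if b then a == n else n <= a)%N then Some (a - n + m)%N else None.
Definition bmap b1 b2 (r : int) (n m : nat * nat) : X3 -> option X3 :=
  pprod (pprod (cmap b1 n.1 m.1) (cmap b2 n.2 m.2)) (fun k => Some (k - r)).

Lemma pinj_cmap b n m : pinj (cmap b n m).
Proof.
move=> x y z; rewrite /cmap; case: b.
  by case: eqP => // ->; case: eqP => // ->.
by case: leqP => // h1 [<-]; case: leqP => // h2 [] ; lia.
Qed.

Lemma pinj_bmap b1 b2 r n m : pinj (bmap b1 b2 r n m).
Proof.
apply: pinj_pprod; first by apply: pinj_pprod; exact: pinj_cmap.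
by move=> x y z [<-] [] /addIr.
Qed.

Lemma iter_SopE m : iter m (@Sop R) = pull (fun a => Some (a + m)%N).
Proof.
have pi k : pinj (fun a => Some (a + k)%N) by move=> x y z [<-] []; lia.
elim: m => [|m ih].
  by apply: pullP => // f x /=; rewrite addn0.
have -> : iter m.+1 (@Sop R) = pull (fun a => Some (a + 1)%N) \o iter m (@Sop R).
  apply/funext => f /=; rewrite /Sop /pull/=; congr mk_l2.
  by apply/funext => a; rewrite addn1.
by rewrite ih pull_comp//; apply: eq_pull => a /=; rewrite addnAC addn1 addnS.
Qed.

Definition ssub n a := if (n <= a)%N then Some (a - n)%N else None.
Lemma pinj_ssub n : pinj (ssub n).
Proof.
move=> x y z; rewrite /ssub; case: leqP => // h1 [<-].
by case: leqP => // h2 []; lia.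
Qed.

Lemma iter_SadjE n : iter n (@Sadj R) = pull (ssub n).
Proof.
elim: n => [|n ih].
  by apply: pullP => [|f x /=]; rewrite ?subn0//; exact: pinj_ssub.
have -> : iter n.+1 (@Sadj R) = pull (ssub 1) \o iter n (@Sadj R).
  apply/funext => f /=; rewrite /Sadj /pull/=; congr mk_l2.
  by apply/funext => -[|a] //=; rewrite /ssub/= subn1.
rewrite ih pull_comp; [|exact: pinj_ssub..].
apply: eq_pull => a; rewrite /ssub; case: (leqP 1 a) => h1 /=; last first.
  by case: leqP => //; lia.
by case: leqP => h2; case: leqP => h3 //; try lia; congr Some; lia.
Qed.

Definition zmap n := if n == 0%N then Some n else None.
Lemma pinj_zmap : pinj zmap.
Proof. by move=> x y z; rewrite /zmap; case: eqP => // -> _; case: eqP => // ->. Qed.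
Lemma popE : @pop R = pull zmap.
Proof.
apply/funext => f; rewrite /pop /pull; congr mk_l2; apply/funext => a.
by rewrite /zmap; case: eqP => //= ->.
Qed.

Lemma SSE n m : SS n m = pull (cmap false n m).
Proof.
have pi k : pinj (fun a => Some (a + k)%N) by move=> x y z [<-] []; lia.
rewrite /SS iter_SopE iter_SadjE pull_comp//; last exact: pinj_ssub.
by apply: eq_pull => a; rewrite /ssub /cmap; case: leqP.
Qed.

Lemma SpSE n m : SpS n m = pull (cmap true n m).
Proof.
have pi k : pinj (fun a => Some (a + k)%N) by move=> x y z [<-] []; lia.
rewrite /SpS iter_SopE iter_SadjE popE.
rewrite pull_comp; [|exact: pinj_zmap|exact: pinj_ssub].
rewrite pull_comp//; last by apply: pinj_comp; [exact: pinj_zmap|exact: pinj_ssub].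
apply: eq_pull => a; rewrite /ssub /cmap /zmap; case: leqP => h /=.
  by case: eqP => h1; case: eqP => h2 //; lia.
by case: eqP => //; lia.
Qed.

Lemma btE r : @bt R (- r) = pull (fun k => Some (k - r)).
Proof. by []. Qed.

Lemma pinj_zsub (r : int) : pinj (fun k => Some (k - r)).
Proof. by move=> x y z [<-] [] /addIr. Qed.

Lemma tens3E b1 b2 r n m : tens (tens (pull (cmap b1 n.1 m.1))
  (pull (cmap b2 n.2 m.2))) (@bt R (- r)) = pull (bmap b1 b2 r n m).
Proof.
have hi b k l := @pinj_cmap b k l.
rewrite btE tens_pull// tens_pull//; [exact: pinj_pprod|exact: pinj_zsub].
Qed.

Definition wf (b1 b2 : bool) (r : int) (n m : nat * nat) : bool :=
  match b1, b2 with
  | false, false => [&& r == m.1%:Z - n.1%:Z, n.1 == n.2 & m.1 == m.2]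
  | false, true => [&& r == m.1%:Z - n.1%:Z, (n.2 <= n.1)%N & (m.2 <= m.1)%N]
  | true, false => [&& r == m.2%:Z - n.2%:Z, (n.1 <= n.2)%N & (m.1 <= m.2)%N]
  | true, true => true
  end.

Lemma inTP s : inT s <-> s = (fun=> 0) \/ exists b1 b2 r n m,
  wf b1 b2 r n m /\ s = pull (bmap b1 b2 r n m).
Proof.
rewrite /inT; split=> -[->|]; try by left.
  move=> [r [n [m []]]]; rewrite /B1 /B2 /B3 /B4 ?SSE ?SpSE => H; right.
  - exists false, false, r, n, m; case: H => -> e1 e2 ->; split.
      by rewrite /= e1 e2 !eqxx.
    by rewrite -tens3E -e1 -e2.
  - exists false, true, r, n, m; case: H => -> e1 e2 ->; split.
      by rewrite /= e1 e2 eqxx.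
    by rewrite -tens3E.
  - exists true, false, r, n, m; case: H => -> e1 e2 ->; split.
      by rewrite /= e1 e2 eqxx.
    by rewrite -tens3E.
  - by exists true, true, r, n, m; rewrite H -tens3E.
move=> [b1 [b2 [r [n [m [w ->]]]]]]; right; exists r, n, m.
case: b1 b2 w => [] [] /= w.
- by apply: Or44; rewrite /B4 !SpSE tens3E.
- case/and3P: w => /eqP-> h1 h2; apply: Or43; split=> //.
  by rewrite /B3 SpSE SSE tens3E.
- case/and3P: w => /eqP-> h1 h2; apply: Or42; split=> //.
  by rewrite /B2 SpSE SSE tens3E.
case/and3P: w => /eqP-> /eqP h1 /eqP h2; apply: Or41; split=> //.
by rewrite /B1 SSE -tens3E -h1 -h2.
Qed.

Lemma pull_none : @pull R X3 (fun=> None) = (fun=> 0).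
Proof. by apply/esym; apply: pullP. Qed.

Lemma bmap_comp b1 b2 r n m b1' b2' r' n' m' :
  wf b1 b2 r n m -> wf b1' b2' r' n' m' ->
  (fun x => obind (bmap b1' b2' r' n' m') (bmap b1 b2 r n m x)) =1 (fun=> None) \/
  exists n'' m'', wf (b1 || b1') (b2 || b2') (r + r') n'' m'' /\
  (fun x => obind (bmap b1' b2' r' n' m') (bmap b1 b2 r n m x)) =1
    bmap (b1 || b1') (b2 || b2') (r + r') n'' m''.
Proof.
have K b k l b' k' l' :
  (fun a => obind (cmap b' k' l') (cmap b k l a)) =1
  (if (if b then if b' then l == k' else k' <= l
      else if b' then l <= k' else true)%N
   then cmap (b || b') (if b then k else k + (k' - l))%N
          (if b' then l' else l' + (l - k'))%N
   else fun=> None).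
  by move=> a; rewrite /cmap; case: b b' => [] [];
    repeat (case: ifP => //= ?); try (exfalso; lia); congr Some; lia.
have K' : (fun x => obind (bmap b1' b2' r' n' m') (bmap b1 b2 r n m x)) =1
   pprod (pprod (fun a => obind (cmap b1' n'.1 m'.1) (cmap b1 n.1 m.1 a))
      (fun a => obind (cmap b2' n'.2 m'.2) (cmap b2 n.2 m.2 a)))
      (fun k => Some (k - (r + r'))).
  move=> [[a b] c]; rewrite /bmap /pprod/=.
  case: (cmap b1 _ _ _) => //= a'; case: (cmap b2 _ _ _) => //= [b'|].
    case: (cmap b1' _ _ _) => //= a''; case: (cmap b2' _ _ _) => //= b''.
    by rewrite opprD addrA.
  by case: (cmap b1' _ _ _).
move=> w w'.
have [c1|c1] := boolP (if b1 then if b1' then m.1 == n'.1 else n'.1 <= m.1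
      else if b1' then m.1 <= n'.1 else true)%N; last first.
  by left => x; rewrite K' /pprod/= (K b1 n.1) (negbTE c1).
have [c2|c2] := boolP (if b2 then if b2' then m.2 == n'.2 else n'.2 <= m.2
      else if b2' then m.2 <= n'.2 else true)%N; last first.
  left => x; rewrite K' /pprod/= (K b2 n.2) (negbTE c2)/=.
  by rewrite (K b1 n.1) c1; case: (cmap _ _ _ _).
right.
exists (if b1 then n.1 else n.1 + (n'.1 - m.1), if b2 then n.2 else n.2 + (n'.2 - m.2))%N.
exists (if b1' then m'.1 else m'.1 + (m.1 - n'.1), if b2' then m'.2 else m'.2 + (m.2 - n'.2))%N.
split; last by move=> x; rewrite K' /bmap /pprod/= (K b1 n.1) (K b2 n.2) c1 c2.
by case: b1 b1' b2 b2' w w' c1 c2 {K K'} => [] [] [] []; rewrite /wf/=; lia.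
Qed.

Lemma inT_comp s s' : inT s -> inT s' -> inT (s \o s').
Proof.
move=> /inTP[->|[b1 [b2 [r [n [m [w ->]]]]]]].
  by move=> _; apply/inTP; left.
move=> /inTP[->|[b1' [b2' [r' [n' [m' [w' ->]]]]]]].
  apply/inTP; left; apply/funext => f /=; apply: l2P => x.
  by rewrite pullE; [case: (bmap _ _ _ _ _ x)|exact: pinj_bmap].
rewrite pull_comp; [|exact: pinj_bmap..].
apply/inTP; have [E|[n'' [m'' [w'' E]]]] := bmap_comp w w'.
  by left; rewrite (eq_pull _ E) pull_none.
right; exists (b1 || b1'), (b2 || b2'), (r + r'), n'', m''.
by rewrite (eq_pull _ E).
Qed.

Lemma cmapV b n m a a' : cmap b n m a = Some a' <-> cmap b m n a' = Some a.
Proof.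
rewrite /cmap; case: b; split.
- by case: eqP => // -> []; rewrite subnn add0n => <-; rewrite eqxx subnn.
- by case: eqP => // -> []; rewrite subnn add0n => <-; rewrite eqxx subnn.
- by case: leqP => // h [<-]; case: leqP => h' //; [congr Some; lia|lia].
- by case: leqP => // h [<-]; case: leqP => h' //; [congr Some; lia|lia].
Qed.

Lemma pprodV (X Y : Type) (h h' : X -> option X) (g g' : Y -> option Y) :
  (forall x y, h x = Some y <-> h' y = Some x) ->
  (forall x y, g x = Some y <-> g' y = Some x) ->
  forall x y, pprod h g x = Some y <-> pprod h' g' y = Some x.
Proof.
move=> hh gg [a b] [c d]; rewrite /pprod/=; split.
  case E1: (h a) => [?|]//=; case E2: (g b) => [?|]//= -[<- <-].
  by move/hh: E1 => ->; move/gg: E2 => /= ->.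
case E1: (h' c) => [?|]//=; case E2: (g' d) => [?|]//= -[<- <-].
by move/hh: E1 => ->; move/gg: E2 => /= ->.
Qed.

Lemma bmapV b1 b2 r n m x y :
  bmap b1 b2 r n m x = Some y <-> bmap b1 b2 (- r) m n y = Some x.
Proof.
apply: pprodV; first by apply: pprodV => a a'; exact: cmapV.
by move=> k l; split=> -[<-]; congr Some; lia.
Qed.

Lemma inT_adjoint s : inT s -> exists2 s', inT s' & adjoint s s'.
Proof.
move=> /inTP[->|[b1 [b2 [r [n [m [w ->]]]]]]].
  exists (fun=> 0); first by left.
  move=> f g; have z (h : ell2 X3) : ip 0 h = 0.
    by have := ip_linear (-1) (0 : ell2 X3) 0 h; rewrite scaler0 addr0 mulN1r addNr.
  by rewrite z ip_conj z conjC0.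
exists (pull (bmap b1 b2 (- r) m n)); last by apply: adjoint_pull => x y; exact: bmapV.
apply/inTP; right; exists b1, b2, (- r), m, n; split=> //.
by case: b1 b2 w => [] []; rewrite /wf/=; lia.
Qed.

End InverseSemigroup.

Section Semigroup.
Variable R : realType.
Local Notation ell2 := (ell2 R).
Local Notation op3 := (op3 R).

Record semigT := SemigT { opT :> op3; opTP : `[< inT opT >] }.
HB.instance Definition _ := [isSub for opT].
HB.instance Definition _ := [Choice of semigT by <:].

Lemma T_inT (s : semigT) : inT (opT s). Proof. exact/asboolP/opTP. Qed.

Definition mulT (s s' : semigT) : semigT :=
  SemigT (asboolT (inT_comp (T_inT s) (T_inT s'))).

Lemma starT_subproof (s : semigT) : exists s' : semigT, adjoint (opT s) (opT s').
Proof. by have [f fT sf] := inT_adjoint (T_inT s); exists (SemigT (asboolT fT)). Qed.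
Definition starT (s : semigT) : semigT := sval (cid (starT_subproof s)).

Definition zeroT : semigT := SemigT (asboolT (or_introl erefl : inT (fun=> 0 : ell2 X3))).

Lemma oneT_subproof : inT (B1 0 (0, 0)%N (0, 0)%N : op3).
Proof. by right; exists 0, (0, 0)%N, (0, 0)%N; apply: Or41; rewrite subrr. Qed.
Definition oneT : semigT := SemigT (asboolT oneT_subproof).
HB.instance Definition _ := isPointed.Build semigT oneT.

(* [f] as an element of the semigroup. *)
Definition toT (f : op3) : semigT := insubd zeroT f.

Definition projection (f : op3) := f \o f = f /\ adjoint f f.

Record projT := ProjT { projT_val :> semigT; projT_valP : `[< projection (opT projT_val) >] }.
HB.instance Definition _ := [isSub for projT_val].
HB.instance Definition _ := [Choice of projT by <:].

Definition pid (A : pred X3) (x : X3) := if A x then Some x else None.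

Lemma pinj_pid A : pinj (pid A).
Proof. by move=> x y z; rewrite /pid; case: ifP => // _ [->]; case: ifP => // _ []. Qed.

Lemma T_pull (s : semigT) : exists h g : X3 -> option X3,
  [/\ forall x y, h x = Some y <-> g y = Some x, pinj h, pinj g,
      opT s = pull h & opT (starT s) = pull g].
Proof.
have [h [g [hg sh]]] : exists h g : X3 -> option X3,
    (forall x y, h x = Some y <-> g y = Some x) /\ opT s = pull h.
  have /inTP[->|[b1 [b2 [r [n [m [_ ->]]]]]]] := T_inT s.
    by exists (fun=> None), (fun=> None); rewrite pull_none.
  by exists (bmap b1 b2 r n m), (bmap b1 b2 (- r) m n); split=> // x y; exact: bmapV.
have hi : pinj h by move=> x y z /hg + /hg => -> [].
have gi : pinj g by move=> x y z /hg + /hg => -> [].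
exists h, g; split=> //; rewrite /starT; case: cid => s' /= ss'.
by apply: (adjoint_uniq ss'); rewrite sh; exact: adjoint_pull.
Qed.

Lemma projection_pid A : projection (pull (pid A)).
Proof.
split; last first.
  apply: adjoint_pull => x y; rewrite /pid; split; case: ifP => // Ax [<-];
  by rewrite Ax.
rewrite pull_comp; [|exact: pinj_pid..]; apply: eq_pull => x.
by rewrite /pid; case: ifP => //= ->.
Qed.

Lemma E_pull (e : projT) : exists A : pred X3, opT e = pull (pid A).
Proof.
have /asboolP[ee _] := projT_valP e; have [h [_ [_ hi _ eh _]]] := T_pull e.
exists (fun x => h x == Some x); rewrite eh; apply: eq_pull => x; rewrite /pid.
move: ee; rewrite eh pull_comp// => /(pull_inj (pinj_comp hi hi) hi) /(_ x).
case E1: (h x) => [y|] //= hy; have {1}-> : x = y by apply: hi E1 hy.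
by rewrite (hi _ _ _ E1 hy) eqxx.
Qed.

Lemma mulE_subproof (e f : projT) : `[< projection (opT (mulT e f)) >].
Proof.
apply/asboolP; have [A eA] := E_pull e; have [B fB] := E_pull f.
rewrite /= eA fB pull_comp; [|exact: pinj_pid..].
rewrite (_ : pull _ = pull (pid (fun x => A x && B x))); first exact: projection_pid.
by apply: eq_pull => x; rewrite /pid; case: ifP.
Qed.
Definition mulE (e f : projT) : projT := ProjT (mulE_subproof e f).

Lemma conjE_subproof (s : semigT) (e : projT) :
  `[< projection (opT (mulT (mulT s e) (starT s))) >].
Proof.
apply/asboolP; have [h [g [hg hi gi sh sg]]] := T_pull s; have [A eA] := E_pull e.
rewrite /= eA sg sh pull_comp//; last exact: pinj_pid.
rewrite pull_comp//; last by apply: pinj_comp => //; exact: pinj_pid.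
rewrite (_ : pull _ = pull (pid (fun x => oapp A false (h x)))).
  exact: projection_pid.
apply: eq_pull => x; rewrite /pid; case hx: (h x) => [y|]//=.
by case: (A y) => //=; apply/hg.
Qed.
Definition conjE (s : semigT) (e : projT) : projT := ProjT (conjE_subproof s e).

Lemma rangeE_subproof (s : semigT) : `[< projection (opT (mulT s (starT s))) >].
Proof.
apply/asboolP; have [h [g [hg hi gi sh sg]]] := T_pull s.
rewrite /= sg sh pull_comp// (_ : pull _ = pull (pid (fun x => h x != None))).
  exact: projection_pid.
by apply: eq_pull => x; rewrite /pid; case hx: (h x) => [y|]//=; apply/hg.
Qed.
Definition rangeE (s : semigT) : projT := ProjT (rangeE_subproof s).

Lemma zeroE_subproof : `[< projection (opT zeroT) >].
Proof.
apply/asboolP; rewrite /= -(pull_none R).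
by rewrite -[pull _]/(pull (pid xpred0)); exact: projection_pid.
Qed.
Definition zeroE : projT := ProjT zeroE_subproof.

(* {0,1}^E with the product topology. *)
Definition chars := prod_topology (fun _ : projT => bool).

Definition character (x : chars) :=
  [/\ exists e, x e, forall e f, x (mulE e f) = x e && x f & x zeroE = false].
Definition Ehat0 : set chars := [set x | character x].

Definition is_filter (A : set projT) :=
  [/\ A !=set0, ~ A zeroE, forall e f, A e -> A f -> A (mulE e f) &
      forall e f, A e -> mulE f e = e -> A f].
Definition is_ultrafilter (A : set projT) :=
  is_filter A /\ forall B, is_filter B -> A `<=` B -> B = A.

Definition Ehat_infty : set chars :=
  [set x | Ehat0 x /\ is_ultrafilter [set e | x e]].
Definition Ehat_tight : set chars := Ehat0 `&` closure Ehat_infty.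

(* [None] is the point at infinity. *)
Definition Lam (k1 k2 : option nat) : set projT :=
  match k1, k2 with
  | Some k1, Some k2 => [set e | opT e = B4 0 (k1, k2) (k1, k2)]
  | Some k1, None => [set e | exists2 l, (k1 <= l)%N & opT e = B3 0 (k1, l) (k1, l)]
  | None, Some k2 => [set e | exists2 l, (k2 <= l)%N & opT e = B2 0 (l, k2) (l, k2)]
  | None, None => [set e | exists l, opT e = B1 0 (l, l) (l, l)]
  end.
Definition phi (k1 k2 : option nat) : chars :=
  fun f => `[< exists2 e, Lam k1 k2 e & mulE f e = e >].

Definition act (x : chars) (s : semigT) : chars := fun e => x (conjE s e).

Definition Sigma_pred (xs : chars * semigT) :=
  `[< Ehat0 xs.1 /\ xs.1 (rangeE xs.2) >].
Record Sigma := MkSigma { sigval :> chars * semigT; sigP : Sigma_pred sigval }.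
HB.instance Definition _ := [isSub for sigval].
HB.instance Definition _ := [Choice of Sigma by <:].

Definition germ_rel : rel Sigma := fun a b =>
  `[< (sigval a).1 = (sigval b).1 /\
      exists2 e : projT, (sigval a).1 e & mulT e (sigval a).2 = mulT e (sigval b).2 >].

Lemma mulTA (a b c : semigT) : mulT a (mulT b c) = mulT (mulT a b) c.
Proof. exact: val_inj. Qed.

Lemma mulEC e f : mulE e f = mulE f e.
Proof.
apply/val_inj/val_inj => /=.
have [A ->] := E_pull e; have [B ->] := E_pull f.
rewrite !pull_comp; [|exact: pinj_pid..]; apply: eq_pull => x.
by rewrite /pid; case: (boolP (A x)) => a; case: (boolP (B x)) => b /=;
  rewrite ?(negbTE a) ?(negbTE b) ?a ?b.
Qed.

Lemma germ_refl : reflexive germ_rel.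
Proof.
move=> a; apply/asboolP; split=> //; exists (rangeE (sigval a).2) => //.
by have /asboolP[] := sigP a.
Qed.

Lemma germ_sym : symmetric germ_rel.
Proof.
suff sym a b : germ_rel a b -> germ_rel b a.
  by move=> a b; apply/idP/idP; exact: sym.
move=> /asboolP[ab [e xe ee]]; apply/asboolP; split=> //.
by exists e; [rewrite -ab|].
Qed.

Lemma germ_trans : transitive germ_rel.
Proof.
move=> b a c /asboolP[ab [e xe ee]] /asboolP[bc [f xf ff]]; apply/asboolP.
rewrite ab; split=> //; exists (mulE e f).
  by have /asboolP[[_ -> _] _] := sigP b; rewrite xf -ab xe.
rewrite mulEC -[LHS]mulTA ee mulTA -[mulT f e]/(projT_val (mulE f e)) mulEC.
by rewrite -[LHS]mulTA ff mulTA.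
Qed.

Canonical germ_equiv := EquivRel germ_rel germ_refl germ_sym germ_trans.

End Semigroup.

Local Open Scope quotient_scope.
Section Groupoid.
Variable R : realType.
Local Notation C := (Cx R).
Local Notation semigT := (semigT R).
Local Notation projT := (projT R).
Local Notation chars := (chars R).
Local Notation Sigma := (Sigma R).

Lemma Sigma_inhabited : exists x : chars, Sigma_pred (x, oneT R).
Proof.
pose o : X3 := (0%N, 0%N, 0 : int); pose x : chars := fun e => opT e (delta R o) o == 1.
have xE (e : projT) A : opT e = pull (pid A) -> x e = A o.
  move=> eA; rewrite /x /= eA pullE; last exact: pinj_pid.
  rewrite /pid; case: (A o); rewrite /= ?deltaE ?eqxx//.
  by apply/negbTE; rewrite eq_sym oner_neq0.
have x1 : x (rangeE (oneT R)).
  have [h [g [hg hi gi sh sg]]] := T_pull (oneT R).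
  rewrite (xE _ (fun x => h x != None)); last first.
    rewrite -[LHS]/(opT (oneT R) \o opT (starT (oneT R))) sg sh pull_comp//.
    apply: eq_pull => y.
    by rewrite /pid; case hy: (h y) => [z|]//=; apply/hg.
  have : h =1 bmap false false 0 (0, 0)%N (0, 0)%N.
    apply: (@pull_inj R) => //; first exact: pinj_bmap.
    by rewrite -tens3E -SSE -sh.
  by move=> ->.
exists x; apply/asboolP; split=> //=; split; last by rewrite (xE _ xpred0) //= -pull_none.
  by exists (rangeE (oneT R)).
move=> e f; have [A eA] := E_pull e; have [B fB] := E_pull f.
rewrite (xE _ _ eA) (xE _ _ fB) (xE _ (fun x => A x && B x))//=.
rewrite eA fB pull_comp; [|exact: pinj_pid..]; apply: eq_pull => y.
by rewrite /pid; case: ifP.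
Qed.

Definition gpd : Type := {eq_quot germ_equiv R}.
HB.instance Definition _ := Choice.on gpd.

Definition mk_gpd : Sigma -> gpd := \pi_{eq_quot germ_equiv R}.
Definition gpd_repr (g : gpd) : Sigma := repr (g : {eq_quot germ_equiv R}).

(* [germ x s] is the class of (x, s), for x a character with x (s s^* ) = 1;
   it is a dummy value otherwise. *)
Definition germ (x : chars) (s : semigT) : gpd :=
  mk_gpd (insubd (MkSigma (svalP (cid Sigma_inhabited))) (x, s)).

Definition grange (g : gpd) : chars := (sigval (gpd_repr g)).1.
Definition grep (g : gpd) : semigT := (sigval (gpd_repr g)).2.
Definition gsource (g : gpd) : chars := act (grange g) (grep g).
(* Meaningful when [gsource g = grange h]. *)
Definition gmul (g h : gpd) : gpd := germ (grange g) (mulT (grep g) (grep h)).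
Definition ginv (g : gpd) : gpd := germ (gsource g) (starT (grep g)).

(* {[(x, s)] : x in U} for U the trace on D_s of an open set of {0,1}^E. These
   sets are a base, hence generate the same topology when taken as a subbase. *)
Definition germ_box (Us : set chars * semigT) : set gpd :=
  [set germ x Us.2 | x in [set x | Us.1 x /\ Ehat0 x /\ x (rangeE Us.2)]].
HB.instance Definition _ := isSubBaseTopological.Build gpd
  [set Us : set chars * semigT | open Us.1] germ_box.
End Groupoid.

Section GroupoidAlgebra.
Variable R : realType.
Local Notation C := (Cx R).
Local Notation semigT := (semigT R).
Local Notation gpd := (gpd R).
Local Notation ell2 := (ell2 R).
Local Notation chars := (chars R).
Local Notation op3 := (op3 R).

Definition Gtight : set gpd :=
  [set g | Ehat_tight (grange g) /\ Ehat_tight (gsource g)].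

(* Functions on a subset of the groupoid are represented by their extension by
   0; [Cc A] is the set of compactly supported continuous functions on [A]. *)
Definition Cc (A : set gpd) : set (gpd -> C) :=
  [set f | {within A, continuous f} /\
           exists K, [/\ compact K, K `<=` A & forall g, f g != 0 -> K g]].

Definition conv (f h : gpd -> C) : gpd -> C := fun x =>
  \sum_(y \in [set y | Gtight y /\ grange y = grange x]) f y * h (gmul (ginv y) x).
Definition invol (f : gpd -> C) : gpd -> C := fun x => (f (ginv x))^*.

Definition Cc_representation (H : hilbert R) (p : (gpd -> C) -> H -> H) :=
  [/\ forall f, Cc Gtight f -> bounded_op (p f),
      forall a f h, Cc Gtight f -> Cc Gtight h ->
        forall v, p (a *: f + h) v = a *: p f v + p h v,
      forall f h, Cc Gtight f -> Cc Gtight h -> p (conv f h) = p f \o p h &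
      forall f, Cc Gtight f -> adjoint (p f) (p (invol f))].

Record cstar_algebra := CStarAlgebra {
  cscar :> lmodType C;
  csmul : cscar -> cscar -> cscar;
  csstar : cscar -> cscar;
  csnorm : cscar -> R;
  csmulA : associative csmul;
  csmul_linearl : forall b, linear (csmul^~ b);
  csmul_linearr : forall b, linear (csmul b);
  csstarK : involutive csstar;
  csstar_linear : forall (c : C) a b,
    csstar (c *: a + b) = c^* *: csstar a + csstar b;
  csstarM : forall a b, csstar (csmul a b) = csmul (csstar b) (csstar a);
  csnorm_eq0 : forall a, csnorm a = 0 -> a = 0;
  csnormD : forall a b, csnorm (a + b) <= csnorm a + csnorm b;
  csnormZ : forall (c : C) a, csnorm (c *: a) = re `|c| * csnorm a;
  csnormM : forall a b, csnorm (csmul a b) <= csnorm a * csnorm b;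
  csnorm_star : forall a, csnorm (csmul (csstar a) a) = csnorm a ^+ 2;
  cscomplete : forall u : nat -> cscar,
    (forall e : R, 0 < e -> exists N, forall m n, (N <= m)%N -> (N <= n)%N ->
       csnorm (u m - u n) < e) ->
    exists l, forall e : R, 0 < e -> exists N, forall n, (N <= n)%N ->
       csnorm (u n - l) < e }.

Definition full_groupoid_algebra (A : cstar_algebra) (iota : (gpd -> C) -> A) :=
  [/\ forall a f h, Cc Gtight f -> Cc Gtight h ->
        iota (a *: f + h) = a *: iota f + iota h,
      forall f h, Cc Gtight f -> Cc Gtight h ->
        iota (conv f h) = csmul (iota f) (iota h),
      forall f, Cc Gtight f -> iota (invol f) = csstar (iota f),
      forall f, Cc Gtight f -> csnorm (iota f) =
        sup [set r | exists (H : hilbert R) (p : (gpd -> C) -> H -> H),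
                     Cc_representation p /\ r = opnorm (p f)] &
      forall a (e : R), 0 < e ->
        exists2 f, Cc Gtight f & csnorm (a - iota f) < e].

Definition representation (A : cstar_algebra) (H : hilbert R) (p : A -> H -> H) :=
  [/\ forall a, bounded_op (p a) /\ opnorm (p a) <= csnorm a,
      forall c a b v, p (c *: a + b) v = c *: p a v + p b v,
      forall a b, p (csmul a b) = p a \o p b &
      forall a, adjoint (p a) (p (csstar a))].

Definition equivalent (A : Type) (H K : hilbert R)
    (p : A -> H -> H) (q : A -> K -> K) :=
  exists2 U : H -> K, unitary U & forall a v, U (p a v) = q a (U v).

Definition closed_star_subalgebra (H : hilbert R) (D : set (H -> H)) :=
  [/\ D `<=` @bounded_op R H H,
      D (fun=> 0) /\ forall c f h, D f -> D h -> D (fun v => c *: f v + h v),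
      forall f h, D f -> D h -> D (f \o h),
      forall f h, D f -> bounded_op h -> adjoint f h -> D h &
      forall f, bounded_op f -> (forall e : R, 0 < e ->
        exists2 h, D h & opnorm (fun v => f v - h v) < e) -> D f].

Variant gen := g1 | g2 | g3 | g4.

(* The generators without their signs. The second one has its projection in the
   second tensor factor: only with this numbering does the unit phi(oo, k2), where
   projections p occur in the second factor, give a representation annihilating
   the third generator and not the second one, as [Pi2] below. *)
Definition gen_op (j : gen) : op3 :=
  match j with
  | g1 => tens (tens (@Sadj R) (@Sadj R)) (bt 1)
  | g2 => tens (tens (@Sadj R) (@pop R)) (bt 1)
  | g3 => tens (tens (@pop R) (@Sadj R)) (bt 1)
  | g4 => tens (tens (@pop R) (@pop R)) (bt 1)
  end.

Definition s0 (j : gen) : op3 :=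
  match j with g1 => gen_op g1 | _ => fun f => - gen_op j f end.

Lemma gen_op_inT j : inT (gen_op j).
Proof.
right; case: j.
- by exists (- 1), (1, 1)%N, (0, 0)%N; apply: Or41.
- by exists (- 1), (1, 0)%N, (0, 0)%N; apply: Or42.
- by exists (- 1), (0, 1)%N, (0, 0)%N; apply: Or43.
- by exists (- 1), (0, 0)%N, (0, 0)%N; apply: Or44.
Qed.

(* The generators as elements of the inverse semigroup, where signs are dropped. *)
Definition genT (j : gen) : semigT := SemigT (asboolT (gen_op_inT j)).

Definition Theta (s : semigT) : set gpd :=
  [set germ x s | x in [set x : chars | x (rangeE s) /\ Ehat_tight x]].

Definition D0 : set op3 :=
  smallest (@closed_star_subalgebra (ell2 X3)) [set s0 j | j in [set: gen]].

Definition iso_onto_D0 (A : cstar_algebra) (iota : (gpd -> C) -> A)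
    (Phi : A -> op3) :=
  [/\ representation Phi, forall a, opnorm (Phi a) = csnorm a,
      range Phi = D0 & forall j, Phi (iota \1_(Theta (genT j))) = s0 j].

Definition D0_representation (K : hilbert R) (p : op3 -> K -> K) :=
  [/\ forall d, D0 d -> bounded_op (p d) /\ opnorm (p d) <= opnorm d,
      forall c d d', D0 d -> D0 d' ->
        forall v, p (fun f => c *: d f + d' f) v = c *: p d v + p d' v,
      forall d d', D0 d -> D0 d' -> p (d \o d') = p d \o p d' &
      forall d d', D0 d -> D0 d' -> adjoint d d' -> adjoint (p d) (p d')].

(* The representation of D0 taking the values [v j] on the generators. *)
Definition D0_representation_of (K : hilbert R) (v : gen -> K -> K)
    (p : op3 -> K -> K) :=
  D0_representation p /\ forall j, p (s0 j) = v j.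

(* Values on the generators of the representations Pi_(w1 w2, t0), Pi_(w1, t0),
   Pi_(w2, t0) and Pi_(1, t0). *)
Definition Pi12 (t0 : C) (j : gen) : ell2 (nat * nat)%type -> ell2 (nat * nat)%type :=
  match j with
  | g1 => fun f => t0 *: tens (@Sadj R) (@Sadj R) f
  | g2 => fun f => t0 *: tens (@Sadj R) (@pop R) f
  | g3 => fun f => t0 *: tens (@pop R) (@Sadj R) f
  | g4 => fun f => t0 *: tens (@pop R) (@pop R) f
  end.
Definition Pi1 (t0 : C) (j : gen) : ell2 nat -> ell2 nat :=
  match j with
  | g1 => fun f => t0 *: Sadj f
  | g3 => fun f => t0 *: pop f
  | _ => fun=> 0
  end.
Definition Pi2 (t0 : C) (j : gen) : ell2 nat -> ell2 nat :=
  match j with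
  | g1 => fun f => t0 *: Sadj f
  | g2 => fun f => t0 *: pop f
  | _ => fun=> 0
  end.
Definition Pi0 (t0 : C) (j : gen) : scalarH R -> scalarH R :=
  match j with
  | g1 => fun z => t0 *: z
  | _ => fun=> 0
  end.

Definition fiber (u : chars) : set gpd := [set g | Gtight g /\ gsource g = u].

(* Sesquilinear with the same convention as [ip], linear in the first variable.
   With the conjugate on [f] instead of [h] the values on indicator functions are
   the same, but e_n = t0^n e_0 would hold in the completion instead of
   e_n = t0^(- n) e_0. *)
Definition pairing_star (u : chars) (f h : gpd -> C) (k : gpd) : C :=
  \sum_(y \in fiber u) f y * (h (gmul y k))^*.

(* The representation of the functions on the isotropy group {sigma n : n in Z}
   determined by t0. *)
Definition Lrep (t0 : C) (sigma : int -> gpd) (f : gpd -> C) : C :=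
  \sum_(n \in [set: int]) f (sigma n) * t0 ^ n.

(* [H], with [kappa], is the Hilbert space completion of Cc(G_u) for the form
   L(<f, h>_* ). *)
Definition induced_space (t0 : C) (u : chars) (sigma : int -> gpd)
    (H : hilbert R) (kappa : (gpd -> C) -> H) :=
  [/\ forall c f h, Cc (fiber u) f -> Cc (fiber u) h ->
        kappa (c *: f + h) = c *: kappa f + kappa h,
      forall f h, Cc (fiber u) f -> Cc (fiber u) h ->
        ip (kappa f) (kappa h) = Lrep t0 sigma (pairing_star u f h) &
      forall v (e : R), 0 < e ->
        exists2 f, Cc (fiber u) f & hnorm (v - kappa f) < e].

Definition induced_representation (u : chars) (H : hilbert R)
    (kappa : (gpd -> C) -> H) (A : cstar_algebra) (iota : (gpd -> C) -> A)
    (Ind : A -> H -> H) :=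
  representation Ind /\
  forall f h, Cc Gtight f -> Cc (fiber u) h ->
    Ind (iota f) (kappa h) = kappa (conv f h).

(* Ind L is equivalent to the representation of D0 with values [v] on the
   generators, transported along the isomorphism [Phi] from C*(G) to D0 that
   identifies the indicator functions a_j with the generators of D0. *)
Definition Ind_equivalent (u : chars) (H : hilbert R) (kappa : (gpd -> C) -> H)
    (K : hilbert R) (v : gen -> K -> K) :=
  forall (A : cstar_algebra) (iota : (gpd -> C) -> A) (Phi : A -> op3)
    (Ind : A -> H -> H),
  full_groupoid_algebra iota -> iso_onto_D0 iota Phi ->
  induced_representation u kappa iota Ind ->
  (exists p, D0_representation_of v p) /\
  forall p, D0_representation_of v p -> equivalent Ind (p \o Phi).

Local Notation oo := (@None nat).

Definition sigma1 (r : int) : gpd := germ (phi oo oo)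
  (toT (if (0 <= r)%R then B1 r (0, 0) (`|r|, `|r|) else B1 r (`|r|, `|r|) (0, 0))%N).

Definition rho2 (k2 : nat) (s : nat * int) : gpd := germ (phi oo (Some s.1))
  (toT (if (0 <= s.2)%R
        then B2 s.2 (s.1 + k2, s.1) (`|s.2| + s.1 + k2, k2)
        else B2 s.2 (s.1 + k2 + `|s.2|, s.1) (s.1 + k2, k2))%N).

Definition rho3 (k1 : nat) (s : nat * int) : gpd := germ (phi (Some s.1) oo)
  (toT (if (0 <= s.2)%R
        then B3 s.2 (s.1, s.1 + k1) (k1, `|s.2| + s.1 + k1)
        else B3 s.2 (s.1, s.1 + k1 + `|s.2|) (k1, s.1 + k1))%N).

Definition rho4 (k : nat * nat) (s : nat * nat * int) : gpd :=
  germ (phi (Some s.1.1) (Some s.1.2)) (toT (B4 s.2 s.1 k)).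

Definition tensv (X Y : choiceType) (f : ell2 X) (h : ell2 Y) : ell2 (X * Y)%type :=
  mk_l2 (fun z => f z.1 * h z.2).

End GroupoidAlgebra.

(* Main.v *)
(* Every element of T is a partial bijection of N x N x Z that translates its domain by a
   constant vector, so a germ [(x, s)] is determined by the character x and this vector
   of Z^3: the tight groupoid becomes a groupoid of pairs (range, displacement), with
   displacements adding up under composition. The fiber over a unit is then I x Z with
   I the orbit of the unit and the isotropy group Z acting by translation, so that
   e_(i, r) = t0^(-r) e_(i, 0) in the completion and the e_(i, 0) are an orthonormal basis.
   Left convolution with the indicator of Theta_s permutes the indicators of points, which
   gives the values of Ind L on the generators; a representation of D0 is determined by
   these values, D0 being the smallest closed *-algebra containing the generators. *)
Require Import Defs.
From HB Require Import structures.
From mathcomp Require Import all_boot all_order all_algebra.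
From mathcomp Require Import complex.
From mathcomp Require Import all_classical all_reals all_analysis.
From mathcomp Require Import ring lra zify.
Import Order.TTheory GRing.Theory Num.Theory numFieldNormedType.Exports.
Local Open Scope classical_set_scope.
Local Open Scope ring_scope.
Set Implicit Arguments.
Unset Strict Implicit.
Unset Printing Implicit Defensive.

(** * Hilbert spaces *)

(** The algebra with [iota], the space [H] with [kappa], and [Ind] are given only through
    characterizing properties, so everything must be read off from indicator functions. Two
    topological facts make these enough: the fibers of the source map are discrete, so
    [Cc (fiber u)] is spanned by indicators of points; and each [Theta s] is compact with a
    continuous indicator on the tight groupoid, so the a_j lie in [Cc]. The two coordinates in N are
    extended by infinity. The domain of a projection is the product of two sides and Z, and
    [phi k1 k2] is evaluation at the point (k1, k2). A factor p only accepts the coordinate 0, so a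
    generator with p at an infinite coordinate acts by zero: this is what separates the four orbits.
    The scalar t0 comes from the factor t of the generators: it lowers the Z coordinate by one, and
    e_(i, -1) = t0 e_(i, 0). A representation of [D0] with the required values is obtained by
    transporting [Ind] along the unitary and the inverse of [Phi]. *)

Section HilbertTheory.
Variables (R : realType) (H : hilbert R).
Local Notation C := (Cx R).
Implicit Types (x y z : H) (a : C).

Lemma ipDl x y z : ip (x + y) z = ip x z + ip y z.
Proof. by rewrite -[x]scale1r ip_linear mul1r scale1r. Qed.

Lemma ip0l z : ip 0 z = 0.
Proof. by apply: (addrI (ip 0 z)); rewrite -ipDl !addr0. Qed.

Lemma ipZl a x z : ip (a *: x) z = a * ip x z.
Proof. by rewrite -[a *: x]addr0 ip_linear ip0l addr0. Qed.

Lemma ipNl x z : ip (- x) z = - ip x z.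
Proof. by rewrite -scaleN1r ipZl mulN1r. Qed.

Lemma ipDr x y z : ip x (y + z) = ip x y + ip x z.
Proof. by rewrite ip_conj ipDl rmorphD/= -!ip_conj. Qed.

Lemma ipZr a x y : ip x (a *: y) = a^* * ip x y.
Proof. by rewrite ip_conj ipZl rmorphM/= -ip_conj. Qed.

Lemma ip0r z : ip z 0 = 0.
Proof. by rewrite ip_conj ip0l conjC0. Qed.

Lemma ipNr x z : ip x (- z) = - ip x z.
Proof. by rewrite ip_conj ipNl rmorphN/= -ip_conj. Qed.

Lemma ip_suml I (s : seq I) (f : I -> H) z :
  ip (\sum_(i <- s) f i) z = \sum_(i <- s) ip (f i) z.
Proof. by elim: s => [|i s ih]; rewrite ?big_nil ?ip0l// !big_cons ipDl ih. Qed.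

Lemma ip_sumr I (s : seq I) (f : I -> H) z :
  ip z (\sum_(i <- s) f i) = \sum_(i <- s) ip z (f i).
Proof. by elim: s => [|i s ih]; rewrite ?big_nil ?ip0r// !big_cons ipDr ih. Qed.

Lemma hnorm_ge0 x : 0 <= hnorm x.
Proof. exact: sqrtr_ge0. Qed.

Lemma hnorm_sqr x : ofR (hnorm x ^+ 2) = ip x x.
Proof. by rewrite sqr_sqrtr ?re_ge0 ?ip_ge0// reK ?ip_ge0. Qed.

Lemma hnorm0 : hnorm (0 : H) = 0.
Proof. by rewrite /hnorm ip0l sqrtr0. Qed.

Lemma hnorm_eq0 x : hnorm x = 0 -> x = 0.
Proof. by move=> x0; apply: ip_eq0; rewrite -hnorm_sqr x0 expr0n. Qed.

Lemma hnormN x : hnorm (- x) = hnorm x.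
Proof. by rewrite /hnorm ipNl ipNr opprK. Qed.

Lemma hnorm_distC x y : hnorm (x - y) = hnorm (y - x).
Proof. by rewrite -hnormN opprB. Qed.

Lemma ofRM (u v : R) : ofR (u * v) = ofR u * ofR v :> C.
Proof. exact: (rmorphM (real_complex R)). Qed.

Lemma ofRX (u : R) n : ofR (u ^+ n) = ofR u ^+ n :> C.
Proof. exact: (rmorphXn (real_complex R)). Qed.

Lemma ofR_gt0 (u : R) : (0 < ofR u :> C) = (0 < u).
Proof. by rewrite -[0 in LHS]/(ofR 0) ofR_lt. Qed.

Lemma hnorm_lt x (e : R) : 0 < e -> (hnorm x < e) = (ip x x < ofR (e ^+ 2)).
Proof.
by move=> e0; rewrite -hnorm_sqr ofR_lt ltr_pXn2r// nnegrE ?hnorm_ge0// ltW.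
Qed.

Lemma hnormZ a x : hnorm (a *: x) = re `|a| * hnorm x.
Proof.
apply/eqP; rewrite -(@eqrXn2 _ 2)// ?mulr_ge0 ?re_ge0 ?hnorm_ge0//.
apply/eqP/(can_inj (@ofRK R)).
by rewrite hnorm_sqr exprMn (ofRM (_ ^+ _)) hnorm_sqr ofRX reK// ipZl ipZr mulrA normCK.
Qed.

Lemma cauchy_schwarz x y : re `|ip x y| <= hnorm x * hnorm y.
Proof.
have [y0|y0] := eqVneq (ip y y) 0.
  by rewrite (ip_eq0 y0) ip0r normr0 mulr_ge0// hnorm_ge0.
rewrite -(@ler_pXn2r _ 2)// ?nnegrE ?mulr_ge0 ?re_ge0 ?hnorm_ge0//.
rewrite -ofR_le exprMn (ofRM (_ ^+ _)) !hnorm_sqr ofRX reK//.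
have yR : (ip y y)^* = ip y y by rewrite -ip_conj.
have y_gt0 : 0 < ip y y by rewrite lt_neqAle eq_sym y0 ip_ge0.
have := ip_ge0 (x - (ip x y / ip y y) *: y).
rewrite !(ipDl, ipDr, ipNl, ipNr, ipZl, ipZr).
rewrite !rmorphM/= fmorphV/= yR -ip_conj.
have -> : ip x x - ip y x / ip y y * ip x y
    + (- (ip x y / ip y y * ip y x) - - (ip x y / ip y y * (ip y x / ip y y * ip y y)))
  = (ip x x * ip y y - ip x y * ip y x) / ip y y by field.
by rewrite pmulr_lge0 ?invr_gt0// subr_ge0 normCK -ip_conj.
Qed.

Lemma hnormD x y : hnorm (x + y) <= hnorm x + hnorm y.
Proof.
rewrite -(@ler_pXn2r _ 2)// ?nnegrE ?addr_ge0 ?hnorm_ge0//.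
have sq z : hnorm z ^+ 2 = re (ip z z) by rewrite -hnorm_sqr ofRK.
rewrite sqrrD !sq !(ipDl, ipDr) !reD.
have re_conj (z : C) : re z^* = re z by case: z.
have : re (ip y x) = re (ip x y) by rewrite ip_conj re_conj.
have := le_trans (ler_norm _) (le_trans (re_norm _) (cauchy_schwarz x y)).
by lra.
Qed.

Lemma hnormB x y : hnorm (x - y) <= hnorm x + hnorm y.
Proof. by rewrite -[hnorm y]hnormN hnormD. Qed.

Lemma small_hnorm_eq0 x : (forall e, 0 < e -> hnorm x < e) -> x = 0.
Proof.
move=> xe; apply: hnorm_eq0; apply/eqP; apply: contraT => x0.
by have := xe (hnorm x); rewrite ltxx lt_neqAle eq_sym x0 hnorm_ge0 => /(_ isT).
Qed.

Section Orthonormal.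
Variables (I : choiceType) (e : I -> H).
Hypothesis e_on : forall i j, ip (e i) (e j) = (i == j)%:R.

Lemma bessel_identity x (s : seq I) : uniq s ->
  ip (x - \sum_(i <- s) ip x (e i) *: e i) (x - \sum_(i <- s) ip x (e i) *: e i) =
  ip x x - \sum_(i <- s) `|ip x (e i)| ^+ 2.
Proof.
move=> us; set p := \sum_(i <- s) _.
have pe j : j \in s -> ip p (e j) = ip x (e j).
  move=> js; rewrite ip_suml (bigD1_seq j)//= ipZl e_on eqxx mulr1 big1 ?addr0//.
  by move=> i ij; rewrite ipZl e_on (negbTE ij) mulr0.
have dp : ip (x - p) p = 0.
  rewrite {2}/p ip_sumr big_seq big1// => i si.
  by rewrite ipZr ipDl ipNl pe// subrr mulr0.
rewrite ipDr ipNr dp subr0 ipDl ipNl; congr (_ - _).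
rewrite ip_suml; apply: eq_bigr => i _.
by rewrite ipZl [ip (e i) x]ip_conj normCK.
Qed.

Lemma bessel x (s : seq I) : uniq s -> \sum_(i <- s) `|ip x (e i)| ^+ 2 <= ip x x.
Proof. by move=> us; rewrite -subr_ge0 -bessel_identity// ip_ge0. Qed.

End Orthonormal.
End HilbertTheory.

Section LinearOperators.
Variables (R : realType) (H K : hilbert R).
Local Notation C := (Cx R).
Implicit Types (f : H -> K) (x y : H).

Section Linear.
Variable f : H -> K.
Hypothesis f_lin : linear f.

Lemma linear_op0 : f 0 = 0.
Proof. by have := f_lin (-1) 0 0; rewrite scaler0 addr0 scaleN1r addNr. Qed.

Lemma linear_opD x y : f (x + y) = f x + f y.
Proof. by rewrite -[x]scale1r f_lin !scale1r. Qed.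

Lemma linear_opZ (a : C) x : f (a *: x) = a *: f x.
Proof. by rewrite -[a *: x]addr0 f_lin linear_op0 addr0. Qed.

Lemma linear_opB x y : f (x - y) = f x - f y.
Proof. by rewrite linear_opD -scaleN1r linear_opZ scaleN1r. Qed.

Lemma linear_op_sum I (s : seq I) (c : I -> C) (e : I -> H) :
  f (\sum_(i <- s) c i *: e i) = \sum_(i <- s) c i *: f (e i).
Proof.
elim: s => [|i s ih]; first by rewrite !big_nil linear_op0.
by rewrite !big_cons linear_opD linear_opZ ih.
Qed.

End Linear.

Lemma isometry_hnorm f x : (forall y, ip (f y) (f y) = ip y y) -> hnorm (f x) = hnorm x.
Proof. by move=> fi; rewrite /hnorm fi. Qed.

Lemma bounded_op_gt0 f : bounded_op f ->
  exists2 M : R, 0 < M & forall x, hnorm (f x) <= M * hnorm x.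
Proof.
move=> [_ [M fM]]; exists (Num.max M 1); first by rewrite lt_max ltr01 orbT.
move=> x; rewrite (le_trans (fM x))// ler_wpM2r ?hnorm_ge0//.
by rewrite le_max lexx.
Qed.

(** [total_family] allows one coefficient function per list, so the coefficients of a repeated index
    are added up. Repetitions occur because germs of a fiber that differ only in the isotropy
    coordinate give multiples of the same basis vector. *)
Lemma total_family_pairs (I : choiceType) (e : I -> H) :
  (forall x (eps : R), 0 < eps -> exists l : seq (C * I),
    hnorm (x - \sum_(p <- l) p.1 *: e p.2) < eps) -> total_family e.
Proof.
move=> h x eps /(h x)[l]; set S := \sum_(p <- l) _ => xS.
exists (undup [seq p.2 | p <- l]), (fun i => \sum_(p <- l | p.2 == i) p.1).
suff -> : \sum_(i <- undup [seq p.2 | p <- l]) (\sum_(p <- l | p.2 == i) p.1) *: e i = S by [].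
under eq_bigr do rewrite scaler_suml.
rewrite (exchange_big_dep xpredT)//= /S big_seq [RHS]big_seq; apply: eq_bigr => p pl.
rewrite -big_filter (_ : [seq i <- _ | _] = [:: p.2]) ?big_seq1//.
have p2 : p.2 \in undup [seq p.2 | p <- l] by rewrite mem_undup map_f.
by rewrite (@eq_filter _ _ (pred1 p.2)) ?filter_pred1_uniq ?undup_uniq// => i; rewrite /= eq_sym.
Qed.

Lemma bounded_op_ext (I : choiceType) (e : I -> H) f g :
  total_family e -> bounded_op f -> bounded_op g ->
  (forall i, f (e i) = g (e i)) -> f =1 g.
Proof.
move=> et fb gb fg x; apply/eqP; rewrite -subr_eq0; apply/eqP.
apply: small_hnorm_eq0 => eps eps0.
have [M M0 fM] := bounded_op_gt0 fb; have [N N0 gN] := bounded_op_gt0 gb.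
have MN0 : 0 < M + N by rewrite addr_gt0.
have [|s [c sc]] := et x (eps / (M + N)); first by rewrite divr_gt0.
set p := \sum_(i <- s) _ in sc.
have fgp : f p = g p.
  rewrite /p (linear_op_sum (proj1 fb)) (linear_op_sum (proj1 gb)).
  by apply: eq_bigr => i _; rewrite fg.
have -> : f x - g x = f (x - p) - g (x - p).
  by rewrite (linear_opB (proj1 fb)) (linear_opB (proj1 gb)) fgp opprB addrA subrK.
rewrite (le_lt_trans (hnormB _ _))// (le_lt_trans (lerD (fM _) (gN _)))//.
by rewrite -mulrDl mulrC -ltr_pdivlMr.
Qed.

(** Polarization: the norms of [x + y] and [x + 'i *: y] determine the sum and the difference of
    [ip x y] and [ip y x]. *)
Lemma isometry_ip f : linear f -> (forall x, ip (f x) (f x) = ip x x) ->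
  forall x y, ip (f x) (f y) = ip x y.
Proof.
move=> fl fi x y.
have hD := fi (x + y); have hi := fi (x + 'i *: y).
rewrite !(linear_opD fl) !(ipDl, ipDr) !fi in hD.
rewrite !(linear_opD fl) !(linear_opZ fl) !(ipDl, ipDr, ipZl, ipZr) !fi conjCi in hi.
set a := ip (f x) (f y) in hD hi *; set b := ip (f y) (f x) in hD hi.
set c := ip x y in hD hi *; set d := ip y x in hD hi.
have {}hD : a + b = c + d.
  have : (a + b) - (c + d) = 0.
    rewrite [LHS](_ : _ = (ip x x + a + (b + ip y y)) - (ip x x + c + (d + ip y y))).
      by rewrite hD subrr.
    by ring.
  by move/eqP; rewrite subr_eq0 => /eqP.
have {}hi : a - b = c - d.
  have : (- 'i) * ((a - b) - (c - d)) = 0.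
    rewrite [LHS](_ : _ = (ip x x + - 'i * a + ('i * b + 'i * (- 'i * ip y y))) -
       (ip x x + - 'i * c + ('i * d + 'i * (- 'i * ip y y)))).
      by rewrite hi subrr.
    by ring.
  by move/eqP; rewrite mulf_eq0 oppr_eq0 (negbTE (neq0Ci _)) subr_eq0 => /eqP.
have : 2 * (a - c) = 0.
  rewrite [LHS](_ : _ = (a + b) - (c + d) + ((a - b) - (c - d))); last by ring.
  by rewrite hD hi !subrr addr0.
by move/eqP; rewrite mulf_eq0 pnatr_eq0/= subr_eq0 => /eqP.
Qed.

(** Surjectivity: if [f (u n)] tends to [y], then [u] is Cauchy because [f] preserves distances, and
    its limit is a preimage of [y]. *)
Lemma isometry_dense_unitary f : linear f -> (forall x, ip (f x) (f x) = ip x x) ->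
  (forall (y : K) (eps : R), 0 < eps -> exists x, hnorm (y - f x) < eps) -> unitary f.
Proof.
move=> fl fi fd; split=> // [|y]; first exact: isometry_ip.
have inv0 n : 0 < (n.+1%:R^-1 : R) by rewrite invr_gt0.
have small (e : R) : 0 < e -> exists N, forall n, (N <= n)%N -> n.+1%:R^-1 < e.
  move=> e0; have [N _ hN] := near_infty_natSinv_lt (PosNum e0).
  by exists N => n /hN.
pose u n := sval (cid (fd y _ (inv0 n))).
have hu n : hnorm (y - f (u n)) < n.+1%:R^-1 by rewrite /u; case: cid.
have [|l hl] := @ip_complete _ H u.
  move=> e /eps_real[e0 <-]; set r := re e in e0 *.
  have r0 : 0 < Num.sqrt r by rewrite sqrtr_gt0.
  have [|N hN] := small (Num.sqrt r / 2); first by rewrite divr_gt0.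
  exists N => m n Nm Nn.
  rewrite -[r]sqr_sqrtr ?(ltW e0)// -hnorm_lt// -(isometry_hnorm _ fi) linear_opB//.
  rewrite (_ : _ - _ = (y - f (u n)) - (y - f (u m))); last first.
    by rewrite opprB [RHS]addrC addrA subrK.
  rewrite (le_lt_trans (hnormB _ _))// [ltRHS]splitr ltrD//.
    exact: lt_trans (hu n) (hN _ Nn).
  exact: lt_trans (hu m) (hN _ Nm).
exists l; apply/eqP; rewrite eq_sym -subr_eq0; apply/eqP; apply: small_hnorm_eq0 => e e0.
have e20 : 0 < e / 2 by rewrite divr_gt0.
have [|N hN] := hl (ofR ((e / 2) ^+ 2)); first by rewrite ofR_gt0 exprn_gt0.
have [N' hN'] := small _ e20.
rewrite (_ : y - f l = (y - f (u (maxn N N'))) + f (u (maxn N N') - l)); last first.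
  by rewrite linear_opB// addrA subrK.
rewrite (le_lt_trans (hnormD _ _))// [ltRHS]splitr ltrD//.
  exact: lt_trans (hu _) (hN' _ (leq_maxr _ _)).
by rewrite isometry_hnorm// hnorm_lt// hN// leq_maxl.
Qed.

End LinearOperators.

(** * Orthonormal bases and coordinates *)

Section OrthonormalBases.
Variables (R : realType) (I : choiceType).
Local Notation C := (Cx R).
Local Notation dl := (@delta R I : I -> ell2 R I).

Lemma l2ip_delta (x : ell2 R I) i : ip x (dl i) = x i.
Proof.
apply: csumE => e e0; exists [:: i] => s us si.
rewrite (bigD1_seq i) ?si ?mem_head//= deltaE eqxx conjC1 mulr1 big1 ?addr0 ?subrr ?normr0//.
by move=> j ji; rewrite deltaE (negbTE ji) conjC0 mulr0.
Qed.

(** By [bessel_identity] the squared distance from [x] to its truncation to a finite set is a tail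
    of the sum of squares. *)
Lemma delta_basis : orthonormal_basis dl.
Proof.
have on i j : ip (dl i) (dl j) = (i == j)%:R.
  by rewrite l2ip_delta deltaE eq_sym.
split=> // x eps eps0.
have [|s hs] := @l2_is_sum_sqr _ _ x (ofR (eps ^+ 2)); first by rewrite ofR_gt0 exprn_gt0.
exists (undup s), x; rewrite hnorm_lt//.
have {hs} := hs (undup s) (undup_uniq s) (fun i => etrans (mem_undup s i)).
rewrite distrC ger0_norm; last first.
  rewrite subr_ge0; apply: le_trans (bessel on x (undup_uniq s)).
  by under [leRHS]eq_bigr do rewrite l2ip_delta.
move=> hs.
rewrite (eq_bigr (fun i => ip x (dl i) *: dl i)) => [|i _]; last by rewrite l2ip_delta.
rewrite (bessel_identity on) ?undup_uniq//.
by under eq_bigr do rewrite l2ip_delta.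
Qed.

(** Bessel's inequality makes the coefficient map [U] well defined and contractive. It is isometric
    on finite combinations of [e], hence everywhere since [e] is total, and its range is dense
    because it contains the finite combinations of the [delta]. *)
Lemma basis_coordinates (H : hilbert R) (e : I -> H) : orthonormal_basis e ->
  exists2 U : H -> ell2 R I, unitary U & forall i, U (e i) = dl i.
Proof.
move=> [e_on e_tot].
have sqs x : (fun i => ip x (e i)) \in @sqsummable R I.
  by apply/sqsummableP; exists (ip x x) => s us; exact: bessel.
pose U x : ell2 R I := L2 (sqs x).
have Ul : linear U by move=> a x y; apply: l2P => i; rewrite /= ip_linear.
have Ue i : U (e i) = dl i by apply: l2P => j; rewrite deltaE /= e_on eq_sym.
have Ub x : hnorm (U x) <= hnorm x.
  rewrite -(@ler_pXn2r _ 2)// ?nnegrE ?hnorm_ge0// -ofR_le !hnorm_sqr.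
  by apply: l2_le => s us; exact: bessel.
have Uspan (s : seq I) (c : I -> C) (p := \sum_(i <- s) c i *: e i) : ip (U p) (U p) = ip p p.
  rewrite linear_op_sum// !ip_suml; apply: eq_bigr => i _.
  rewrite !ip_sumr; apply: eq_bigr => j _.
  by rewrite !ipZl !ipZr !Ue e_on (proj1 delta_basis).
exists U => //; apply: isometry_dense_unitary => // [x|y eps eps0].
  suff : hnorm (U x) = hnorm x by rewrite -!hnorm_sqr => ->.
  apply/eqP; rewrite eq_le Ub/=; apply/ler_addgt0Pl => eps eps0.
  (* Replacing [x] by [p], and then [U p] by [U x], costs at most [hnorm (x - p)] each time. *)
  have [|s [c hs]] := e_tot x (eps / 2); first by rewrite divr_gt0.
  set p := \sum_(i <- s) _ in hs.
  have Up : hnorm (U p) = hnorm p by rewrite /hnorm Uspan.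
  have h1 := hnormD (x - p) p; rewrite subrK -Up in h1.
  have h2 := hnormD (U x) (U (p - x)); rewrite -linear_opD// addrC subrK in h2.
  have h3 := Ub (p - x); rewrite (hnorm_distC p) in h3.
  by have := hnorm_ge0 (U (p - x)); lra.
have [s [c hs]] := delta_basis.2 y eps eps0.
exists (\sum_(i <- s) c i *: e i); rewrite linear_op_sum//.
by under eq_bigr do rewrite Ue.
Qed.

End OrthonormalBases.

Section Unitaries.
Variables (R : realType).

Lemma unitary_inj (H K : hilbert R) (U : H -> K) : unitary U -> injective U.
Proof.
move=> [Ul Ui _] x y Uxy; apply/eqP; rewrite -subr_eq0; apply/eqP/ip_eq0.
by rewrite -Ui linear_opB// Uxy subrr ip0l.
Qed.

Lemma unitary_inv (H K : hilbert R) (U : H -> K) : unitary U ->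
  exists V : K -> H, [/\ unitary V, cancel U V & cancel V U].
Proof.
move=> Uu; have [Ul Ui Us] := Uu.
pose V y := sval (cid (Us y)); have UV : cancel V U by move=> y; rewrite /V; case: cid.
have VU : cancel U V by move=> x; apply: unitary_inj Uu _ _ _; rewrite UV.
exists V; split=> //; split=> [a x y|x y|x]; last by exists (U x); rewrite VU.
  by apply: unitary_inj Uu _ _ _; rewrite Ul !UV.
by rewrite -Ui !UV.
Qed.

Lemma unitary_comp (H K L : hilbert R) (U : H -> K) (V : K -> L) :
  unitary U -> unitary V -> unitary (V \o U).
Proof.
move=> [Ul Ui Us] [Vl Vi Vs]; split=> [a x y|x y|z]; rewrite /= ?Ul ?Vl ?Vi ?Ui//.
by have [y <-] := Vs z; have [x <-] := Us y; exists x.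
Qed.

Lemma unitary_bases (I : choiceType) (H K : hilbert R) (e : I -> H) (b : I -> K) :
  orthonormal_basis e -> orthonormal_basis b ->
  exists2 U : H -> K, unitary U & forall i, U (e i) = b i.
Proof.
move=> /basis_coordinates[U Uu Ue] /basis_coordinates[V Vu Vb].
have [W [Wu VW WV]] := unitary_inv Vu.
by exists (W \o U) => [|i /=]; [exact: unitary_comp|rewrite Ue -Vb VW].
Qed.

Lemma unitary_bounded (H K : hilbert R) (U : H -> K) : unitary U -> bounded_op U.
Proof.
by move=> [Ul Ui _]; split=> //; exists 1 => x; rewrite mul1r isometry_hnorm.
Qed.

Lemma bounded_op_comp (H K L : hilbert R) (f : H -> K) (g : K -> L) :
  bounded_op f -> bounded_op g -> bounded_op (g \o f).
Proof.
move=> fb gb; split=> [a x y|]; first by rewrite /= (proj1 fb) (proj1 gb).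
have [M M0 fM] := bounded_op_gt0 fb; have [N N0 gN] := bounded_op_gt0 gb.
exists (N * M) => x /=; rewrite (le_trans (gN _))// -mulrA ler_wpM2l//.
exact: ltW.
Qed.

End Unitaries.

(** * Representations of D0 *)

Section OperatorNorm.
Variables (R : realType) (H K : hilbert R).
Local Notation C := (Cx R).

(** [sup] bounds its set only if the set is bounded above, which [bounded_op f] guarantees; the
    estimate is then applied to the normalized vector. *)
Lemma opnorm_bound (f : H -> K) x : bounded_op f -> hnorm (f x) <= opnorm f * hnorm x.
Proof.
move=> fb; have fl := proj1 fb; have [M M0 fM] := bounded_op_gt0 fb.
have [x0|x0] := eqVneq (hnorm x) 0.
  by rewrite x0 mulr0 (hnorm_eq0 x0) linear_op0// hnorm0.
have x_gt0 : 0 < hnorm x by rewrite lt_neqAle eq_sym x0 hnorm_ge0.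
have nr (r : R) (y : H) : 0 <= r -> hnorm (ofR r *: y) = r * hnorm y.
  by move=> r0; rewrite hnormZ ofR_norm ofRK ger0_norm.
have nr' (r : R) (y : K) : 0 <= r -> hnorm (ofR r *: y) = r * hnorm y.
  by move=> r0; rewrite hnormZ ofR_norm ofRK ger0_norm.
rewrite -ler_pdivrMr// mulrC -nr' ?invr_ge0 ?hnorm_ge0// -linear_opZ//.
apply: ub_le_sup; last first.
  by exists (ofR (hnorm x)^-1 *: x) => //=; rewrite nr ?invr_ge0 ?hnorm_ge0// mulVf.
exists M => _ [y /= y1 <-]; rewrite (le_trans (fM y))//.
by rewrite ler_piMr// ltW.
Qed.

End OperatorNorm.

(** * Uniqueness of representations of D0 and transport of Ind *)

Section Equivalence.
Variable R : realType.
Local Notation C := (Cx R).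

(** The closure properties pass to intersections. Boundedness of the elements does not when the
    family of subalgebras containing [G] is empty, for then the intersection is the full set; hence
    the hypothesis. *)
Lemma closed_star_subalgebra_smallest (H : hilbert R) (G : set (H -> H)) :
  smallest (@closed_star_subalgebra R H) G `<=` @bounded_op R H H ->
  closed_star_subalgebra (smallest (@closed_star_subalgebra R H) G).
Proof.
set D := smallest _ _ => Db; split=> //.
- split=> [M [[_ [? _] _ _ _] _] //|c f h Df Dh M MG].
  by have [[_ [_ Ml] _ _ _] _] := MG; apply: Ml; [exact: Df|exact: Dh].
- move=> f h Df Dh M MG.
  by have [[_ _ Mm _ _] _] := MG; apply: Mm; [exact: Df|exact: Dh].
- move=> f h Df hb fh M MG.
  by have [[_ _ _ Ma _] _] := MG; apply: Ma hb fh; exact: Df.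
move=> f fb fD M MG; have [[_ _ _ _ Mc] _] := MG; apply: Mc => // e /fD[h Dh fh].
by exists h => //; exact: Dh.
Qed.

Section D0Representation.
Variables (K : hilbert R) (p q : op3 R -> K -> K).
Hypothesis D0b : @D0 R `<=` @bounded_op R _ _.
Hypotheses (p_rep : D0_representation p) (q_rep : D0_representation q).

Lemma D0_rep0 (r : op3 R -> K -> K) : D0_representation r -> r (fun=> 0) = fun=> 0.
Proof.
move=> [_ rl _ _]; apply/funext => x.
have [_ [D00 _] _ _ _] := closed_star_subalgebra_smallest D0b.
have := rl (-1) _ _ D00 D00 x.
rewrite (_ : (fun f => _ *: _ + _) = fun=> 0); last by apply/funext => f; rewrite scaler0 addr0.
by rewrite scaleN1r addNr.
Qed.

(** The elements of [D0] on which [p] and [q] agree form a closed star-subalgebra containing the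
    generators: adjoints are unique, and both representations are contractive. *)
Lemma D0_rep_ext : (forall j, p (s0 j) = q (s0 j)) -> forall d, D0 d -> p d = q d.
Proof.
move=> pq d Dd.
have [_ [D00 Dl] Dm Da Dc] := closed_star_subalgebra_smallest D0b.
suff h : @D0 R `<=` [set d | D0 d /\ p d = q d] by exact: (h d Dd).2.
apply: smallest_sub; last first.
  by move=> _ [j _ <-]; split=> //; apply: sub_gen_smallest; exists j.
have [pb pl pm pa] := p_rep; have [qb ql qm qa] := q_rep.
split=> [f [Df _]|||f h [Df fpq] hb fh|f fb fc]; first exact: D0b.
- split=> [|c f h [Df fpq] [Dh hpq]]; first by split; rewrite ?(D0_rep0 p_rep) ?(D0_rep0 q_rep).
  by split; [exact: Dl|apply/funext => x; rewrite pl// ql// fpq hpq].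
- by move=> f h [Df fpq] [Dh hpq]; split; [exact: Dm|rewrite pm// qm// fpq hpq].
- have Dh := Da _ _ Df hb fh; split=> //.
  by apply: (adjoint_uniq (f := p f)); [exact: pa|rewrite fpq; exact: qa].
have Df : D0 f by apply: Dc => // e /fc[h [Dh _] fh]; exists h.
split=> //; apply/funext => x; apply/eqP; rewrite -subr_eq0; apply/eqP.
apply: small_hnorm_eq0 => e e0.
(* Each of [p] and [q] contributes an error of at most [e / 3], so that the total is strictly below
   [e]; adding 1 keeps the denominator positive for [x = 0]. *)
pose e' := e / 3 / (hnorm x + 1).
have x1 : 0 < hnorm x + 1 by rewrite ltr_wpDl// hnorm_ge0.
have e'0 : 0 < e' by rewrite !divr_gt0.
have [h [Dh hpq] fh] := fc e' e'0.
have close r : D0_representation r -> hnorm (r f x - r h x) <= e / 3.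
  move=> [rb rl _ _]; have Dfh := Dl (-1) _ _ Dh Df.
  rewrite (_ : r f x - r h x = r (fun v => -1 *: h v + f v) x); last first.
    by rewrite rl// scaleN1r addrC.
  have [rfb rfn] := rb _ Dfh.
  rewrite (le_trans (opnorm_bound _ rfb))//.
  apply: (@le_trans _ _ (e' * hnorm x)).
    rewrite ler_wpM2r ?hnorm_ge0// (le_trans rfn)// ltW//.
    by rewrite (_ : (fun v => _) = fun v => f v - h v)//; apply/funext => v; rewrite scaleN1r addrC.
  by rewrite /e' mulrAC ler_pdivrMr// ler_wpM2l ?lerDl// divr_ge0// ltW.
rewrite (_ : p f x - q f x = (p f x - p h x) - (q f x - q h x)); last first.
  by rewrite hpq opprB addrA subrK.
rewrite (le_lt_trans (hnormB _ _))//.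
by move: (close p p_rep) (close q q_rep) e0; lra.
Qed.

End D0Representation.

Lemma opnorm_conj (H K : hilbert R) (U : H -> K) (V : K -> H) (f : H -> H) :
  unitary U -> unitary V -> cancel V U -> opnorm (U \o f \o V) = opnorm f.
Proof.
move=> Uu Vu VU; have [[_ Ui _] [_ Vi _]] := (Uu, Vu).
rewrite /opnorm; congr (sup _); apply/seteqP; split=> _ [x /= x1 <-].
  exists (V x) => /=; rewrite ?(isometry_hnorm x (fun x => Vi x x))//.
  by rewrite (isometry_hnorm _ (fun x => Ui x x)).
exists (U x) => /=; rewrite (isometry_hnorm _ (fun x => Ui x x))//.
rewrite (_ : V (U x) = x) ?(isometry_hnorm _ (fun x => Ui x x))//.
by apply: unitary_inj Uu _ _ _; rewrite VU.
Qed.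

(** Since [Phi] is injective with range [D0], conjugating [Ind] by [U] gives a representation [q] of
    [D0] with values [v]. Any other such [p] agrees with [q] on [D0], so [U] intertwines [Ind] with
    [p \o Phi]. *)
Lemma Ind_equivalentP (H : hilbert R) (u : chars R) (kappa : (gpd R -> C) -> H)
    (K : hilbert R) (v : gen -> K -> K) (U : H -> K) : unitary U ->
  (forall (A : cstar_algebra R) (iota : (gpd R -> C) -> A) (Ind : A -> H -> H),
    induced_representation u kappa iota Ind ->
    forall j x, U (Ind (iota \1_(Theta (genT R j))) x) = v j (U x)) ->
  Ind_equivalent u kappa v.
Proof.
move=> Uu UInd A iota Phi Ind _ [Phi_rep Phi_n Phi_D Phi_g] Ind_ind.
have [Ind_rep _] := Ind_ind.
have [V [Vu UV VU]] := unitary_inv Uu.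
have [Phi_b Phi_l Phi_m Phi_a] := Phi_rep.
have [Ind_b Ind_l Ind_m Ind_a] := Ind_rep.
have D0P d : D0 d <-> exists a, Phi a = d.
  by rewrite -Phi_D; split=> [[a _ <-]|[a <-]]; exists a.
(* As [D0] is defined by an intersection, the boundedness of its elements is obtained from its being
   the range of the representation [Phi]. *)
have D0b : @D0 R `<=` @bounded_op R _ _ by move=> _ /D0P[a <-]; exact: (Phi_b a).1.
have Phi_inj : injective Phi.
  move=> a b ab; apply/eqP; rewrite -subr_eq0; apply/eqP/csnorm_eq0.
  rewrite -Phi_n (_ : Phi _ = fun=> 0); last first.
    apply/funext => x; rewrite (_ : a - b = -1 *: b + a) ?Phi_l ?ab; last by rewrite scaleN1r addrC.
    by rewrite scaleN1r addNr.
  rewrite /opnorm (_ : [set _ | _ in _] = [set 0]) ?sup1//.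
  apply/seteqP; split=> [_ [x _ <-]|_ ->]; first by rewrite /= hnorm0.
  by exists 0; rewrite /= hnorm0.
(* Outside [D0] this is 0, a value that [D0_representation] never tests. *)
pose inv d := xget 0 [set a | Phi a = d].
have PhiK a : inv (Phi a) = a.
  by rewrite /inv; case: xgetP => [b _ /Phi_inj|/(_ a)/(_ erefl)].
pose q d := U \o Ind (inv d) \o V.
have q_rep : D0_representation q.
  split.
  - move=> _ /D0P[a <-]; rewrite /q PhiK; split; last first.
      by rewrite opnorm_conj// Phi_n; exact: (Ind_b a).2.
    apply: bounded_op_comp; first exact: unitary_bounded.
    by apply: bounded_op_comp; [exact: (Ind_b a).1|exact: unitary_bounded].
  - move=> c _ _ /D0P[a <-] /D0P[b <-] x; rewrite /q !PhiK.
    rewrite (_ : (fun f => _) = Phi (c *: a + b)); last by apply/funext => f; rewrite Phi_l.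
    by rewrite PhiK /= Ind_l (proj1 (unitary_bounded Uu)).
  - move=> _ _ /D0P[a <-] /D0P[b <-]; rewrite /q -Phi_m !PhiK Ind_m.
    by apply/funext => x /=; rewrite UV.
  move=> _ _ /D0P[a <-] /D0P[b <-] ab.
  have bE := adjoint_uniq ab (Phi_a a); rewrite bE /q !PhiK.
  have [[_ Ui _] [_ Vi _]] := (Uu, Vu).
  by move=> x y /=; rewrite -{1}[y]VU Ui Ind_a -Ui VU.
have qE j : q (s0 j) = v j.
  by apply/funext => x; rewrite /q -Phi_g PhiK /= (UInd _ _ _ Ind_ind) VU.
split; first by exists q; split.
move=> p [p_rep pE]; exists U => // a x /=.
rewrite (D0_rep_ext D0b p_rep q_rep) => [|j|]; last by apply/D0P; exists a.
  by rewrite /q PhiK /= UV.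
by rewrite pE qE.
Qed.

End Equivalence.

(** * The inverse semigroup as partial maps *)

Section Semigroup.
Variable R : realType.
Local Notation semigT := (semigT R).
Local Notation projT := (projT R).
Local Notation chars := (chars R).
Implicit Types (s : semigT) (e f : projT) (x y z : X3).

(** The choice is harmless: [pull] is injective on partial injections, so any partial injection
    inducing [opT s] equals [hT s]. *)
Definition hT s : X3 -> option X3 := sval (cid (T_pull s)).

Lemma pinj_hT s : pinj (hT s).
Proof. by rewrite /hT; case: cid => h /= [g []]. Qed.

Lemma hTE s : opT s = pull (hT s).
Proof. by rewrite /hT; case: cid => h /= [g []]. Qed.

Lemma hT_eq s (h : X3 -> option X3) : pinj h -> opT s = pull h -> hT s =1 h.
Proof. by move=> hi; rewrite hTE; apply: pull_inj => //; exact: pinj_hT. Qed.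

Lemma semigT_eq s s' : hT s =1 hT s' -> s = s'.
Proof. by move=> ss'; apply/val_inj; rewrite /= !hTE; exact: eq_pull. Qed.

Lemma hT_star s x y : hT (starT s) y = Some x <-> hT s x = Some y.
Proof.
have [h [g [hg hi gi sh sg]]] := T_pull s.
by rewrite (hT_eq hi sh) (hT_eq gi sg) hg.
Qed.

(** [pull] is contravariant, so the left factor of a product acts first on points, in accordance
    with the right action on characters. *)
Lemma hT_mul s s' x : hT (mulT s s') x = obind (hT s') (hT s x).
Proof.
move: x; apply: hT_eq; first by apply: pinj_comp; exact: pinj_hT.
by rewrite /= !hTE pull_comp//; exact: pinj_hT.
Qed.

Lemma starTK s : starT (starT s) = s.
Proof.
apply: semigT_eq => x; case E: (hT s x) => [y|]; first by apply/hT_star/hT_star.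
by case E': (hT _ x) => [y|//]; move/hT_star/hT_star: E'; rewrite E.
Qed.

Lemma hT_inT s : hT s =1 (fun=> None) \/ exists b1 b2 r n m,
  wf b1 b2 r n m /\ hT s =1 bmap b1 b2 r n m.
Proof.
have /inTP[s0|[b1 [b2 [r [n [m [w sE]]]]]]] := T_inT s; [left|right].
  by apply: hT_eq; rewrite ?pull_none.
by exists b1, b2, r, n, m; split=> //; apply: hT_eq => //; exact: pinj_bmap.
Qed.

Lemma hT_toT b1 b2 r n m : wf b1 b2 r n m ->
  hT (toT (pull (bmap b1 b2 r n m))) =1 bmap b1 b2 r n m.
Proof.
move=> w; apply: hT_eq; first exact: pinj_bmap.
by rewrite /toT /insubd insubT//; apply/asboolP/inTP; right; exists b1, b2, r, n, m.
Qed.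

Definition dom e : pred X3 := fun x => hT e x : bool.

Lemma hT_proj e x : hT e x = if dom e x then Some x else None.
Proof.
have [A eA] := E_pull e; rewrite /dom (hT_eq (@pinj_pid A) eA) /pid.
by case: (A x).
Qed.

Lemma proj_eq e f : dom e =1 dom f -> e = f.
Proof. by move=> ef; apply/val_inj/semigT_eq => x; rewrite !hT_proj ef. Qed.

Lemma dom_mul e f x : dom (mulE e f) x = dom e x && dom f x.
Proof. by rewrite /dom hT_mul hT_proj /dom; case: (hT e x). Qed.

Lemma dom_conj s e x : dom (conjE s e) x = oapp (dom e) false (hT s x).
Proof.
rewrite /dom !hT_mul; case E: (hT s x) => [y|]//=.
rewrite hT_proj; case: (dom e y) => //=.
by have /hT_star-> := E.
Qed.

Lemma dom_range s x : dom (rangeE s) x = hT s x.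
Proof. by rewrite /dom hT_mul; case E: (hT s x) => [y|]//=; have /hT_star-> := E. Qed.

Lemma dom_zero x : dom (zeroE R) x = false.
Proof. by rewrite /dom (@hT_eq _ (fun=> None))// pull_none. Qed.

Lemma dom_one x : dom (rangeE (oneT R)) x.
Proof.
rewrite dom_range (@hT_eq _ (bmap false false 0 (0, 0)%N (0, 0)%N)).
- by [].
- exact: pinj_bmap.
by rewrite -tens3E -SSE.
Qed.

Lemma mulE_id e f : mulE f e = e <-> forall x, dom e x -> dom f x.
Proof.
split=> [fe x|ef]; first by rewrite -{1}fe dom_mul => /andP[].
by apply: proj_eq => x; rewrite dom_mul andbC; case: (boolP (dom e x)) => // /ef->.
Qed.

(** The domain of a factor S^{*n} p S^m ([b] true) or S^{*n} S^m ([b] false), extended to infinity,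
    which is [None]. *)
Definition in1 (b : bool) (n : nat) (k : option nat) : bool :=
  match k with Some a => if b then a == n else (n <= a)%N | None => ~~ b end.

(* The subsets of N and infinity which are empty, a point of N, or a half line
   containing infinity; infinity belongs to one iff all large numbers do. *)
Definition side (P : option nat -> bool) :=
  (forall k, P k = false) \/ exists b n, P =1 in1 b n.

(** The translation by m - n with infinity fixed. It is meant for arguments in [in1 b n]; below [n]
    the truncated subtraction makes it constant. *)
Definition mv (n m : nat) : option nat -> option nat := omap (fun a => a - n + m)%N.

Lemma side_in1 b n : side (in1 b n). Proof. by right; exists b, n. Qed.

(** A point either belongs to the preimage or not; on a half line, the preimage of a point is a
    point or empty, and the preimage of a half line is a half line, starting at [n] if [n' <= m]. *)
Lemma side_mv b n m P : side P -> side (fun k => in1 b n k && P (mv n m k)).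
Proof.
move=> [P0|[b' [n' PE]]]; first by left => k; rewrite P0 andbF.
case: b; last case: b' PE => PE.
- case: (boolP (P (Some m))) => Pm.
    right; exists true, n => -[a|] //=; case: eqP => // ->.
    by rewrite subnn add0n Pm.
  left=> -[a|] //=; case: eqP => // ->.
  by rewrite subnn add0n (negbTE Pm).
- have [mn'|mn'] := leqP m n'.
    right; exists true, (n' - m + n)%N => -[a|] /=; rewrite PE//=.
    by apply/idP/idP; lia.
  by left=> -[a|] /=; rewrite PE//=; apply/negbTE; lia.
right; exists false, (n + (n' - m))%N => -[a|] /=; rewrite PE//=.
by apply/idP/idP; lia.
Qed.

Lemma sideI P Q : side P -> side Q -> side (fun k => P k && Q k).
Proof.
move=> [P0|[b [n PE]]] sQ; first by left => k; rewrite P0.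
(* Intersection is the case [m = n] of [side_mv], since [mv n n] is the identity on [in1 b n]. *)
have [Q'|[b' [n' Q']]] := @side_mv b n n _ sQ.
  left=> -[a|]; rewrite PE; last by have := Q' None.
  case E: (in1 b n (Some a)) (Q' (Some a)) => //=.
  by case: b E {PE Q'} => /= [/eqP->|?]; rewrite ?subnn ?subnK.
right; exists b', n' => -[a|]; rewrite PE -Q' //.
case E: (in1 b n (Some a)) => //=.
by case: b E {PE Q'} => /= [/eqP->|?]; rewrite ?subnn ?subnK.
Qed.

Lemma bmapE b1 b2 r n m x : bmap b1 b2 r n m x =
  if in1 b1 n.1 (Some x.1.1) && in1 b2 n.2 (Some x.1.2)
  then Some ((x.1.1 - n.1 + m.1)%N, (x.1.2 - n.2 + m.2)%N, x.2 - r) else None.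
Proof.
by rewrite /bmap /pprod /cmap /in1; case: ifP => //= _; case: ifP.
Qed.

Lemma B1E r n m : B1 r n m = pull (bmap false false r (n.1, n.1) (m.1, m.1)) :> op3 R.
Proof. by rewrite -tens3E /B1 !SSE. Qed.

Lemma B2E r n m : B2 r n m = pull (bmap false true r n m) :> op3 R.
Proof. by rewrite -tens3E /B2 SSE SpSE. Qed.

Lemma B3E r n m : B3 r n m = pull (bmap true false r n m) :> op3 R.
Proof. by rewrite -tens3E /B3 SSE SpSE. Qed.

Lemma B4E r n m : B4 r n m = pull (bmap true true r n m) :> op3 R.
Proof. by rewrite -tens3E /B4 !SpSE. Qed.

Lemma dom_side e : exists P Q, [/\ side P, side Q &
  forall x, dom e x = P (Some x.1.1) && Q (Some x.1.2)].
Proof.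
have [e0|[b1 [b2 [r [n [m [_ eE]]]]]]] := hT_inT e.
  by exists xpred0, xpred0; split=> [| |x]; [left|left|rewrite /dom e0].
exists (in1 b1 n.1), (in1 b2 n.2); split=> [| |x]; try exact: side_in1.
by rewrite /dom eE bmapE; case: ifP.
Qed.

Definition boxE b1 b2 n : projT := rangeE (toT (pull (bmap b1 b2 0 n n))).

Lemma dom_box b1 b2 n : wf b1 b2 0 n n ->
  forall x, dom (boxE b1 b2 n) x = in1 b1 n.1 (Some x.1.1) && in1 b2 n.2 (Some x.1.2).
Proof. by move=> w x; rewrite dom_range hT_toT// bmapE; case: ifP. Qed.

Lemma opT_boxP e b1 b2 n : opT e = pull (bmap b1 b2 0 n n) <->
  forall x, dom e x = in1 b1 n.1 (Some x.1.1) && in1 b2 n.2 (Some x.1.2).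
Proof.
split=> [eE x|eE].
  by rewrite /dom (hT_eq _ eE) ?bmapE; [case: ifP|exact: pinj_bmap].
rewrite hTE; apply: eq_pull => -[[a b] c]; rewrite hT_proj eE bmapE /=.
case: ifP => // /andP[]; rewrite subr0 => h1 h2; congr (Some (_, _, _)).
  by case: b1 h1 {eE} => [/eqP->|?]; lia.
by case: b2 h2 {eE} => [/eqP->|?]; lia.
Qed.

(* These projections form a neighbourhood base of (k1, k2): a finite coordinate is
   fixed, a coordinate at infinity is only required to be at least N. *)
Definition nearE (k1 k2 : option nat) (N : nat) : projT :=
  boxE (isSome k1) (isSome k2) (odflt N k1, odflt N k2).

Lemma dom_near k1 k2 N : (odflt 0 k1 <= N)%N -> (odflt 0 k2 <= N)%N ->
  forall x, dom (nearE k1 k2 N) x =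
    in1 k1 (odflt N k1) (Some x.1.1) && in1 k2 (odflt N k2) (Some x.1.2).
Proof.
by move=> h1 h2; apply: dom_box; case: k1 k2 h1 h2 => [a|] [b|] //= h1 h2;
  rewrite subrr eqxx/= ?h1 ?h2 ?eqxx.
Qed.

(** One description for the four cases of [Lam]: [N] is the free index at the infinite coordinates.
    If both coordinates are finite, all admissible [N] give the same projection. *)
Lemma LamP k1 k2 e : Lam k1 k2 e <->
  exists N, [/\ (odflt 0 k1 <= N)%N, (odflt 0 k2 <= N)%N & e = nearE k1 k2 N].
Proof.
have nearP N : (odflt 0 k1 <= N)%N -> (odflt 0 k2 <= N)%N ->
    let n := (odflt N k1, odflt N k2) in
    e = nearE k1 k2 N <-> opT e = pull (bmap k1 k2 0 n n).
  move=> h1 h2 n; rewrite opT_boxP; split=> [->|eE]; first exact: dom_near.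
  by apply: proj_eq => x; rewrite eE dom_near.
split.
- case: k1 k2 nearP => [a|] [b|] nearP /=.
  + rewrite B4E => eE; exists (maxn a b); rewrite leq_maxl leq_maxr; split=> //.
    by apply/nearP; rewrite //= ?leq_maxl ?leq_maxr.
  + by move=> [N aN]; rewrite B3E => eE; exists N; split=> //; apply/nearP.
  + by move=> [N aN]; rewrite B2E => eE; exists N; split=> //; apply/nearP.
  + by move=> [N]; rewrite B1E => eE; exists N; split=> //; apply/nearP.
- move=> [N [h1 h2 /(nearP _ h1 h2)]].
  case: k1 k2 h1 h2 {nearP} => [a|] [b|] /= h1 h2 eE.
  + by rewrite B4E.
  + by exists N => //; rewrite B3E.
  + by exists N => //; rewrite B2E.
  + by exists N; rewrite B1E.
Qed.

(** So [phi k1 k2] is evaluation at the point (k1, k2) of the domain extended to infinity. A side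
    contains infinity exactly when it contains all large numbers, that is, when it contains the
    corresponding side of [nearE k1 k2 N] for some [N]. *)
Lemma phiE k1 k2 e P Q : side P -> side Q ->
  (forall x, dom e x = P (Some x.1.1) && Q (Some x.1.2)) -> phi k1 k2 e = P k1 && Q k2.
Proof.
move=> sP sQ eE; apply/idP/idP.
- move=> /asboolP[f /LamP[N [h1 h2 ->]] /mulE_id hf].
  have far (k : option nat) (S : option nat -> bool) : side S ->
      (forall a, in1 k (odflt N k) (Some a) -> S (Some a)) -> S k.
    move=> + h; case: k h => [a|] /= h; first by move=> _; exact: h.
    move=> [S0|[b [n SE]]]; first by have := h N (leqnn N); rewrite S0.
    (* A number above [N] and different from [n], which rules out that the side is the single point
       [n]. *)
    have := h (N + n).+1; rewrite !SE /=; case: b {SE} => //= /(_ _).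
    by move=> /(_ ltac:(lia)) /eqP; lia.
  have in1N (k : option nat) : exists a, in1 k (odflt N k) (Some a).
    by case: k => [a|]; [exists a|exists N] => /=.
  have [a1 ha1] := in1N k1; have [a2 ha2] := in1N k2.
  apply/andP; split; apply: far => // a ha.
    have := hf (a, a2, 0); rewrite dom_near// eE => h.
    by have /andP[] := h (introT andP (conj ha ha2)).
  have := hf (a1, a, 0); rewrite dom_near// eE => h.
  by have /andP[] := h (introT andP (conj ha1 ha)).
- move=> /andP[Pk Qk]; apply/asboolP.
  have far (k : option nat) (S : option nat -> bool) : side S -> S k ->
      exists N, forall M, (N <= M)%N ->
      forall a, in1 k (odflt M k) (Some a) -> S (Some a).
    move=> [S0|[b [n SE]]]; first by rewrite S0.
    case: k => [c|] Sk; first by exists 0%N => M _ a /= /eqP->.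
    exists n => M nM a /= Ma; rewrite SE.
    by move: Sk; rewrite SE/=; case: b {SE} => //= _; exact: leq_trans Ma.
  have [N1 h1] := far _ _ sP Pk; have [N2 h2] := far _ _ sQ Qk.
  pose N := (N1 + N2 + odflt 0 k1 + odflt 0 k2)%N.
  have n1 : (odflt 0 k1 <= N)%N by rewrite /N; lia.
  have n2 : (odflt 0 k2 <= N)%N by rewrite /N; lia.
  exists (nearE k1 k2 N); first by apply/LamP; exists N.
  apply/mulE_id => x; rewrite dom_near// eE => /andP[x1 x2].
  by rewrite (h1 N _ _ x1) ?(h2 N _ _ x2)// /N; lia.
Qed.

End Semigroup.

(** * Characters *)

Section Topology.
Variable R : realType.
Local Notation semigT := (semigT R).
Local Notation projT := (projT R).
Local Notation chars := (chars R).
Local Notation gpd := (gpd R).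

Lemma open_coord (e : projT) (b : bool) : open [set x : chars | x e = b].
Proof.
apply: (@open_comp chars bool (proj e) [set b]); last exact: discrete_open.
by move=> x _; exact: proj_continuous.
Qed.

Lemma chars_cvg (F : set_system chars) (x : chars) : Filter F ->
  (forall e, F [set y : chars | y e = x e]) -> F --> x.
Proof.
move=> FF Fx; apply/cvg_sup => e U.
have /= -> := @nbhsE (initial_topology (@proj _ (fun=> bool) e)) x.
case=> B [[C oC <- ?]] /filterS; apply.
by apply: filterS (Fx e) => y /= yx; rewrite /preimage /= /proj yx.
Qed.

Lemma act_continuous (s : semigT) : continuous (fun x : chars => act x s).
Proof.
move=> x; apply: chars_cvg => e.
have : nbhs x [set y : chars | y (conjE s e) = x (conjE s e)].
  by apply: open_nbhs_nbhs; split=> //; exact: open_coord.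
by [].
Qed.

Lemma open_germ_box (U : set chars) (s : semigT) : open U -> open (germ_box (U, s)).
Proof.
move=> oU; exists [set germ_box (U, s)]; last by rewrite bigcup_set1.
by move=> _ ->; exact: (@finI_from1 _ _ _ (germ_box (R:=R)) (U, s)).
Qed.

(** It suffices to test the subbase, since a filter is closed under the finite intersections that
    form a base. *)
Lemma gpd_cvg (F : set_system gpd) (p : gpd) : Filter F ->
  (forall (U : set chars) s, open U -> germ_box (U, s) p -> F (germ_box (U, s))) -> F --> p.
Proof.
move=> FF Fb A; rewrite nbhsE => -[B [oB Bp] BA].
case: oB Bp BA => D sDB <- [C DC Cp] UDA.
rewrite nbhs_filterE; apply: filterS UDA _; apply: (@filterS _ _ _ C).
  by move=> ? ?; exists C.
have /sDB [E sE IEC] := DC; rewrite -IEC; apply: filter_bigI => -[U s] EUs.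
apply: Fb; last by move: Cp; rewrite -IEC => /(_ _ EUs).
by have /sE := EUs; rewrite inE.
Qed.

End Topology.

Section Characters.
Variable R : realType.
Local Notation semigT := (semigT R).
Local Notation projT := (projT R).
Local Notation chars := (chars R).
Implicit Types (x : chars) (e f : projT) (s : semigT).

Lemma char_mono x e f : Ehat0 x -> x e -> (forall z, dom e z -> dom f z) -> x f.
Proof.
by move=> [_ xM _] xe /mulE_id fe; move: (xM f e); rewrite fe xe andbT => <-.
Qed.

Lemma char_dom x e : Ehat0 x -> x e -> exists z, dom e z.
Proof.
move=> [_ _ x0] xe; apply: contrapT => e0.
suff : x (zeroE R) by rewrite x0.
rewrite (_ : zeroE R = e)//; apply: proj_eq => z; rewrite dom_zero.
by apply/esym/negP => ez; apply: e0; exists z.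
Qed.

Lemma conjE_mul s s' e : conjE (mulT s s') e = conjE s (conjE s' e).
Proof.
apply: proj_eq => z; rewrite !dom_conj hT_mul; case: (hT s z) => //= y.
by rewrite dom_conj.
Qed.

Lemma act_mul x s s' : act x (mulT s s') = act (act x s) s'.
Proof. by apply/funext => e; rewrite /act conjE_mul. Qed.

Lemma act_range x s s' : act x s (rangeE s') = x (rangeE (mulT s s')).
Proof.
rewrite /act; congr x; apply: proj_eq => z.
by rewrite dom_conj dom_range hT_mul; case: (hT s z) => //= y; rewrite dom_range.
Qed.

Lemma rangeE_mul_star s : rangeE (mulT s (starT s)) = rangeE s.
Proof.
apply: proj_eq => z; rewrite !dom_range hT_mul.
by case E: (hT s z) => [y|]//=; have /hT_star-> := E.
Qed.

Lemma act_star_range x s : x (rangeE s) -> act x s (rangeE (starT s)).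
Proof. by rewrite act_range rangeE_mul_star. Qed.

Lemma act_star x s : Ehat0 x -> x (rangeE s) -> act (act x s) (starT s) = x.
Proof.
move=> xc xs; rewrite -act_mul; apply/funext => e.
have [_ xM _] := xc; rewrite -[RHS]andTb -xs -xM /act; congr x.
apply: proj_eq => z; rewrite dom_conj dom_mul dom_range hT_mul.
by case E: (hT s z) => [y|]//=; have /hT_star-> := E.
Qed.

Lemma act_char x s : Ehat0 x -> x (rangeE s) -> Ehat0 (act x s).
Proof.
move=> xc xs; have [_ xM x0] := xc; split.
- by exists (rangeE (starT s)); exact: act_star_range.
- move=> e f; rewrite /act -xM; congr x; apply: proj_eq => z.
  by rewrite dom_mul !dom_conj; case: (hT s z) => //= y; rewrite dom_mul.
- rewrite /act -x0; congr x; apply: proj_eq => z.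
  by rewrite dom_conj dom_zero; case: (hT s z) => //= y; rewrite dom_zero.
Qed.

Lemma char_filter x : Ehat0 x -> is_filter [set e | x e].
Proof.
move=> xc; have [xn xM x0] := xc; split=> //=; first by rewrite x0.
  by move=> e f xe xf; rewrite xM xe.
by move=> e f xe /mulE_id ef; exact: char_mono xe ef.
Qed.

(** A filter containing that of [act x s] is carried back by conjugation with s^* to a filter
    containing that of [x], where maximality applies. *)
Lemma act_ultrafilter x s : Ehat_infty x -> x (rangeE s) -> Ehat_infty (act x s).
Proof.
move=> [xc [_ xmax]] xs; have ac := act_char xc xs; split=> //.
split; first exact: char_filter.
move=> B [[b0 Bb0] B0 BM Bup] xB.
have [_ xM _] := xc.
have Bup' e f : B e -> (forall z, dom e z -> dom f z) -> B f.
  by move=> Be /mulE_id ef; exact: Bup ef.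
have Bs : B (rangeE (starT s)) by apply: xB; exact: act_star_range.
have sE : [set e | B (conjE (starT s) e)] = [set e | x e].
  apply: xmax => [|e /= xe].
    split=> /=.
    - exists (rangeE s); apply: Bup' Bs _ => z; rewrite dom_conj dom_range.
      by case E: (hT _ z) => [y|]//= _; rewrite dom_range; have /hT_star-> := E.
    - move=> Bz; apply: B0; apply: Bup' Bz _ => z; rewrite dom_conj.
      by case: (hT _ z) => //= y; rewrite dom_zero.
    - move=> e f Be Bf; apply: Bup' (BM _ _ Be Bf) _ => z.
      rewrite dom_mul !dom_conj; case: (hT _ z) => //= y; by rewrite dom_mul.
    - move=> e f Be /mulE_id ef; apply: Bup' Be _ => z.
      by rewrite !dom_conj; case: (hT _ z) => //= y; exact: ef.
  apply: xB => /=; rewrite /act -conjE_mul.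
  have : x (mulE (rangeE s) e) by rewrite xM xs.
  move=> /(char_mono xc); apply=> z; rewrite dom_mul dom_range dom_conj hT_mul.
  by case E: (hT s z) => [y|]//=; have /hT_star-> := E.
apply/seteqP; split=> // b Bb.
suff : [set e | x e] (conjE s b) by [].
(* Conjugating [b] by s and then by s^* cuts it down to the projection s^* s, which belongs to
   [B]. *)
rewrite -sE /=; apply: Bup' (BM _ _ Bb Bs) _ => z.
rewrite dom_mul dom_range !dom_conj.
case E: (hT (starT s) z) => [y|]/=; last by rewrite andbF.
by rewrite andbT dom_conj; have /hT_star-> := E.
Qed.

(** The action is continuous, but it preserves ultrafilters only on the domain of [s]; as this
    domain is open, approximating ultrafilters can be taken inside it. *)
Lemma act_tight x s : Ehat_tight x -> x (rangeE s) -> Ehat_tight (act x s).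
Proof.
move=> [xc xcl] xs; split; first exact: act_char.
move=> V aV; have nV : nbhs x [set y | V (act y s)] by exact: act_continuous.
have nD : nbhs x [set y : chars | y (rangeE s) = true].
  by apply: open_nbhs_nbhs; split=> //; exact: open_coord.
have [y [yi [Vy ys]]] := xcl _ (filterI nV nD).
by exists (act y s); split=> //; exact: act_ultrafilter.
Qed.

Lemma phi_char k1 k2 : Ehat0 (phi k1 k2 : chars).
Proof.
split.
- exists (rangeE (oneT R)).
  rewrite (@phiE _ _ _ _ (in1 false 0) (in1 false 0)) => [| | |z]; try exact: side_in1.
    by case: k1 k2 => [a|] [b|].
  by rewrite dom_one.
- move=> e f; have [P [Q [sP sQ eE]]] := dom_side e.
  have [P' [Q' [sP' sQ' fE]]] := dom_side f.
  rewrite (phiE k1 k2 sP sQ eE) (phiE k1 k2 sP' sQ' fE).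
  rewrite (phiE k1 k2 (sideI sP sP') (sideI sQ sQ')) 1?andbACA// => z.
  by rewrite dom_mul eE fE andbACA.
- rewrite (@phiE _ _ _ _ xpred0 xpred0) => [//| | |z]; try by left.
  by rewrite dom_zero.
Qed.

Lemma phi_near k1 k2 N : (odflt 0 k1 <= N)%N -> (odflt 0 k2 <= N)%N ->
  phi k1 k2 (nearE R k1 k2 N).
Proof.
move=> h1 h2.
rewrite (@phiE _ _ _ _ (in1 k1 (odflt N k1)) (in1 k2 (odflt N k2))) => [| | |z].
- by case: k1 k2 h1 h2 => [a|] [b|] /=; rewrite ?eqxx.
- exact: side_in1.
- exact: side_in1.
- by rewrite dom_near.
Qed.

(* An element e of a larger filter meets every nearE k1 k2 N; the domain of e being a
   product of sides, this puts (k1, k2) in it. *)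
Lemma phi_ultrafilter k1 k2 : Ehat_infty (phi k1 k2 : chars).
Proof.
have kc := phi_char k1 k2; split=> //; split; first exact: char_filter.
move=> B [_ B0 BM _] kB; apply/seteqP; split=> // e Be /=.
have [P [Q [sP sQ eE]]] := dom_side e.
have meet N : (odflt 0 k1 <= N)%N -> (odflt 0 k2 <= N)%N -> exists z : X3,
    [/\ in1 k1 (odflt N k1) (Some z.1.1), in1 k2 (odflt N k2) (Some z.1.2),
        P (Some z.1.1) & Q (Some z.1.2)].
  move=> h1 h2; apply: contrapT => none; apply: B0.
  rewrite (_ : zeroE R = mulE e (nearE R k1 k2 N)).
    by apply: BM => //; apply: kB; exact: phi_near.
  apply: proj_eq => z; rewrite dom_zero dom_mul dom_near// eE.
  by apply/esym/negP => /andP[/andP[? ?] /andP[? ?]]; apply: none; exists z.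
have far (k : option nat) S : side S -> exists M, forall N, (M <= N)%N -> forall a,
    in1 k (odflt N k) (Some a) -> S (Some a) -> S k.
  case: k => [c|]; first by exists 0%N => N _ a /= /eqP->.
  move=> [S0|[b [n SE]]]; first by exists 0%N => N _ a _; rewrite S0.
  exists n.+1 => N nN a /= Na; rewrite !SE /=; case: b {SE} => //.
  by move=> /eqP; lia.
have [M1 h1] := far k1 P sP; have [M2 h2] := far k2 Q sQ.
have [|//|z [z1 z2 Pz Qz]] := meet (M1 + M2 + odflt 0 k1 + odflt 0 k2)%N; try lia.
by rewrite (phiE k1 k2 sP sQ eE) (h1 _ _ _ z1 Pz) ?(h2 _ _ _ z2 Qz)//; lia.
Qed.

Lemma phi_tight k1 k2 : Ehat_tight (phi k1 k2 : chars).
Proof.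
split; first exact: phi_char.
by apply: subset_closure; exact: phi_ultrafilter.
Qed.

Lemma phi_range k1 k2 s b1 b2 r n m : hT s =1 bmap b1 b2 r n m ->
  phi k1 k2 (rangeE s) = in1 b1 n.1 k1 && in1 b2 n.2 k2.
Proof.
move=> sE; apply: phiE => [| |z]; try exact: side_in1.
by rewrite dom_range sE bmapE; case: ifP.
Qed.

(** Evaluating a conjugated projection at (k1, k2) is evaluating the projection at the translated
    point. In particular an orbit keeps its infinite coordinates. *)
Lemma act_phi k1 k2 s b1 b2 r n m : hT s =1 bmap b1 b2 r n m ->
  phi k1 k2 (rangeE s) ->
  act (phi k1 k2) s = phi (mv n.1 m.1 k1) (mv n.2 m.2 k2).
Proof.
move=> sE; rewrite (phi_range k1 k2 sE) => /andP[h1 h2]; apply/funext => e.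
have [P [Q [sP sQ eE]]] := dom_side e.
rewrite (phiE _ _ sP sQ eE) /act.
rewrite (phiE k1 k2 (side_mv b1 n.1 m.1 sP) (side_mv b2 n.2 m.2 sQ)) ?h1 ?h2// => z.
rewrite dom_conj sE bmapE; cbv beta; rewrite andbACA.
by case: ifP => //= _; rewrite eE.
Qed.

End Characters.

(** * Germs *)

Section Germs.
Variable R : realType.
Local Notation semigT := (semigT R).
Local Notation projT := (projT R).
Local Notation chars := (chars R).
Local Notation gpd := (gpd R).
Local Notation Z3 := (int * int * int)%type.
Implicit Types (x : chars) (e : projT) (s : semigT) (v w : Z3) (g h : gpd).

Definition pos (z : X3) : Z3 := (z.1.1%:Z, z.1.2%:Z, z.2).

Definition translates s v := forall y z, hT s y = Some z -> pos z = pos y + v.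

Lemma translates_bmap s b1 b2 r n m : hT s =1 bmap b1 b2 r n m ->
  translates s (m.1%:Z - n.1%:Z, m.2%:Z - n.2%:Z, - r).
Proof.
move=> sE y z; rewrite sE bmapE; case: ifP => // /andP[h1 h2] [<-].
have sub b n' m' a : in1 b n' (Some a) -> ((a - n' + m')%N : int) = a%:Z + (m'%:Z - n'%:Z).
  by case: b => /= [/eqP->|na]; lia.
by congr (_, _, _); [exact: sub h1|exact: sub h2].
Qed.

(* Unspecified for the zero element, which every vector translates. *)
Definition dispT s : Z3 := xget 0 [set v | translates s v].

Lemma translates_disp s : translates s (dispT s).
Proof.
rewrite /dispT; case: xgetP => [_ -> //|none]; exfalso.
have [s0|[b1 [b2 [r [n [m [_ sE]]]]]]] := hT_inT s; last exact: none (translates_bmap sE).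
by apply: (none 0) => y z; rewrite s0.
Qed.

Lemma dispT_eq s v y : translates s v -> hT s y -> dispT s = v.
Proof.
move=> sv; case E: (hT s y) => [z|//] _; apply: (addrI (pos y)).
by rewrite -(sv _ _ E) -(translates_disp E).
Qed.

Lemma dispT_char x s v : translates s v -> Ehat0 x -> x (rangeE s) -> dispT s = v.
Proof.
move=> sv xc xs; have [z] := char_dom xc xs; rewrite dom_range.
exact: dispT_eq sv.
Qed.

Definition valid x s := Ehat0 x /\ x (rangeE s).

Lemma germE x s (Ss : Sigma_pred (x, s)) : germ x s = mk_gpd (MkSigma Ss).
Proof. by congr (\pi_(_) _)%qT; apply: val_inj; rewrite /= insubdK. Qed.

(** Equal germs agree at some point of a common domain, where the displacement can be read off.
    Conversely, two elements with the same displacement agree on the product of their range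
    projections, on which [x] is 1. *)
Lemma germ_eqP x s s' : valid x s -> valid x s' ->
  reflect (dispT s = dispT s') (germ x s == germ x s').
Proof.
move=> vs vs'.
have Ss : Sigma_pred (x, s) by exact/asboolP.
have Ss' : Sigma_pred (x, s') by exact/asboolP.
rewrite (germE Ss) (germE Ss').
apply: (iffP eqP) => [/eqmodP|ss'].
  move=> /asboolP[_ [e /= xe es]]; have [xc xs] := vs; have [_ xM _] := xc.
  have : x (mulE e (rangeE s)) by rewrite xM xe.
  move=> /(char_dom xc)[y]; rewrite dom_mul dom_range => /andP[ey].
  case E: (hT s y) => [z|//] _; have Ee : hT e y = Some y by rewrite hT_proj ey.
  have /(congr1 (fun t => hT t y)) := es; rewrite !hT_mul /= Ee /= E => /esym E'.
  apply: (addrI (pos y)).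
  by rewrite -(translates_disp E) -(translates_disp E').
apply/eqmodP/asboolP; split=> //=.
have [[_ xs] [[_ xM _] xs']] := (vs, vs').
exists (mulE (rangeE s) (rangeE s')); first by rewrite xM xs.
apply: semigT_eq => y; rewrite [LHS]hT_mul [RHS]hT_mul hT_proj dom_mul !dom_range.
case E: (hT s y) => [z|]//=; case E': (hT s' y) => [z'|]//=; rewrite E E'.
congr Some; have := translates_disp E; rewrite ss' -(translates_disp E').
by case: z {E} => [[? ?] ?]; case: z' {E'} => [[? ?] ?] [-> -> ->].
Qed.

Lemma gpdE g : valid (grange g) (grep g) /\ g = germ (grange g) (grep g).
Proof.
have /asboolP v := sigP (gpd_repr g); split=> //.
rewrite /germ /mk_gpd (_ : (grange g, grep g) = sigval (gpd_repr g)); last first.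
  by rewrite [RHS]surjective_pairing.
by rewrite valKd /mk_gpd reprK.
Qed.

Definition gdisp g : Z3 := dispT (grep g).

Lemma grangeE x s : valid x s -> grange (germ x s) = x.
Proof.
move=> v; have Ss : Sigma_pred (x, s) by exact/asboolP.
have /eqmodP/asboolP[] // :
  (gpd_repr (germ x s) = MkSigma Ss %[mod {eq_quot germ_equiv R}])%qT.
by rewrite /gpd_repr reprK (germE Ss).
Qed.

Lemma gdispE x s v : valid x s -> translates s v -> gdisp (germ x s) = v.
Proof.
move=> vs sv; have [xc xs] := vs; rewrite -(dispT_char sv xc xs).
have [v' /eqP E] := gpdE (germ x s); rewrite !grangeE// in v' E.
by apply/esym/(germ_eqP vs v').
Qed.

Lemma gpd_eq g h : grange g = grange h -> gdisp g = gdisp h -> g = h.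
Proof.
move=> gh d; have [v ->] := gpdE g; have [v' ->] := gpdE h.
by rewrite gh in v *; apply/eqP/germ_eqP.
Qed.

(** [gsource] uses the representative chosen by [repr]. It has the displacement of [s], so both
    conjugate a projection to the same one after a cut by the two range projections, which [x] does
    not notice. *)
Lemma gsourceE x s : valid x s -> gsource (germ x s) = act x s.
Proof.
move=> vs; have [xc xs] := vs; rewrite /gsource grangeE//; set g := germ x s.
have [v' E] := gpdE g; rewrite grangeE// in v' E.
have /(germ_eqP vs v') d : germ x s == germ x (grep g) by apply/eqP.
have [_ xM _] := xc; have [_ xs'] := v'.
have cut (s1 s2 : semigT) e : x (rangeE s1) -> x (rangeE s2) ->
    x (conjE s1 e) = x (mulE (mulE (rangeE s1) (rangeE s2)) (conjE s1 e)).
  by move=> h1 h2; rewrite !xM h1 h2.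
apply/funext => e; rewrite /act (cut (grep g) s e)// (cut s (grep g) e)//; congr x.
apply: proj_eq => y; rewrite !dom_mul !dom_range !dom_conj.
case E1: (hT s y) => [z|]; case E2: (hT (grep g) y) => [z'|]//=.
suff -> : z = z' by [].
have := translates_disp E1; rewrite d -(translates_disp E2).
by case: z {E1} => [[? ?] ?]; case: z' {E2} => [[? ?] ?] [-> -> ->].
Qed.

Lemma grange_char g : Ehat0 (grange g).
Proof. by have [[]] := gpdE g. Qed.

Lemma gsource_char g : Ehat0 (gsource g).
Proof. by have [[xc xs] ->] := gpdE g; rewrite gsourceE//; exact: act_char. Qed.

Section Composition.
Variables g h : gpd.
Hypothesis gh : gsource g = grange h.

Let valid_mul : valid (grange g) (mulT (grep g) (grep h)).
Proof.
have [[gc _] _] := gpdE g; split=> //; rewrite -act_range -/(gsource g) gh.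
by have [[]] := gpdE h.
Qed.

Lemma grange_mul : grange (gmul g h) = grange g.
Proof. exact: grangeE valid_mul. Qed.

Lemma gdisp_mul : gdisp (gmul g h) = gdisp g + gdisp h.
Proof.
apply: gdispE valid_mul _ => y z; rewrite hT_mul.
case E: (hT _ y) => [y'|]//= E'.
by rewrite (translates_disp E') (translates_disp E) addrA.
Qed.

Lemma gsource_mul : gsource (gmul g h) = gsource h.
Proof. by rewrite gsourceE// act_mul -/(gsource g) gh. Qed.

End Composition.

Section Inverse.
Variable g : gpd.

Let valid_inv : valid (gsource g) (starT (grep g)).
Proof.
split; first exact: gsource_char.
by apply: act_star_range; have [[]] := gpdE g.
Qed.

Lemma grange_inv : grange (ginv g) = gsource g.
Proof. exact: grangeE valid_inv. Qed.

Lemma gdisp_inv : gdisp (ginv g) = - gdisp g.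
Proof.
apply: gdispE valid_inv _ => y z /hT_star /translates_disp ->.
by rewrite addrK.
Qed.

Lemma gsource_inv : gsource (ginv g) = grange g.
Proof. by rewrite gsourceE// act_star//; have [[]] := gpdE g. Qed.

End Inverse.

Lemma gpd_eq_source g h : gsource g = gsource h -> gdisp g = gdisp h -> g = h.
Proof.
move=> gh d; have ghV : ginv g = ginv h.
  by apply: gpd_eq; [rewrite !grange_inv; exact: gh|rewrite !gdisp_inv d].
apply: gpd_eq; last exact: d.
by rewrite -(gsource_inv g) ghV gsource_inv.
Qed.

Lemma tight_source g : Ehat_tight (grange g) -> Ehat_tight (gsource g).
Proof. by have [[_ xs] _] := gpdE g => gt; exact: act_tight. Qed.

Lemma tight_range g : Ehat_tight (gsource g) -> Ehat_tight (grange g).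
Proof. by rewrite -grange_inv => /tight_source; rewrite gsource_inv. Qed.

Lemma germ_boxP (U : set chars) s g : germ_box (U, s) g <->
  [/\ U (grange g), grange g (rangeE s) & gdisp g = dispT s].
Proof.
split=> [[x /= [Ux [xc xs]] <-]|[Ug gs d]].
  have v : valid x s by [].
  by rewrite grangeE// (gdispE v (@translates_disp s)).
have v : valid (grange g) s by split=> //; exact: grange_char.
exists (grange g) => /=; first by split=> //; split=> //; exact: grange_char.
by apply: gpd_eq; rewrite ?grangeE// (gdispE v (@translates_disp s)).
Qed.

Lemma ThetaP s g : Theta s g <->
  [/\ Ehat_tight (grange g), grange g (rangeE s) & gdisp g = dispT s].
Proof.
split=> [[x /= [xs xt] <-]|[gt gs d]].
  have v : valid x s by split=> //; exact: xt.1.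
  by rewrite grangeE// (gdispE v (@translates_disp s)).
have v : valid (grange g) s by split=> //; exact: grange_char.
exists (grange g) => //.
by apply: gpd_eq; rewrite ?grangeE// (gdispE v (@translates_disp s)).
Qed.

Lemma Theta_tight s : Theta s `<=` @Gtight R.
Proof. by move=> g /ThetaP[gt _ _]; split=> //; exact: tight_source. Qed.

End Germs.

(** * Topology and convolution *)

Lemma fsbig_single (T : choiceType) (V : nmodType) (A : set T) (i : T) (F : T -> V) :
  A i -> (forall j, A j -> j <> i -> F j = 0) -> \sum_(j \in A) F j = F i.
Proof.
move=> Ai F0; rewrite -(@fsbig_widen _ _ _ _ [set i]) ?fsbig_set1//.
  by move=> _ ->.
by move=> j [/F0 + ji]; exact.
Qed.

Lemma locally_constant_within (X Y : topologicalType) (A : set X) (f : X -> Y) :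
  (forall x, A x -> exists2 V, open V /\ V x & forall y, A y -> V y -> f y = f x) ->
  {within A, continuous f}.
Proof.
move=> fc; apply/subspace_continuousP => x Ax W /nbhs_singleton Wx.
have [V oV fV] := fc x Ax; rewrite /= nbhs_simpl /=.
apply: filterS (open_nbhs_nbhs oV) => y Vy Ay /=.
suff : W (f y) by []; by rewrite fV.
Qed.

Section GroupoidTopology.
Variable R : realType.
Local Notation C := (Cx R).
Local Notation semigT := (semigT R).
Local Notation chars := (chars R).
Local Notation gpd := (gpd R).
Implicit Types (x u : chars) (s : semigT) (g h : gpd).

HB.instance Definition _ := isPointed.Build gpd (germ (phi None None) (oneT R)).

Let nhd g : set gpd := germ_box (setT, grep g).

Let nhd_self g : nhd g g.
Proof. by apply/germ_boxP; have [[_ ?] _] := gpdE g; split. Qed.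

Let open_nhd g : open (nhd g).
Proof. exact: open_germ_box openT. Qed.

(** Discreteness of the fibers: all germs in [nhd g] have the displacement of [g], and source and
    displacement determine a germ. *)
Let nhd_fiber g h : gsource g = gsource h -> nhd g h -> h = g.
Proof. by move=> gh /germ_boxP[_ _ d]; apply: gpd_eq_source. Qed.

Lemma finite_Cc_fiber u (s : seq gpd) (f : gpd -> C) :
  (forall g, g \in s -> fiber u g) -> (forall g, f g != 0 -> g \in s) -> Cc (fiber u) f.
Proof.
move=> su fs; split.
  apply: locally_constant_within => h uh; exists (nhd h) => // y uy /nhd_fiber -> //.
  by rewrite uy.2 uh.2.
exists [set` s]; split; [|by move=> g /= /su|by move=> g /fs].
by apply: finite_compact; exact: finite_seq.
Qed.

Lemma indic_neq0 g h : (\1_[set g] h : C) != 0 -> h \in [:: g].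
Proof. by rewrite indicE in_set1 inE; case: (h == g); rewrite ?eqxx. Qed.

Lemma indic_Cc_fiber u g : fiber u g -> Cc (fiber u) \1_[set g].
Proof.
move=> ug; apply: (@finite_Cc_fiber _ [:: g]); last exact: indic_neq0.
by move=> h; rewrite inE => /eqP->.
Qed.

(** Each [nhd g] with [g] in the fiber meets the fiber only in [g], so a finite subcover of a
    compact set enumerates it. *)
Lemma Cc_fiber_support u (f : gpd -> C) : Cc (fiber u) f ->
  exists s : seq gpd, [/\ uniq s, forall g, g \in s -> fiber u g & forall g, f g != 0 -> g \in s].
Proof.
move=> [_ [K [Kc Ku fK]]].
move: Kc; rewrite compact_cover => /(_ _ K nhd)[||D DK KD].
- by move=> g _; exact: open_nhd.
- by move=> g Kg; exists g.
exists (finmap.enum_fset D); split=> [|g gD|g /fK Kg]; first exact: finmap.fset_uniq.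
  by apply: Ku; have := DK g gD; rewrite inE.
have [h /= hD hg] := KD g Kg.
rewrite (nhd_fiber _ hg)//.
have := DK h hD; rewrite inE => Kh.
by rewrite (Ku h Kh).2 (Ku g Kg).2.
Qed.

Lemma Cc_fiberE u (f : gpd -> C) : Cc (fiber u) f ->
  exists2 s : seq gpd, (forall g, g \in s -> fiber u g) &
    f = \sum_(g <- s) f g *: (\1_[set g] : gpd -> C).
Proof.
move=> /Cc_fiber_support[s [us su fs]]; exists s => //; apply/funext => h.
rewrite fct_sumE; under eq_bigr => g _.
  rewrite (_ : (_ *: _) h = f g * (h == g)%:R); last first.
    by rewrite -[LHS]/(f g * \1_[set g] h) indicE in_set1.
  over.
have [hs|hs] := boolP (h \in s).
  rewrite (bigD1_seq h)//= eqxx mulr1 big1 ?addr0// => g /negbTE gh.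
  by rewrite eq_sym gh mulr0.
rewrite big_seq big1 => [|g gs]; last first.
  by case: eqP gs => [<-|_ _]; rewrite ?(negbTE hs) ?mulr0.
by apply/eqP; apply: contraNT hs; exact: fs.
Qed.

(** Each axiom of a character constrains at most three coordinates, and a limit point agrees with
    some member of the set on any three coordinates. *)
Lemma closed_tight_domain s : closed [set x : chars | x (rangeE s) /\ Ehat_tight x].
Proof.
set S := [set x | _] => x Sx.
have meet (e1 e2 e3 : projT R) : exists y,
    [/\ Ehat0 y, y (rangeE s), y e1 = x e1, y e2 = x e2 & y e3 = x e3].
  have n e : nbhs x [set y : chars | y e = x e].
    by apply: open_nbhs_nbhs; split=> //; exact: open_coord.
  have [y [[ys [yc _]] [[? ?] ?]]] := Sx _ (filterI (filterI (n e1) (n e2)) (n e3)).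
  by exists y; split.
split=> /=; first by have [y [_ ys <- _ _]] := meet (rangeE s) (rangeE s) (rangeE s).
split.
  split.
  - by exists (rangeE s); have [y [_ ys <- _ _]] := meet (rangeE s) (rangeE s) (rangeE s).
  - by move=> e f; have [y [[_ yM _] _ <- <- <-]] := meet (mulE e f) e f.
  - by have [y [[_ _ y0] _ <- _ _]] := meet (zeroE R) (zeroE R) (zeroE R).
rewrite ((closure_id (closure (@Ehat_infty R))).1 (@closed_closure _ _)).
by apply: closure_subset Sx => y [_ []].
Qed.

(** The continuous image under [germ ^~ s] of a closed subset of {0,1}^E, which is compact by
    Tychonoff's theorem. *)
Lemma compact_Theta s : compact (Theta s).
Proof.
apply: continuous_compact.
  apply/subspace_continuousP => x [xs xt]; apply: gpd_cvg => U s' oU.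
  have vx : valid x s by split=> //; exact: xt.1.
  move=> /germ_boxP; rewrite grangeE// (gdispE vx (@translates_disp _ s)) => -[Ux xs' d].
  have nU : nbhs x (U `&` [set y : chars | y (rangeE s') = true]).
    by apply: filterI; apply: open_nbhs_nbhs; split=> //; exact: open_coord.
  rewrite /= nbhs_simpl /=; apply: filterS nU => y [Uy ys'] [ys yt] /=.
  have vy : valid y s by split=> //; exact: yt.1.
  by apply/germ_boxP; rewrite grangeE// (gdispE vy (@translates_disp _ s)).
apply: (@subclosed_compact _ _ [set x : chars | forall e, [set: bool] (x e)]).
- exact: closed_tight_domain.
- by apply: (@tychonoff _ (fun=> bool) (fun=> setT)) => e; exact: bool_compact.
- by [].
Qed.

Lemma indic_Cc_Theta s : Cc (@Gtight R) \1_(Theta s).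
Proof.
split; last first.
  exists (Theta s); split; [exact: compact_Theta|exact: Theta_tight|].
  by move=> g; rewrite indicE; case: (boolP (g \in _)); rewrite ?inE ?eqxx.
apply: locally_constant_within => g [gt _].
pose b := grange g (rangeE s).
(* On this box the value at [rangeE s] and the displacement are constant, and for tight ranges they
   decide membership in [Theta s]. *)
exists (germ_box ([set x : chars | x (rangeE s) = b], grep g)).
  split; first by apply: open_germ_box; exact: open_coord.
  by apply/germ_boxP; have [[_ ?] _] := gpdE g; split.
move=> h [ht _] /germ_boxP[/= hb _ d]; rewrite !indicE; congr ((_ : bool)%:R).
apply/idP/idP; rewrite !inE => /ThetaP[_ hs hd]; apply/ThetaP; split=> //.
- by rewrite -/b -hb.
- by rewrite -hd d.
- by rewrite hb.
- by rewrite d.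
Qed.

(** * Convolution with the indicator of Theta *)

Section Convolution.
Variables (s : semigT) (g : gpd).

Let term_neq0 (x y : gpd) : grange y = grange x ->
  \1_(Theta s) y * \1_[set g] (gmul (ginv y) x) != 0 :> C ->
  [/\ Theta s y, gsource y = grange g & x = gmul y g].
Proof.
move=> yx; rewrite !indicE in_set1.
case: (boolP (y \in _)); rewrite ?mul0r ?eqxx// inE => ys.
case: (gmul (ginv y) x =P g) => [yxg _|_]; last by rewrite mulr0n mulr0 eqxx.
have yx' : gsource (ginv y) = grange x by rewrite gsource_inv.
have yg : gsource y = grange g by rewrite -yxg grange_mul// grange_inv.
split=> //; apply: gpd_eq; first by rewrite grange_mul.
by rewrite gdisp_mul// -yxg gdisp_mul// gdisp_inv addNKr.
Qed.

Lemma conv_Theta0 : (forall y, Theta s y -> gsource y <> grange g) ->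
  Defs.conv \1_(Theta s) \1_[set g] = 0 :> (gpd -> C).
Proof.
move=> s0; apply/funext => x; apply: fsbig1 => y [_ yx].
by apply/eqP; apply: contraT => /(term_neq0 yx)[/s0].
Qed.

(** [Theta s] is a bisection: its elements share one displacement and are determined by their
    source. Hence the sum has a single nonzero term, at [y]. *)
Lemma conv_Theta (y : gpd) : Theta s y -> gsource y = grange g ->
  Defs.conv \1_(Theta s) \1_[set g] = \1_[set gmul y g] :> (gpd -> C).
Proof.
move=> ys yg; apply/funext => x; rewrite [RHS]indicE in_set1.
have uniq_y z : Theta s z -> gsource z = grange g -> z = y.
  move=> /ThetaP[_ _ zd] zg; move: ys => /ThetaP[_ _ yd].
  by apply: gpd_eq_source; rewrite ?zg ?yg// zd yd.
case: eqP => [->|xyg].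
  rewrite /Defs.conv (@fsbig_single _ _ _ y); last 2 first.
  - by split; [exact: Theta_tight ys|rewrite grange_mul].
  - move=> z [_ zx] zy; apply/eqP; apply: contraT => /(term_neq0 zx)[zs zg _].
    by case: zy; exact: uniq_y.
  rewrite !indicE (mem_set ys) mul1r mem_set//=.
  have yyg : gsource (ginv y) = grange (gmul y g) by rewrite gsource_inv grange_mul.
  apply: gpd_eq; first by rewrite grange_mul// grange_inv.
  by rewrite !gdisp_mul// gdisp_inv addKr.
rewrite /Defs.conv fsbig1// => z [_ zx]; apply/eqP; apply: contraT.
by move=> /(term_neq0 zx)[zs zg xE]; case: xyg; rewrite xE (uniq_y z).
Qed.

End Convolution.

End GroupoidTopology.

(** * Induction from the isotropy group of an orbit *)

Section Orbit.
Variables (R : realType) (t0 : Cx R).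
Hypothesis t0T : `|t0| = 1.
Local Notation C := (Cx R).
Local Notation gpd := (gpd R).
Variables (u : chars R) (I : choiceType) (rho : I * int -> gpd) (sigma : int -> gpd).
Hypothesis rho_inj : injective rho.
Hypothesis rhoP : forall g, fiber u g <-> exists s, g = rho s.
Hypothesis rho_sigma : forall s n, gmul (rho s) (sigma n) = rho (s.1, s.2 + n).
Variables (H : hilbert R) (kappa : (gpd -> C) -> H).
Hypothesis kappaP : induced_space t0 u sigma kappa.
Let e (s : I * int) : H := kappa \1_[set rho s].

Let t0_neq0 : t0 != 0.
Proof. by rewrite -normr_eq0 t0T oner_eq0. Qed.

Let t0_conj n : (t0 ^ n)^* = t0 ^ (- n).
Proof.
have t0c : t0^* = t0^-1 by apply: (mulfI t0_neq0); rewrite -normCK t0T expr1n divff.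
by rewrite rmorphXz/= ?unitfE// t0c exprz_inv.
Qed.

Lemma fiber_rho s : fiber u (rho s). Proof. by apply/rhoP; exists s. Qed.

Let e_Cc s : Cc (fiber u) \1_[set rho s]. Proof. exact: indic_Cc_fiber (fiber_rho s). Qed.

(** Only y = [rho s] contributes to the pairing at sigma_n, and its translate by sigma_n is [rho w]
    only if the orbit indices agree and n = [w.2 - s.2]. *)
Lemma ip_orbit s w : ip (e s) (e w) = (s.1 == w.1)%:R * t0 ^ (w.2 - s.2).
Proof.
have [_ kip _] := kappaP; rewrite /e kip// /Lrep.
have pairE n : pairing_star u \1_[set rho s] \1_[set rho w] (sigma n)
    = ((s.1, s.2 + n) == w)%:R.
  rewrite /pairing_star (@fsbig_single _ _ _ (rho s)); last 2 first.
  - exact: fiber_rho.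
  - by move=> y _ /eqP/negbTE ys; rewrite indicE in_set1 ys mul0r.
  by rewrite !indicE !in_set1 eqxx mul1r rho_sigma (inj_eq rho_inj) conjC_nat.
under eq_fsbigr do rewrite pairE.
case: s w {pairE} => [i r] [j r']; rewrite /=.
rewrite (@fsbig_single _ _ _ (r' - r)) ?xpair_eqE/=.
- by rewrite addrC subrK eqxx andbT.
- by [].
- move=> n _ nr; rewrite xpair_eqE/=; case: (r + n =P r') => [rn|_].
    by case: nr; rewrite -rn addrC addKr.
  by rewrite andbF mul0r.
Qed.

(** The form on functions is degenerate: by [ip_orbit] and |t0| = 1, the difference of the two
    vectors has norm zero. *)
Lemma orbit_shift i r : e (i, r) = t0 ^ (- r) *: e (i, 0).
Proof.
apply/eqP; rewrite -subr_eq0; apply/eqP/ip_eq0.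
rewrite !(ipDl, ipDr, ipNl, ipNr, ipZl, ipZr) !ip_orbit/= eqxx !mul1r t0_conj opprK.
have tV : t0 ^ r * t0 ^ (- r) = 1 by rewrite -expfzDr// subrr.
by rewrite !subrr sub0r subr0 !expr0z mulr1 (mulrC (t0 ^ (- r))) tV !subrr addr0.
Qed.

Let kappa0 : kappa 0 = 0.
Proof.
have [kl _ _] := kappaP.
have C0 : Cc (fiber u) (0 : gpd -> C).
  by apply: (@finite_Cc_fiber _ _ [::]) => // g; rewrite eqxx.
by have := kl (-1) _ _ C0 C0; rewrite scaler0 addr0 scaleN1r addNr.
Qed.

(** [kappa] is linear only on [Cc (fiber u)], so each partial sum must be shown to have finite
    support in the fiber. *)
Let kappa_sum (s : seq gpd) (c : gpd -> C) : (forall g, g \in s -> fiber u g) ->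
  kappa (\sum_(g <- s) c g *: (\1_[set g] : gpd -> C)) = \sum_(g <- s) c g *: kappa \1_[set g].
Proof.
have [kl _ _] := kappaP; elim: s => [|g s ih] su; first by rewrite !big_nil kappa0.
have su' h : h \in s -> fiber u h by move=> hs; apply: su; rewrite inE hs orbT.
rewrite !big_cons kl ?ih//; first by apply: indic_Cc_fiber; apply: su; rewrite inE eqxx.
apply: finite_Cc_fiber su' _ => h; apply: contraNT => hs.
rewrite fct_sumE big_seq big1// => g' g's; rewrite -[LHS]/(c g' * \1_[set g'] h).
have [->|/indic_neq0] := eqVneq (\1_[set g'] h : C) 0; first by rewrite mulr0.
by rewrite inE => /eqP hg; rewrite hg g's in hs.
Qed.

Lemma orbit_total : total_family (fun i => e (i, 0)).
Proof.
have [_ _ kd] := kappaP; apply: total_family_pairs => x eps /(kd x)[f fC xf].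
have [s su fE] := Cc_fiberE fC.
suff [l kl] : exists l : seq (C * I), kappa f = \sum_(p <- l) p.1 *: e (p.2, 0).
  by exists l; rewrite -kl.
rewrite fE kappa_sum// {xf fE}; elim: s su => [|g s ih] su; first by exists [::]; rewrite !big_nil.
have [|l lE] := ih; first by move=> h hs; apply: su; rewrite inE hs orbT.
have /rhoP[[i r] gE] : fiber u g by apply: su; rewrite inE eqxx.
exists ((f g * t0 ^ (- r), i) :: l).
by rewrite !big_cons lE gE -/(e _) orbit_shift scalerA.
Qed.

Lemma orbit_basis : orthonormal_basis (fun i => e (i, 0)).
Proof.
split; last exact: orbit_total.
by move=> i j; rewrite ip_orbit/= subrr expr0z mulr1.
Qed.

Section Target.
Variables (K : hilbert R) (b : I -> K).
Hypothesis b_basis : orthonormal_basis b.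

Lemma orbit_unitary : exists2 U : H -> K, unitary U &
  forall s, U (e s) = t0 ^ (- s.2) *: b s.1.
Proof.
have [U Uu Ub] := unitary_bases orbit_basis b_basis.
exists U => // -[i r]; rewrite orbit_shift linear_opZ ?Ub//.
by case: Uu.
Qed.

Variables (v : gen -> K -> K) (sh : gen -> I -> option I).
Hypothesis v_bounded : forall j, bounded_op (v j).
Hypothesis v_b : forall j i, v j (b i) = oapp (fun i' => t0 *: b i') 0 (sh j i).
Hypothesis conv_rho : forall j s, Defs.conv \1_(Theta (genT R j)) \1_[set rho s] =
  oapp (fun i => \1_[set rho (i, s.2 - 1)]) 0 (sh j s.1) :> (gpd -> C).

(** Both sides are bounded, so they are compared on the total family [e (i, 0)]. There [conv_rho]
    yields [e (i', -1)], which [U] sends to [t0 *: b i'], the value prescribed by [v_b]. *)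
Lemma orbit_equivalent : Ind_equivalent u kappa v.
Proof.
have [U Uu Ub] := orbit_unitary.
apply: (Ind_equivalentP Uu) => A iota Ind [[Ib _ _ _] Ind_k] j.
apply: bounded_op_ext orbit_total _ _ _ => [||i].
- by apply: (bounded_op_comp (Ib _).1); exact: unitary_bounded.
- by apply: (bounded_op_comp _ (v_bounded j)); exact: unitary_bounded.
rewrite /= Ub oppr0 expr0z scale1r v_b {1}/e Ind_k//; last exact: indic_Cc_Theta.
rewrite conv_rho /=; case: (sh j i) => [i'|] /=; last first.
  by rewrite kappa0 linear_op0//; case: Uu.
by rewrite sub0r -/(e (i', -1)) Ub opprK expr1z.
Qed.

End Target.
End Orbit.

(** * Action of the generators *)

Section PullOperators.
Variables (R : realType) (X : choiceType).
Local Notation C := (Cx R).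

Lemma pull_bounded (t : C) (h : X -> option X) : pinj h ->
  bounded_op (fun f : ell2 R X => t *: pull h f : ell2 R X).
Proof.
move=> hi; split.
  move=> a f g; rewrite scalerA mulrC -scalerA -scalerDr; congr (_ *: _).
  by apply: l2P => x; rewrite l2_addE l2_scaleE !pullE//; case: (h x) => //=; rewrite mulr0 addr0.
exists (re `|t|) => f; rewrite hnormZ ler_wpM2l ?re_ge0//.
rewrite -(@ler_pXn2r _ 2)// ?nnegrE ?hnorm_ge0// -ofR_le !hnorm_sqr.
apply: l2_le => s us; apply: le_trans (l2_sum_le f (uniq_pmap hi us)).
rewrite le_eqVlt; apply/orP; left; apply/eqP.
elim: {us} s => [|x s ih]; first by rewrite !big_nil.
rewrite big_cons ih /= pullE//; case: (h x) => [y|] /=; first by rewrite big_cons.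
by rewrite normr0 expr0n add0r.
Qed.

Lemma pull_delta (h g : X -> option X) (y : X) :
  (forall x y, h x = Some y <-> g y = Some x) ->
  pull h (delta R y : ell2 R X) = oapp (@delta R X) 0 (g y).
Proof.
move=> hg; have hi : pinj h by move=> x x' z /hg + /hg => -> [].
apply: l2P => x; rewrite pullE//.
case E: (h x) => [z|] /=.
  rewrite deltaE; have [<-|zy] := eqVneq z y; first by have /hg-> := E; rewrite /= deltaE eqxx.
  case E' : (g y) => [x'|] //=; rewrite deltaE; case: eqP => // xx'.
  by have /hg := E'; rewrite -xx' E => -[/eqP]; rewrite (negbTE zy).
case E' : (g y) => [x'|] //=; rewrite deltaE; case: eqP => // xx'.
by have /hg := E'; rewrite -xx' E.
Qed.

End PullOperators.

Section Generators.
Variable R : realType.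
Local Notation C := (Cx R).
Local Notation gpd := (gpd R).

(* Whether the generator has p rather than S^* as first, resp. second, factor. *)
Definition gen_p1 (j : gen) : bool := match j with g3 | g4 => true | _ => false end.
Definition gen_p2 (j : gen) : bool := match j with g2 | g4 => true | _ => false end.

(** S^* is [SS 1 0] and p is [SpS 0 0], so the exponents record which factors are S^*; [r = -1]
    encodes the factor t. *)
Lemma hT_gen j : hT (genT R j) =1
  bmap (gen_p1 j) (gen_p2 j) (-1) (~~ gen_p1 j : nat, ~~ gen_p2 j : nat) (0, 0)%N.
Proof.
apply: hT_eq; first exact: pinj_bmap.
by case: j; [rewrite -(B1E _ _ (1, 1) (0, 0))%N|rewrite -B2E|rewrite -B3E|rewrite -B4E].
Qed.

Lemma hT_starT (s : semigT R) b1 b2 r n m :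
  hT s =1 bmap b1 b2 r n m -> hT (starT s) =1 bmap b1 b2 (- r) m n.
Proof.
move=> sE y; case E: (hT _ y) => [x|].
  by apply/esym; apply: (iffLR (bmapV _ _ _ _ _ _ _)); rewrite -sE; apply/hT_star.
case E': (bmap _ _ _ _ _ y) => [x|//].
by move/(iffRL (bmapV _ _ _ _ _ _ _)): E'; rewrite -sE => /hT_star; rewrite E.
Qed.

Section Action.
Variables (j : gen) (k1 k2 : option nat) (g : gpd).
Hypothesis g_range : grange g = phi k1 k2.

Let range_star : phi k1 k2 (rangeE (starT (genT R j))) =
  in1 (gen_p1 j) 0 k1 && in1 (gen_p2 j) 0 k2.
Proof. exact: phi_range (hT_starT (hT_gen j)). Qed.

(** The source of an element of [Theta] takes the value 1 on s^* s. For a factor p this forces the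
    coordinate 0, excluding infinity, whereas a factor S^* imposes no condition. *)
Lemma conv_gen0 : in1 (gen_p1 j) 0 k1 && in1 (gen_p2 j) 0 k2 = false ->
  Defs.conv \1_(Theta (genT R j)) \1_[set g] = 0 :> (gpd -> C).
Proof.
move=> k0; apply: conv_Theta0 => _ [x [xs xt] <-].
rewrite gsourceE; last by split=> //; exact: xt.1.
rewrite g_range => xk; have := act_star_range xs.
by rewrite xk range_star k0.
Qed.

(** The element of [Theta] composable with [g] is the inverse of the germ of s^* at the range of
    [g]; the product is then identified by its source and displacement. *)
Lemma conv_gen (h : gpd) l1 l2 v w : gsource g = phi l1 l2 -> gdisp g = v ->
  gsource h = phi l1 l2 -> gdisp h = w -> in1 (gen_p1 j) 0 k1 && in1 (gen_p2 j) 0 k2 ->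
  w = (- (~~ gen_p1 j : nat)%:Z, - (~~ gen_p2 j : nat)%:Z, 1) + v ->
  Defs.conv \1_(Theta (genT R j)) \1_[set g] = \1_[set h] :> (gpd -> C).
Proof.
move=> gl gv hl hw k0 vw; set s := genT R j.
have sv : valid (phi k1 k2) (starT s) by split; [exact: phi_char|rewrite range_star].
pose y := ginv (germ (phi k1 k2) (starT s)).
have ys : gsource y = grange g by rewrite gsource_inv grangeE.
have yr : grange y = act (phi k1 k2) (starT s) by rewrite grange_inv gsourceE.
have yrs : grange y (rangeE s).
  by rewrite yr; have := act_star_range sv.2; rewrite starTK.
have yd : gdisp y = (- (~~ gen_p1 j : nat)%:Z, - (~~ gen_p2 j : nat)%:Z, 1).
  rewrite gdisp_inv (gdispE sv (translates_bmap (hT_starT (hT_gen j)))) /=.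
  by congr (_, _, _); rewrite /= ?subr0 ?opprK.
have yT : Theta s y.
  apply/ThetaP; split=> //; first by apply: tight_range; rewrite ys g_range; exact: phi_tight.
  have vy : valid (grange y) s by split=> //; exact: grange_char.
  rewrite (dispT_char (translates_bmap (hT_gen j)) vy.1 vy.2) yd /=.
  by congr (_, _, _); rewrite /= sub0r.
rewrite (conv_Theta yT ys); congr (\1_[set _]).
by apply: gpd_eq_source; rewrite ?gsource_mul ?gdisp_mul// ?gl// yd gv hw vw.
Qed.

End Action.

Section Germs.
Variables (b1 b2 : bool) (r : int) (n m : nat * nat) (k1 k2 : option nat).
Hypotheses (w : wf b1 b2 r n m) (n1 : in1 b1 n.1 k1) (n2 : in1 b2 n.2 k2).
Let s : semigT R := toT (pull (bmap b1 b2 r n m)).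

Let phi_valid : valid (phi k1 k2) s.
Proof. by split; [exact: phi_char|rewrite (phi_range _ _ (hT_toT R w)) n1 n2]. Qed.

Lemma germ_bmap d1 d2 l1 l2 : m.1%:Z - n.1%:Z = d1 -> m.2%:Z - n.2%:Z = d2 ->
  mv n.1 m.1 k1 = l1 -> mv n.2 m.2 k2 = l2 ->
  [/\ grange (germ (phi k1 k2) s) = phi k1 k2, gdisp (germ (phi k1 k2) s) = (d1, d2, - r) &
      gsource (germ (phi k1 k2) s) = phi l1 l2].
Proof.
move=> <- <- <- <-; split; first exact: grangeE phi_valid.
  exact: gdispE phi_valid (translates_bmap (hT_toT R w)).
by rewrite gsourceE// (act_phi (hT_toT R w))//; exact: phi_valid.2.
Qed.

End Germs.

(** In the inverse of [g] the given unit becomes the range, so it constrains the domain of a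
    representative; inverting again exchanges [n] and [m] and changes the sign of [r]. *)
Lemma fiber_phi k1 k2 (g : gpd) : fiber (phi k1 k2) g ->
  exists b1 b2 r n m, [/\ wf b1 b2 r n m, in1 b1 m.1 k1, in1 b2 m.2 k2 &
    gdisp g = (m.1%:Z - n.1%:Z, m.2%:Z - n.2%:Z, - r)].
Proof.
move=> [_ gk]; have [v gE] := gpdE (ginv g); rewrite grange_inv gk in v gE.
have [s0|[b1 [b2 [r [n [m [w sE]]]]]]] := hT_inT (grep (ginv g)).
  by have [z] := char_dom v.1 v.2; rewrite dom_range s0.
have := v.2; rewrite (phi_range _ _ sE) => /andP[k1n k2n].
exists b1, b2, (- r), m, n; split=> //.
  by case: b1 b2 w {sE k1n k2n} => [] [] /=; lia.
rewrite -[LHS]opprK -gdisp_inv gE (gdispE v (translates_bmap sE)).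
by congr (_, _, _); rewrite /= ?opprB.
Qed.

Lemma phi_source_fiber k1 k2 (g : gpd) : gsource g = phi k1 k2 -> fiber (phi k1 k2) g.
Proof.
move=> gk; split=> //; have t : Ehat_tight (gsource g) by rewrite gk; exact: phi_tight.
by split=> //; exact: tight_range.
Qed.

End Generators.

(** * The four orbits *)

Section Coordinates.
Variable R : realType.
Local Notation gpd := (gpd R).

Lemma sigma1P r : [/\ grange (sigma1 R r) = phi None None,
  gdisp (sigma1 R r) = (r, r, - r) & gsource (sigma1 R r) = phi None None].
Proof. by rewrite /sigma1; case: ifP => r0; rewrite B1E; apply: germ_bmap => //=; lia. Qed.

Lemma rho2P k2 s : [/\ grange (rho2 R k2 s) = phi None (Some s.1),
  gdisp (rho2 R k2 s) = (s.2, k2%:Z - s.1%:Z, - s.2) & gsource (rho2 R k2 s) = phi None (Some k2)].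
Proof.
case: s => i r; rewrite /rho2/=.
by case: ifP => r0; rewrite B2E; apply: germ_bmap => //=; try lia; congr Some; lia.
Qed.

Lemma rho3P k1 s : [/\ grange (rho3 R k1 s) = phi (Some s.1) None,
  gdisp (rho3 R k1 s) = (k1%:Z - s.1%:Z, s.2, - s.2) & gsource (rho3 R k1 s) = phi (Some k1) None].
Proof.
case: s => i r; rewrite /rho3/=.
by case: ifP => r0; rewrite B3E; apply: germ_bmap => //=; try lia; congr Some; lia.
Qed.

Lemma rho4P k s : [/\ grange (rho4 R k s) = phi (Some s.1.1) (Some s.1.2),
  gdisp (rho4 R k s) = (k.1%:Z - s.1.1%:Z, k.2%:Z - s.1.2%:Z, - s.2) &
  gsource (rho4 R k s) = phi (Some k.1) (Some k.2)].
Proof.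
case: s => [[i j] r]; rewrite /rho4/= B4E.
by apply: germ_bmap => //=; congr Some; lia.
Qed.

Lemma fiber_sigma1 (g : gpd) : fiber (phi None None) g <-> exists r, g = sigma1 R r.
Proof.
split=> [gu|[r ->]]; last by apply: phi_source_fiber; have [] := sigma1P r.
have [b1 [b2 [r [n [m [w m1 m2 gd]]]]]] := fiber_phi gu.
exists r; have [_ rd rs] := sigma1P r; apply: gpd_eq_source; first by rewrite gu.2 rs.
by case: b1 b2 w m1 m2 => [] [] //= w _ _; rewrite gd rd; congr (_, _, _); lia.
Qed.

Lemma fiber_rho2 k2 (g : gpd) : fiber (phi None (Some k2)) g <-> exists s, g = rho2 R k2 s.
Proof.
split=> [gu|[s ->]]; last by apply: phi_source_fiber; have [] := rho2P k2 s.
have [b1 [b2 [r [n [m [w m1 m2 gd]]]]]] := fiber_phi gu.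
(* The displacement fixes the range coordinate. The subtraction is exact because [m2] gives
   [m.2 <= k2], and a factor p at the infinite coordinate is excluded by [m1]. *)
exists ((k2 + n.2 - m.2)%N, r); have [_ rd rs] := rho2P k2 ((k2 + n.2 - m.2)%N, r).
apply: gpd_eq_source; first by rewrite gu.2 rs.
case: b1 b2 w m1 m2 => [] [] //= w _; rewrite gd rd => m2; congr (_, _, _); rewrite /=; lia.
Qed.

Lemma fiber_rho3 k1 (g : gpd) : fiber (phi (Some k1) None) g <-> exists s, g = rho3 R k1 s.
Proof.
split=> [gu|[s ->]]; last by apply: phi_source_fiber; have [] := rho3P k1 s.
have [b1 [b2 [r [n [m [w m1 m2 gd]]]]]] := fiber_phi gu.
exists ((k1 + n.1 - m.1)%N, r); have [_ rd rs] := rho3P k1 ((k1 + n.1 - m.1)%N, r).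
apply: gpd_eq_source; first by rewrite gu.2 rs.
case: b1 b2 w m1 m2 => [] [] //= w + _; rewrite gd rd => m1; congr (_, _, _); rewrite /=; lia.
Qed.

Lemma fiber_rho4 k (g : gpd) :
  fiber (phi (Some k.1) (Some k.2)) g <-> exists s, g = rho4 R k s.
Proof.
split=> [gu|[s ->]]; last by apply: phi_source_fiber; have [] := rho4P k s.
have [b1 [b2 [r [n [m [w m1 m2 gd]]]]]] := fiber_phi gu.
pose s := ((k.1 + n.1 - m.1)%N, (k.2 + n.2 - m.2)%N, r).
exists s; have [_ rd rs] := rho4P k s.
apply: gpd_eq_source; first by rewrite gu.2 rs.
rewrite gd rd; case: b1 b2 w m1 m2 => [] [] /= w m1 m2; congr (_, _, _); rewrite /=; lia.
Qed.

Lemma gmul_eq (g h f : gpd) k1 k2 l1 l2 v w : gsource g = phi k1 k2 -> gdisp g = v ->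
  grange h = phi k1 k2 -> gdisp h = w -> gsource h = phi l1 l2 ->
  gsource f = phi l1 l2 -> gdisp f = v + w -> gmul g h = f.
Proof.
move=> gk gv hk hw hl fl fvw; have gh : gsource g = grange h by rewrite gk hk.
apply: gpd_eq_source; first by rewrite gsource_mul// hl fl.
by rewrite gdisp_mul// gv hw fvw.
Qed.

Lemma sigma1_mul r n : gmul (sigma1 R r) (sigma1 R n) = sigma1 R (r + n).
Proof.
have [_ d e] := sigma1P r; have [a' d' e'] := sigma1P n; have [_ d'' e''] := sigma1P (r + n).
by apply: (gmul_eq e d a' d' e' e''); rewrite d''; congr (_, _, _); rewrite /=; lia.
Qed.

Lemma rho2_mul k2 s n : gmul (rho2 R k2 s) (rho2 R k2 (k2, n)) = rho2 R k2 (s.1, s.2 + n).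
Proof.
have [_ d e] := rho2P k2 s; have [a' d' e'] := rho2P k2 (k2, n).
have [_ d'' e''] := rho2P k2 (s.1, s.2 + n).
by apply: (gmul_eq e d a' d' e' e''); rewrite d''; congr (_, _, _); rewrite /=; lia.
Qed.

Lemma rho3_mul k1 s n : gmul (rho3 R k1 s) (rho3 R k1 (k1, n)) = rho3 R k1 (s.1, s.2 + n).
Proof.
have [_ d e] := rho3P k1 s; have [a' d' e'] := rho3P k1 (k1, n).
have [_ d'' e''] := rho3P k1 (s.1, s.2 + n).
by apply: (gmul_eq e d a' d' e' e''); rewrite d''; congr (_, _, _); rewrite /=; lia.
Qed.

Lemma rho4_mul k s n : gmul (rho4 R k s) (rho4 R k (k, n)) = rho4 R k (s.1, s.2 + n).
Proof.
have [_ d e] := rho4P k s; have [a' d' e'] := rho4P k (k, n).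
have [_ d'' e''] := rho4P k (s.1, s.2 + n).
by apply: (gmul_eq e d a' d' e' e''); rewrite d''; congr (_, _, _); rewrite /=; lia.
Qed.

Lemma gdisp_eq (g h : gpd) v w : gdisp g = v -> gdisp h = w -> g = h -> v = w.
Proof. by move=> <- <- ->. Qed.

Lemma sigma1_inj : injective (@sigma1 R).
Proof.
move=> r r'; have [_ d _] := sigma1P r; have [_ d' _] := sigma1P r'.
by move=> /(gdisp_eq d d')[].
Qed.

Lemma rho2_inj k2 : injective (rho2 R k2).
Proof.
move=> [i r] [i' r']; have [_ d _] := rho2P k2 (i, r); have [_ d' _] := rho2P k2 (i', r').
by move=> /(gdisp_eq d d')[-> /= ? _]; congr (_, _); lia.
Qed.

Lemma rho3_inj k1 : injective (rho3 R k1).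
Proof.
move=> [i r] [i' r']; have [_ d _] := rho3P k1 (i, r); have [_ d' _] := rho3P k1 (i', r').
by move=> /(gdisp_eq d d')[/= ? -> _]; congr (_, _); lia.
Qed.

Lemma rho4_inj k : injective (rho4 R k).
Proof.
move=> [[i j] r] [[i' j'] r'].
have [_ d _] := rho4P k (i, j, r); have [_ d' _] := rho4P k (i', j', r').
by move=> /(gdisp_eq d d')[/= ? ? /oppr_inj ->]; congr (_, _, _); lia.
Qed.

(* Inverse to the partial map describing S^* or, if b holds, p on the basis. *)
Definition raise (b : bool) : nat -> option nat :=
  if b then zmap else fun a => Some a.+1.
Definition lower (b : bool) : nat -> option nat := if b then zmap else ssub 1.

Lemma lowerP b x y : lower b x = Some y <-> raise b y = Some x.
Proof.
case: b; rewrite /lower /raise /zmap /ssub.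
  by split; case: eqP => // -> [<-].
by split; [case: leqP => // ? [<-]; congr Some; lia|move=> [<-]; rewrite /= subn1].
Qed.

Lemma pinj_lower b : pinj (lower b).
Proof. by move=> x y z /lowerP + /lowerP => -> []. Qed.

Lemma raiseE b k : raise b k = if in1 b 0 (Some k) then Some (if b then 0 else k.+1)%N else None.
Proof. by case: b => //=; rewrite /raise /zmap; case: eqP => // ->. Qed.

Lemma SadjE : @Sadj R = pull (lower false).
Proof. exact: (iter_SadjE R 1). Qed.

(** These four maps describe how the generators move the orbit index, infinite coordinates being
    dropped; [None] arises from a factor p at an infinite or nonzero coordinate. *)
Definition raise1 (j : gen) (_ : unit) := if gen_p1 j || gen_p2 j then None else Some tt.
Definition raise2 (j : gen) i := if gen_p1 j then None else raise (gen_p2 j) i.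
Definition raise3 (j : gen) i := if gen_p2 j then None else raise (gen_p1 j) i.
Definition raise4 (j : gen) := pprod (raise (gen_p1 j)) (raise (gen_p2 j)).

Local Notation conv_delta j g :=
  (Defs.conv \1_(Theta (genT R j)) \1_[set g] : gpd -> Cx R).

Lemma conv_sigma1 j (s : unit * int) : conv_delta j (sigma1 R s.2) =
  oapp (fun i : unit => \1_[set sigma1 R (s.2 - 1)]) 0 (raise1 j s.1).
Proof.
case: s => i r; have [a d e] := sigma1P r; have [_ d' e'] := sigma1P (r - 1).
rewrite /raise1; case: ifP => /= p12; first by rewrite (conv_gen0 a)//=; case: j p12.
apply: (conv_gen a e d e' d'); first by case: j p12.
by case: j p12 => //= _; congr (_, _, _); rewrite /=; lia.
Qed.

Lemma conv_rho2 k2 j s : conv_delta j (rho2 R k2 s) =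
  oapp (fun i => \1_[set rho2 R k2 (i, s.2 - 1)]) 0 (raise2 j s.1).
Proof.
have [a d e] := rho2P k2 s; rewrite /raise2 raiseE.
case: ifP => p1; first by rewrite (conv_gen0 a)//= p1.
case: ifP => p2 /=; last by rewrite (conv_gen0 a)// p2 andbF.
set t := (_, _); have [_ d' e'] := rho2P k2 t.
apply: (conv_gen a e d e' d'); first by rewrite p1 p2.
by move: p1 p2; rewrite {a d d' e'}/t; case: j => //= _ h; congr (_, _, _); rewrite /=; lia.
Qed.

Lemma conv_rho3 k1 j s : conv_delta j (rho3 R k1 s) =
  oapp (fun i => \1_[set rho3 R k1 (i, s.2 - 1)]) 0 (raise3 j s.1).
Proof.
have [a d e] := rho3P k1 s; rewrite /raise3 raiseE.
case: ifP => p2; first by rewrite (conv_gen0 a)//= p2 andbF.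
case: ifP => p1 /=; last by rewrite (conv_gen0 a)// p1.
set t := (_, _); have [_ d' e'] := rho3P k1 t.
apply: (conv_gen a e d e' d'); first by rewrite p1 p2.
by move: p1 p2; rewrite {a d d' e'}/t; case: j => //= h _; congr (_, _, _); rewrite /=; lia.
Qed.

Lemma conv_rho4 k j s : conv_delta j (rho4 R k s) =
  oapp (fun i => \1_[set rho4 R k (i, s.2 - 1)]) 0 (raise4 j s.1).
Proof.
have [a d e] := rho4P k s; rewrite /raise4 /pprod !raiseE.
case p1: (in1 (gen_p1 j) 0 (Some s.1.1)); last by rewrite (conv_gen0 a)// p1.
case p2: (in1 (gen_p2 j) 0 (Some s.1.2)); last by rewrite (conv_gen0 a)// p2 andbF.
rewrite /=.
set t := (_, _); have [_ d' e'] := rho4P k t.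
apply: (conv_gen a e d e' d'); first by rewrite p1 p2.
by move: p1 p2; rewrite {a d d' e'}/t; case: j => //= h h'; congr (_, _, _); rewrite /=; lia.
Qed.

End Coordinates.

(** * Values of the representations Pi on basis vectors *)

Section GeneratorValues.
Variables (R : realType) (t0 : Cx R).

Lemma pull_op (X : choiceType) (h g : X -> option X) (V : ell2 R X -> ell2 R X) :
  (forall x y, h x = Some y <-> g y = Some x) -> (forall f, V f = t0 *: pull h f) ->
  bounded_op V /\ forall y, V (delta R y) = oapp (fun x => t0 *: delta R x) 0 (g y).
Proof.
move=> hg /funext ->; have hi : pinj h by move=> x y z /hg + /hg => -> [].
split; first exact: pull_bounded.
by move=> y; rewrite (pull_delta R y hg); case: (g y) => //=; rewrite scaler0.
Qed.

Lemma zero_op (X : choiceType) (V : ell2 R X -> ell2 R X) : (forall f, V f = 0) ->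
  bounded_op V /\ forall y, V (delta R y) = 0.
Proof.
move=> V0; split=> //; split=> [a f g|]; first by rewrite !V0 scaler0 addr0.
by exists 0 => f; rewrite V0 hnorm0 mul0r.
Qed.

Lemma Pi2_values j : bounded_op (Pi2 t0 j) /\
  forall i, Pi2 t0 j (delta R i) = oapp (fun i => t0 *: delta R i) 0 (raise2 j i).
Proof.
case: j; try exact: zero_op.
- by apply: pull_op (lowerP false) _ => f; rewrite /= SadjE.
- by apply: pull_op (lowerP true) _ => f; rewrite /= popE.
Qed.

Lemma Pi1_values j : bounded_op (Pi1 t0 j) /\
  forall i, Pi1 t0 j (delta R i) = oapp (fun i => t0 *: delta R i) 0 (raise3 j i).
Proof.
case: j; try exact: zero_op.
- by apply: pull_op (lowerP false) _ => f; rewrite /= SadjE.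
- by apply: pull_op (lowerP true) _ => f; rewrite /= popE.
Qed.

Lemma Pi12_values j : bounded_op (Pi12 t0 j) /\
  forall i, Pi12 t0 j (delta R i) = oapp (fun i => t0 *: delta R i) 0 (raise4 j i).
Proof.
apply: pull_op (pprodV (lowerP _) (lowerP _)) _ => f.
rewrite -tens_pull; try exact: pinj_lower.
by case: j; rewrite /= ?SadjE ?popE.
Qed.

Lemma Pi0_values j : bounded_op (@Pi0 R t0 j) /\
  forall i, @Pi0 R t0 j 1 = oapp (fun=> t0 *: (1 : scalarH R)) 0 (raise1 j i).
Proof.
case: j; split=> //; split;
  try by move=> a x y; rewrite /= ?scaler0 ?addr0 ?scalerDr// !scalerA mulrC.
- by exists (re `|t0|) => x; rewrite hnormZ.
all: by exists 0 => x; rewrite hnorm0 mul0r.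
Qed.

Lemma scalar_basis : orthonormal_basis (fun _ : unit => 1 : scalarH R).
Proof.
split=> [[] []|x eps eps0]; first by rewrite /= /Cip conjC1 mulr1.
exists [:: tt], (fun=> x); rewrite big_seq1.
by rewrite [x *: _]mulr1 subrr hnorm0.
Qed.

Lemma tensv_delta (X Y : choiceType) (x : X) (y : Y) :
  tensv (delta R x : ell2 R X) (delta R y) = delta R (x, y).
Proof.
by congr mk_l2; apply/funext => z; rewrite !deltaE -natrM mulnb -xpair_eqE -surjective_pairing.
Qed.

End GeneratorValues.

Unset Implicit Arguments.

Theorem theorem6p3 (R : realType) (t0 : Cx R) (t0T : `|t0| = 1) :
  [/\ (* units in the orbit of phi(oo, oo) *)
      forall (H : hilbert R) (kappa : (gpd R -> Cx R) -> H),
        induced_space t0 (phi None None) (@sigma1 R) kappa ->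
        let e (r : int) := kappa \1_[set sigma1 R r] in
        [/\ [/\ total_family e,
                forall r : int, orthonormal_basis (fun _ : unit => e r) &
                forall r1 r2 : int, ip (e r1) (e r2) = t0 ^ (r2 - r1)],
            exists2 U : H -> scalarH R, unitary U &
              forall r : int, U (e r) = t0 ^ (- r) &
            Ind_equivalent (phi None None) kappa (@Pi0 R t0)],
      (* units in the orbit of the phi(oo, k2) *)
      forall (k2 : nat) (H : hilbert R) (kappa : (gpd R -> Cx R) -> H),
        induced_space t0 (phi None (Some k2)) (fun r => rho2 R k2 (k2, r)) kappa ->
        let e (s : nat * int) := kappa \1_[set rho2 R k2 s] in
        [/\ orthonormal_basis (fun s1 : nat => e (s1, 0)) /\
            forall s u : nat * int,
              ip (e s) (e u) = (s.1 == u.1)%:R * t0 ^ (u.2 - s.2),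
            exists2 U : H -> ell2 R nat, unitary U &
              forall s : nat * int, U (e s) = t0 ^ (- s.2) *: delta R s.1 &
            Ind_equivalent (phi None (Some k2)) kappa (@Pi2 R t0)],
      (* units in the orbit of the phi(k1, oo) *)
      forall (k1 : nat) (H : hilbert R) (kappa : (gpd R -> Cx R) -> H),
        induced_space t0 (phi (Some k1) None) (fun r => rho3 R k1 (k1, r)) kappa ->
        let e (s : nat * int) := kappa \1_[set rho3 R k1 s] in
        [/\ orthonormal_basis (fun s1 : nat => e (s1, 0)) /\
            forall s u : nat * int,
              ip (e s) (e u) = (s.1 == u.1)%:R * t0 ^ (u.2 - s.2),
            exists2 U : H -> ell2 R nat, unitary U &
              forall s : nat * int, U (e s) = t0 ^ (- s.2) *: delta R s.1 &
            Ind_equivalent (phi (Some k1) None) kappa (@Pi1 R t0)] &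
      (* units in the orbit of the phi(k1, k2) *)
      forall (k : nat * nat) (H : hilbert R) (kappa : (gpd R -> Cx R) -> H),
        induced_space t0 (phi (Some k.1) (Some k.2)) (fun r => rho4 R k (k, r)) kappa ->
        let e (s : nat * nat * int) := kappa \1_[set rho4 R k s] in
        [/\ orthonormal_basis (fun s : nat * nat => e (s, 0)) /\
            forall s u : nat * nat * int,
              ip (e s) (e u) = (s.1 == u.1)%:R * t0 ^ (u.2 - s.2),
            exists2 U : H -> ell2 R (nat * nat)%type, unitary U &
              forall s : nat * nat * int,
                U (e s) = t0 ^ (- s.2) *: tensv (delta R s.1.1) (delta R s.1.2) &
            Ind_equivalent (phi (Some k.1) (Some k.2)) kappa (@Pi12 R t0)]].
Proof.
split.
- move=> H kappa Hk e.
  (* The orbit is a single point, hence the index type [unit]. *)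
  pose rho (s : unit * int) := sigma1 R s.2.
  have rho_inj : injective rho by move=> [[] r] [[] r'] /sigma1_inj /= ->.
  have rhoP g : fiber (phi None None) g <-> exists s, g = rho s.
    by rewrite fiber_sigma1; split=> [[r ->]|[[? r] ->]]; [exists (tt, r)|exists r].
  have rho_mul s n : gmul (rho s) (sigma1 R n) = rho (s.1, s.2 + n) by exact: sigma1_mul.
  have eip r1 r2 : ip (e r1) (e r2) = t0 ^ (r2 - r1).
    by have := ip_orbit rho_inj rhoP rho_mul Hk (tt, r1) (tt, r2); rewrite eqxx mul1r.
  have eT := orbit_total t0T rho_inj rhoP rho_mul Hk.
  have t0_neq0 : t0 != 0 by rewrite -normr_eq0 t0T oner_eq0.
  have e0 r : e 0 = t0 ^ r *: e r.
    rewrite [e r](orbit_shift t0T rho_inj rhoP rho_mul Hk tt r) scalerA -expfzDr//.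
    by rewrite subrr expr0z scale1r.
  have eTr r : total_family (fun _ : unit => e r).
    move=> x eps /(eT x)[s [c xs]]; exists s, (fun i => c i * t0 ^ r).
    by under eq_bigr do rewrite -scalerA -e0.
  split.
  + split; last exact: eip.
    (* The vector [e 0] alone is total; the list repeats the index 0 once for each entry of [s], so
       the two sums coincide. *)
    * move=> x eps /(eTr 0 x)[s [c xs]]; exists [seq (0 : int) | i <- s], (fun=> c tt).
      rewrite big_map (eq_bigr (fun i => c i *: e 0)); first exact: xs.
      by case.
    * move=> r; split; last exact: eTr.
      by move=> i j; rewrite eip subrr expr0z; case: i j => [] [].
  + have [U Uu Ue] := orbit_unitary t0T rho_inj rhoP rho_mul Hk (scalar_basis R).
    by exists U => // r; rewrite (Ue (tt, r)) /= [LHS]mulr1.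
  + apply: (orbit_equivalent t0T rho_inj rhoP rho_mul Hk (scalar_basis R) (sh := raise1)).
    * by move=> j; exact: (Pi0_values t0 j).1.
    * by move=> j i; exact: (Pi0_values t0 j).2.
    * exact: conv_sigma1.
- move=> k2 H kappa Hk e.
  have inj := @rho2_inj R k2; have fP := @fiber_rho2 R k2; have mP := @rho2_mul R k2.
  split.
  + split; first exact: (orbit_basis t0T inj fP mP Hk).
    exact: (ip_orbit inj fP mP Hk).
  + exact: (orbit_unitary t0T inj fP mP Hk (delta_basis R nat)).
  + apply: (orbit_equivalent t0T inj fP mP Hk (delta_basis R nat) (sh := raise2)).
    * by move=> j; exact: (Pi2_values t0 j).1.
    * by move=> j i; exact: (Pi2_values t0 j).2.
    * exact: conv_rho2.
- move=> k1 H kappa Hk e.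
  have inj := @rho3_inj R k1; have fP := @fiber_rho3 R k1; have mP := @rho3_mul R k1.
  split.
  + split; first exact: (orbit_basis t0T inj fP mP Hk).
    exact: (ip_orbit inj fP mP Hk).
  + exact: (orbit_unitary t0T inj fP mP Hk (delta_basis R nat)).
  + apply: (orbit_equivalent t0T inj fP mP Hk (delta_basis R nat) (sh := raise3)).
    * by move=> j; exact: (Pi1_values t0 j).1.
    * by move=> j i; exact: (Pi1_values t0 j).2.
    * exact: conv_rho3.
move=> k H kappa Hk e.
have inj := @rho4_inj R k; have fP := @fiber_rho4 R k; have mP := @rho4_mul R k.
split.
+ split; first exact: (orbit_basis t0T inj fP mP Hk).
  exact: (ip_orbit inj fP mP Hk).
+ have [U Uu Ue] := orbit_unitary t0T inj fP mP Hk (delta_basis R (nat * nat)%type).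
  by exists U => // -[[i j] r]; rewrite Ue tensv_delta.
+ apply: (orbit_equivalent t0T inj fP mP Hk (delta_basis R (nat * nat)%type) (sh := raise4)).
  * by move=> j; exact: (Pi12_values t0 j).1.
  * by move=> j i; exact: (Pi12_values t0 j).2.
  * exact: conv_rho4.
Qed.
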